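(* Let $v\in\mathbb{C}$, let $W\subset\mathbb{C}$ be a closed neighbourhood of $v$, and let $g: W\setminus\{v\}\to\mathbb{C}$ be a holomorphic function having an essential singularity at $v$. Suppose that $v$ is not a Picard exceptional value of $g$ near $v$. Then there exists a sequence $(q_n)$ of points of $W\setminus\{v\}$ with $q_n\to v$ such that each $q_n$ belongs to a $2$-cycle of $g$, i.e. $g(q_n)\in W\setminus\{v\}$, $g(g(q_n))=q_n$ and $g(q_n)\neq q_n$. Moreover, if $v$ is not a completely ramified value of $g$ near $v$, then the sequence $(q_n)$ can be chosen so that in addition these $2$-cycles are repulsive with multipliers diverging to $\infty$, i.e. $|(g\circ g)'(q_n)|>1$ for all $n$ and $|(g\circ g)'(q_n)|\to\infty$ as $n\to\infty$.
   Context: A closed neighbourhood of $v$ is a closed subset of $\mathbb{C}$ containing $v$ in its interior. The value $v$ is a Picard exceptional value of $g$ near $v$ if there is a punctured neighbourhood of the point $v$ in which $g$ does not take the value $v$. The value $v$ is a completely ramified value of $g$ near $v$ if there is a punctured neighbourhood of the point $v$ in which every solution $z$ of $g(z)=v$ satisfies $g'(z)=0$. A point $q$ is a periodic point of minimal period $2$ of $g$ (an element of a $2$-cycle) if $g(g(q))$ is defined, $g(g(q))=q$ and $g(q)\ne q$; its multiplier is $(g\circ g)'(q)$, and the cycle is called repulsive if this multiplier has modulus $>1$. *)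

(* Defs.v *)
From Stdlib Require Export Reals.
From Coquelicot Require Export Coquelicot.

Local Open Scope C_scope.

(* A function g : D -> C is represented by a total g : C -> C; every notion
   below either reads g on D only, or is local at v and used when D contains a
   punctured neighbourhood of v. *)

(* l is the complex derivative at z of the restriction of g to D; for D a
   neighbourhood of z this is [is_derive g z l]. *)
Definition is_derive_within (g : C -> C) (D : C -> Prop) (z l : C) : Prop :=
  filterdiff (K := C_AbsRing) (U := AbsRing_NormedModule C_AbsRing)
    (V := C_NormedModule) g
    (within D (locally (T := AbsRing_UniformSpace C_AbsRing) z))
    (fun y => scal y l).

(* D need not be open: at a point of D on its boundary only the values of g
   on D are taken into account. *)
Definition holomorphic_on (g : C -> C) (D : C -> Prop) : Prop :=
  forall z : C, D z -> exists l : C, is_derive_within g D z l.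

Definition punctured (W : C -> Prop) (v : C) : C -> Prop :=
  fun z => W z /\ z <> v.

Definition closed_neighbourhood (W : C -> Prop) (v : C) : Prop :=
  closed W /\ locally v W.

Definition removable_singularity (g : C -> C) (v : C) : Prop :=
  exists h : C -> C,
    locally v (fun z => ex_derive (K := C_AbsRing) (V := C_NormedModule) h z) /\
    locally' v (fun z => h z = g z).

Definition pole (g : C -> C) (v : C) : Prop :=
  filterlim (fun z => Cmod (g z)) (locally' v) (Rbar_locally p_infty).

Definition essential_singularity (g : C -> C) (v : C) : Prop :=
  locally' v (fun z => ex_derive (K := C_AbsRing) (V := C_NormedModule) g z) /\
  ~ removable_singularity g v /\
  ~ pole g v.

Definition picard_exceptional_value (g : C -> C) (v : C) : Prop :=
  locally' v (fun z => g z <> v).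

Definition completely_ramified_value (g : C -> C) (v : C) : Prop :=
  locally' v (fun z => g z = v ->
    is_derive (K := C_AbsRing) (V := C_NormedModule) g z (RtoC 0)).

Definition in_2_cycle (g : C -> C) (D : C -> Prop) (q : C) : Prop :=
  D q /\ D (g q) /\ g (g q) = q /\ g q <> q.

(* The derivative is that of the total function g o g, hence does not depend on
   the values of g outside its domain as soon as q and g q are interior to it. *)
Definition has_multiplier_2 (g : C -> C) (q mu : C) : Prop :=
  is_derive (K := C_AbsRing) (V := C_NormedModule) (fun z => g (g z)) q mu.

Definition repulsive (mu : C) : Prop := (1 < Cmod mu)%R.

(* Main.v *)
(* Suppose g has five distinct preimages a of v close to v.  The key step is that for one
   of them g has, in every punctured neighbourhood of v, a holomorphic section phi over a
   fixed disc around a.  As phi is uniformly close to v and g - v has an isolated zero at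
   a, the equation g(q) = phi(q) has a solution q near a, so that g(g(q)) = q.  The
   multiplier is g'(q) / phi'(q); it is large when g'(a) <> 0, because phi' is small.

   To find the section, rescale g near v as in Zalcman's lemma, measuring g' against a gauge
   of order |g| log |g|: along an ultrafilter, the rescaled functions have a nonconstant
   entire limit F.  If all the points where F takes one of the five values a_i were
   multiple, then |F'|^2 would be bounded by a constant times |F - a_i| near them, so
   F'^2 / prod (F - a_i) would extend to a bounded entire function tending to 0 along a
   sequence on which F tends to infinity; it would vanish by Liouville's theorem.  Hence
   F has a simple a_i-point, and near it the rescaled functions can be inverted. *)

Require Import Defs.
From Stdlib Require Import Lra Psatz Classical ClassicalEpsilon List.
From mathcomp Require filter.

Local Open Scope R_scope.
Local Open Scope C_scope.

(** * Complex derivatives *)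

(** The gauge is squeezed between two demands. It must exceed the bound 2 |F| ln |F| that a
    holomorphic F with |F| > 1 on the unit disc imposes on |F'(0)|: this forces every rescaled
    function to be at most 1 in modulus somewhere near 0, so that no limit is infinite. And the
    integral of dx / gauge x must diverge, so that |F'| <= k gauge |F| prevents blow-up over bounded
    distances. The order x log x does both.

    The number five comes from the crude estimate gauge x <= 2 (1 + x)^2: |F'|^2 is of order at most
    |F|^4, and five factors F - a_i outweigh it.

    Essential means neither removable nor a pole: g is unbounded near v, yet returns to a bounded
    set arbitrarily close to v. The two together make |z - v| |g'| / gauge |g| unbounded, which
    starts the rescaling.

    A preimage a may be a multiple solution of g = v, where g has no local inverse. Hence the cycle
    is found as a zero of g - phi by comparison on a circle round a, and simplicity of a matters
    only for the multiplier. That circle is fixed before phi is chosen close to v, so the sections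
    must share one disc. *)

Definition cderiv (f : C -> C) (z l : C) : Prop :=
  forall eps : R, 0 < eps -> exists d : R, 0 < d /\
    forall h : C, Cmod h < d -> Cmod (f (z + h) - f z - l * h) <= eps * Cmod h.

(** Balls of [C_UniformSpace] are squares; comparing them with discs costs a factor sqrt 2, absorbed
    once and for all in [locally_Cmod]. *)
Lemma ball_Cmod (x y : C) (eps : R) :
  Cmod (y - x) < eps -> @ball C_UniformSpace x eps y.
Proof. exact (C_NormedModule_mixin_compat1 x y eps). Qed.

Lemma Cmod_ball (x y : C) (eps : posreal) :
  @ball C_UniformSpace x eps y -> Cmod (y - x) < sqrt 2 * eps.
Proof. exact (C_NormedModule_mixin_compat2 x y eps). Qed.

Lemma sqrt2_bounds : 1 < sqrt 2 < 2.
Proof.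
  pose proof (sqrt_sqrt 2 ltac:(lra)). pose proof (sqrt_pos 2). split; nra.
Qed.

Lemma locally_Cmod (x : C) (P : C -> Prop) :
  @locally C_UniformSpace x P <->
  exists d : R, 0 < d /\ forall y, Cmod (y - x) < d -> P y.
Proof.
  split.
  - intros [d Hd]. exists d. split; [apply cond_pos|].
    intros y Hy. apply Hd, ball_Cmod, Hy.
  - intros [d [Hd H]]. pose proof sqrt2_bounds.
    assert (Hd2 : 0 < d / 2) by lra.
    exists (mkposreal _ Hd2). intros y Hy. apply H.
    apply Cmod_ball in Hy. simpl in Hy. nra.
Qed.

Lemma locally'_Cmod (x : C) (P : C -> Prop) :
  @locally' C_UniformSpace x P <->
  exists d : R, 0 < d /\ forall y, y <> x -> Cmod (y - x) < d -> P y.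
Proof.
  unfold locally', within. rewrite locally_Cmod. split.
  - intros [d [Hd H]]. exists d. split; auto.
  - intros [d [Hd H]]. exists d. split; auto.
Qed.

(** The filter in [is_derive] comes from the uniformity of the ring [C_AbsRing], the discs from the
    product uniformity; [locally_C] mediates between them. From here on all analysis is done with
    epsilon and delta. *)
Lemma is_derive_cderiv (f : C -> C) (z l : C) :
  is_derive (K := C_AbsRing) (V := C_NormedModule) f z l <-> cderiv f z l.
Proof.
  split.
  - intros [_ H] eps Heps.
    specialize (H z (fun P HP => HP) (mkposreal eps Heps)).
    apply locally_C, locally_Cmod in H. destruct H as [d [Hd H]].
    exists d. split; auto. intros h Hh.
    specialize (H (z + h)).
    replace (z + h - z)%C with h in H by ring. specialize (H Hh).
    change (Cmod (f (z + h) - f z - ((z + h - z) * l)) <=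
            eps * Cmod (z + h - z)) in H.
    replace (z + h - z)%C with h in H by ring.
    now rewrite (Cmult_comm l h).
  - intros H. split.
    + apply (@is_linear_scal_l C_AbsRing C_NormedModule l).
    + intros x Hx eps.
      assert (E : x = z) by (symmetry; now apply (@is_filter_lim_locally_unique C_AbsRing (AbsRing_NormedModule C_AbsRing))).
      subst x. apply locally_C, locally_Cmod.
      destruct (H eps (cond_pos eps)) as [d [Hd Hd']].
      exists d. split; auto. intros y Hy.
      specialize (Hd' (y - z) Hy). replace (z + (y - z))%C with y in Hd' by ring.
      rewrite (Cmult_comm l (y - z)) in Hd'. exact Hd'.
Qed.

(** The library rules for products and compositions are stated for the ring as a module over itself;
    this equivalence imports them. *)
Lemma is_derive_ring_cderiv (f : C -> C) (z l : C) :
  is_derive (K := C_AbsRing) (V := AbsRing_NormedModule C_AbsRing) f z l <-> cderiv f z l.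
Proof.
  rewrite <- is_derive_cderiv. split; intros [H1 H2]; (split; [|exact H2]).
  apply (@is_linear_scal_l C_AbsRing C_NormedModule).
  apply (@is_linear_scal_l C_AbsRing (AbsRing_NormedModule C_AbsRing)).
Qed.

Lemma cderiv_const (c z : C) : cderiv (fun _ => c) z 0.
Proof. apply is_derive_cderiv, (@is_derive_const C_AbsRing C_NormedModule). Qed.

Lemma cderiv_id (z : C) : cderiv (fun w => w) z 1.
Proof. apply is_derive_ring_cderiv, (@is_derive_id C_AbsRing). Qed.

Lemma cderiv_plus (f g : C -> C) (z l m : C) :
  cderiv f z l -> cderiv g z m -> cderiv (fun w => f w + g w) z (l + m).
Proof.
  rewrite <- !is_derive_cderiv. apply (@is_derive_plus C_AbsRing C_NormedModule).
Qed.

Lemma cderiv_mult (f g : C -> C) (z l m : C) :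
  cderiv f z l -> cderiv g z m ->
  cderiv (fun w => f w * g w) z (l * g z + f z * m).
Proof.
  rewrite <- !is_derive_ring_cderiv. intros Hf Hg.
  apply (@is_derive_mult C_AbsRing); auto. intros; apply Cmult_comm.
Qed.

Lemma cderiv_comp (f g : C -> C) (z l m : C) :
  cderiv f (g z) l -> cderiv g z m -> cderiv (fun w => f (g w)) z (l * m).
Proof.
  rewrite <- !is_derive_ring_cderiv, (Cmult_comm l).
  apply (@is_derive_comp C_AbsRing (AbsRing_NormedModule C_AbsRing)).
Qed.

Lemma ex_derive_cderiv (f : C -> C) (z : C) :
  ex_derive (K := C_AbsRing) (V := C_NormedModule) f z <-> exists l, cderiv f z l.
Proof.
  split; intros [l Hl]; exists l; now apply is_derive_cderiv.
Qed.

Lemma Cmod_triangle_minus (x y : C) : Cmod (x - y) <= Cmod x + Cmod y.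
Proof.
  unfold Cminus. rewrite <- (Cmod_opp y). apply Cmod_triangle.
Qed.

Lemma Cmod_minus_sym (x y : C) : Cmod (x - y) = Cmod (y - x).
Proof. rewrite <- Cmod_opp. f_equal. ring. Qed.

Lemma Cmod_reverse (x y : C) : Cmod x - Cmod y <= Cmod (x - y).
Proof.
  pose proof (Cmod_triangle (x - y) y). replace (x - y + y) with x in H by ring. lra.
Qed.

Lemma Cmod_dist (x y z : C) : Cmod (x - z) <= Cmod (x - y) + Cmod (y - z).
Proof. replace (x - z) with ((x - y) + (y - z)) by ring. apply Cmod_triangle. Qed.

Lemma Cmod_pos (x : C) : x <> 0 -> 0 < Cmod x.
Proof. apply Cmod_gt_0. Qed.

Lemma Cmod_RtoC (x : R) : 0 <= x -> Cmod x = x.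
Proof. intros. rewrite Cmod_R. apply Rabs_pos_eq; auto. Qed.

Lemma Cminus_eq_0 (x y : C) : x - y = 0 -> x = y.
Proof. intros H. replace x with (x - y + y) by ring. rewrite H. ring. Qed.

Lemma Cminus_neq_0 (x y : C) : x <> y -> x - y <> 0.
Proof. intros H E. apply H, Cminus_eq_0, E. Qed.

Lemma cderiv_ext_loc (f g : C -> C) (z l : C) (r : R) : 0 < r ->
  (forall w, Cmod (w - z) < r -> f w = g w) -> cderiv f z l -> cderiv g z l.
Proof.
  intros Hr E H eps He. destruct (H eps He) as [d [Hd H']].
  exists (Rmin d r). split. apply Rmin_pos; auto.
  intros h Hh. rewrite <- !E.
  - apply H'. apply Rlt_le_trans with (1 := Hh), Rmin_l.
  - replace (z - z) with (RtoC 0) by ring. now rewrite Cmod_0.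
  - replace (z + h - z) with h by ring. apply Rlt_le_trans with (1 := Hh), Rmin_r.
Qed.

Lemma cderiv_ext (f g : C -> C) (z l : C) :
  (forall w, f w = g w) -> cderiv f z l -> cderiv g z l.
Proof. intros E. apply cderiv_ext_loc with 1%R. lra. auto. Qed.

Lemma cderiv_eq (f : C -> C) (z l m : C) : l = m -> cderiv f z l -> cderiv f z m.
Proof. now intros ->. Qed.

Lemma cderiv_lip (f : C -> C) (z l : C) : cderiv f z l ->
  exists d : R, 0 < d /\ forall h, Cmod h < d ->
    Cmod (f (z + h) - f z) <= (Cmod l + 1) * Cmod h.
Proof.
  intros H. destruct (H 1%R Rlt_0_1) as [d [Hd H']].
  exists d. split; auto. intros h Hh. specialize (H' h Hh).
  replace (f (z + h) - f z) with ((f (z + h) - f z - l * h) + l * h) by ring.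
  eapply Rle_trans. apply Cmod_triangle. rewrite Cmod_mult. lra.
Qed.

Definition ccont (f : C -> C) (z : C) : Prop :=
  forall eps : R, 0 < eps -> exists d : R, 0 < d /\
    forall w : C, Cmod (w - z) < d -> Cmod (f w - f z) < eps.

Lemma ccont_continuous (f : C -> C) (z : C) : ccont f z <->
  @continuous (AbsRing_UniformSpace C_AbsRing) (AbsRing_UniformSpace C_AbsRing) f z.
Proof.
  split.
  - intros H P [e He]. destruct (H e (cond_pos e)) as [d [Hd Hf]]. exists (mkposreal d Hd).
    intros w Hw. apply He, Hf, Hw.
  - intros H eps He. destruct (H (fun y => Cmod (y - f z) < eps)) as [d Hd].
    exists (mkposreal eps He). auto.
    exists d. split. apply cond_pos. exact Hd.
Qed.

Lemma cderiv_ccont (f : C -> C) (z l : C) : cderiv f z l -> ccont f z.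
Proof.
  intros H eps He. destruct (cderiv_lip f z l H) as [d [Hd H']].
  pose proof (Cmod_ge_0 l).
  assert (0 < eps / (Cmod l + 1)) by (apply Rdiv_lt_0_compat; lra).
  exists (Rmin d (eps / (Cmod l + 1))). split. apply Rmin_pos; auto.
  intros w Hw. specialize (H' (w - z)). replace (z + (w - z)) with w in H' by ring.
  eapply Rle_lt_trans. apply H'. apply Rlt_le_trans with (1 := Hw), Rmin_l.
  apply Rlt_le_trans with ((Cmod l + 1) * (eps / (Cmod l + 1)))%R.
  apply Rmult_lt_compat_l. lra. apply Rlt_le_trans with (1 := Hw), Rmin_r.
  right. field. lra.
Qed.

Lemma cderiv_scal (c : C) (f : C -> C) (z l : C) :
  cderiv f z l -> cderiv (fun w => c * f w) z (c * l).
Proof.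
  intros H. pose proof (cderiv_mult _ _ z _ _ (cderiv_const c z) H).
  replace (c * l) with (0 * f z + c * l) by ring. exact H0.
Qed.

Lemma cderiv_opp (f : C -> C) (z l : C) : cderiv f z l -> cderiv (fun w => - f w) z (- l).
Proof.
  intros H. apply cderiv_ext with (fun w => (-1) * f w). intros; ring.
  replace (- l) with ((-1) * l) by ring. now apply cderiv_scal.
Qed.

Lemma cderiv_minus (f g : C -> C) (z l m : C) :
  cderiv f z l -> cderiv g z m -> cderiv (fun w => f w - g w) z (l - m).
Proof. intros. apply cderiv_plus; auto. now apply cderiv_opp. Qed.

Lemma cderiv_Cinv (z : C) : z <> 0 -> cderiv (fun w => / w) z (- / (z * z)).
Proof.
  intros Hz eps He. pose proof (Cmod_pos _ Hz) as P.
  set (a := Cmod z) in *.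
  (* The error term is h^2 / (z^2 (z + h)), and |z + h| >= a / 2 as soon as |h| < a / 2. *)
  set (d := Rmin (a / 2) (eps * (a * a * a) / 2)%R).
  assert (0 < a * a * a)%R by (repeat apply Rmult_lt_0_compat; auto).
  assert (0 < d) by (unfold d; apply Rmin_pos; [lra|]; nra).
  exists d. split; auto. intros h Hh.
  destruct (proj1 (Rmin_Rgt _ _ _) Hh) as [h1 h2].
  assert (h3 : a / 2 <= Cmod (z + h)).
  { pose proof (Cmod_reverse z (- h)). rewrite Cmod_opp in H1.
    replace (z - - h) with (z + h) in H1 by ring. unfold a in *. lra. }
  assert (Hzh : z + h <> 0) by (intros E; rewrite E, Cmod_0 in h3; lra).
  replace (/ (z + h) - / z - - / (z * z) * h) with (h * h / (z * z * (z + h)))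
    by (field; repeat split; auto).
  rewrite Cmod_div, !Cmod_mult. fold a.
  2: repeat apply Cmult_neq_0; auto.
  pose proof (Cmod_ge_0 h).
  apply Rle_trans with (Cmod h * Cmod h / (a * a * (a / 2)))%R.
  - unfold Rdiv at 1 2. apply Rmult_le_compat_l. nra. apply Rinv_le_contravar. nra.
    apply Rmult_le_compat_l; nra.
  - apply Rle_trans with (Cmod h * (eps * (a * a * a) / 2) / (a * a * (a / 2)))%R.
    + unfold Rdiv. apply Rmult_le_compat_r. left. apply Rinv_0_lt_compat. nra.
      apply Rmult_le_compat_l; auto. unfold Rdiv in h2. lra.
    + right. field. lra.
Qed.

Lemma cderiv_inv (f : C -> C) (z l : C) : f z <> 0 ->
  cderiv f z l -> cderiv (fun w => / f w) z (- / (f z * f z) * l).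
Proof. intros Hz H. apply (cderiv_comp (fun w => / w)); auto. now apply cderiv_Cinv. Qed.

Lemma cderiv_div (f g : C -> C) (z l m : C) : g z <> 0 ->
  cderiv f z l -> cderiv g z m ->
  cderiv (fun w => f w / g w) z ((l * g z - f z * m) / (g z * g z)).
Proof.
  intros Hz Hf Hg. pose proof (cderiv_mult _ _ _ _ _ Hf (cderiv_inv _ _ _ Hz Hg)).
  replace ((l * g z - f z * m) / (g z * g z)) with
     (l * / g z + f z * (- / (g z * g z) * m)) by (field; auto). exact H.
Qed.

Lemma cderiv_unique (f : C -> C) (z l m : C) : cderiv f z l -> cderiv f z m -> l = m.
Proof.
  rewrite <- !is_derive_cderiv. intros Hl Hm.
  now rewrite <- (is_C_derive_unique f z l Hl), (is_C_derive_unique f z m Hm).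
Qed.

(** * Mean value inequality and integrals *)

Lemma Re_plus (x y : C) : Re (x + y) = (Re x + Re y)%R. Proof. reflexivity. Qed.
Lemma Re_minus (x y : C) : Re (x - y) = (Re x - Re y)%R. Proof. reflexivity. Qed.
Lemma Im_plus (x y : C) : Im (x + y) = (Im x + Im y)%R. Proof. reflexivity. Qed.
Lemma Im_minus (x y : C) : Im (x - y) = (Im x - Im y)%R. Proof. reflexivity. Qed.
Lemma Re_mult_R (t : R) (x : C) : Re (x * t) = (Re x * t)%R.
Proof. destruct x. simpl. ring. Qed.
Definition rderiv (f : R -> C) (t : R) (l : C) : Prop :=
  forall eps : R, 0 < eps -> exists d : R, 0 < d /\
    forall s : R, Rabs s < d -> Cmod (f (t + s)%R - f t - l * s) <= eps * Rabs s.

Lemma Cmod_scaled_small (h : C) (s d : R) : 0 < d -> Rabs s < d / (Cmod h + 1) -> Cmod (s * h) < d.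
Proof.
  intros Hd Hs. pose proof (Cmod_ge_0 h). rewrite Cmod_mult, Cmod_R.
  apply Rle_lt_trans with (Rabs s * (Cmod h + 1))%R. pose proof (Rabs_pos s). nra.
  apply Rlt_le_trans with (d / (Cmod h + 1) * (Cmod h + 1))%R.
  apply Rmult_lt_compat_r; lra. right. field. lra.
Qed.

Lemma rderiv_line (F : C -> C) (z h l : C) (t : R) :
  cderiv F (z + t * h) l -> rderiv (fun s : R => F (z + s * h)) t (l * h).
Proof.
  intros H eps He. pose proof (Cmod_ge_0 h).
  destruct (H (eps / (Cmod h + 1))%R) as [d [Hd H']]. apply Rdiv_lt_0_compat; lra.
  exists (d / (Cmod h + 1))%R. split. apply Rdiv_lt_0_compat; lra.
  intros s Hs. specialize (H' (s * h) (Cmod_scaled_small h s d Hd Hs)).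
  replace (z + t * h + s * h) with (z + (t + s)%R * h) in H' by (rewrite RtoC_plus; ring).
  replace (l * h * s) with (l * (s * h)) by ring.
  eapply Rle_trans. apply H'. rewrite Cmod_mult, Cmod_R. pose proof (Rabs_pos s).
  apply Rle_trans with (eps / (Cmod h + 1) * (Rabs s * (Cmod h + 1)))%R.
  apply Rmult_le_compat_l; [|nra]. left. apply Rdiv_lt_0_compat; lra. right. field. lra.
Qed.

Lemma is_derive_Re (f : R -> C) (t : R) (l : C) :
  rderiv f t l -> is_derive (fun s => Re (f s)) t (Re l).
Proof.
  intros H. apply is_derive_Reals. intros eps He.
  destruct (H (eps / 2)%R ltac:(lra)) as [d [Hd H']].
  exists (mkposreal d Hd). intros s Hs0 Hs. specialize (H' s Hs).
  pose proof (Rabs_pos_lt s Hs0) as P.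
  replace ((Re (f (t + s)%R) - Re (f t)) / s - Re l)%R with (Re (f (t + s)%R - f t - l * s)%C / s)%R
    by (rewrite !Re_minus, Re_mult_R; field; auto).
  rewrite Rabs_div by auto. apply Rmult_lt_reg_r with (Rabs s); auto.
  unfold Rdiv. rewrite Rmult_assoc, Rinv_l, Rmult_1_r by lra.
  eapply Rle_lt_trans. apply re_le_Cmod. nra.
Qed.

Lemma is_derive_line (F : C -> C) (c z h l : C) (t : R) :
  cderiv F (z + t * h) l ->
  is_derive (fun s : R => Re (c * F (z + s * h))) t (Re (c * l * h)).
Proof.
  intros H. apply is_derive_Re, (rderiv_line (fun w => c * F w)), cderiv_scal, H.
Qed.

(** Rotating w onto the positive axis turns its modulus into a real part, to which one-variable real
    analysis applies. *)
Lemma Re_conj_unit (w : C) : exists c : C, Cmod c = 1%R /\ c * w = Cmod w.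
Proof.
  destruct (classic (w = 0)) as [->|Hw].
  - exists 1. rewrite Cmod_1, Cmod_0. split; auto. ring.
  - pose proof (Cmod_pos _ Hw). exists (Cconj w / Cmod w). split.
    + rewrite Cmod_div, Cmod_conj, Cmod_R, Rabs_pos_eq. field. lra. lra.
      intros E. apply RtoC_inj in E. lra.
    + assert (E : RtoC (Cmod w) <> 0) by (intros E; apply RtoC_inj in E; lra).
      replace (Cconj w / Cmod w * w) with (w * Cconj w / Cmod w) by (field; auto).
      rewrite <- Cmod2_conj. rewrite RtoC_pow. field. auto.
Qed.

(** The real mean value theorem for Re (c F) along the segment, with c unimodular and chosen so that
    c times the increment of F is its modulus. *)
Lemma mean_value_ineq (F F' : C -> C) (z h : C) (M : R) :
  (forall t, 0 <= t <= 1 -> cderiv F (z + t * h) (F' (z + t * h))) ->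
  (forall t, 0 <= t <= 1 -> Cmod (F' (z + t * h)) <= M) ->
  Cmod (F (z + h) - F z) <= M * Cmod h.
Proof.
  intros HF HM. destruct (Re_conj_unit (F (z + h) - F z)) as [c [Hc E]].
  destruct (MVT_gen (fun s : R => Re (c * F (z + s * h))) 0 1
     (fun t => Re (c * F' (z + t * h) * h))) as [t [Ht Et]].
  - intros x. rewrite Rmin_left, Rmax_right by lra. intros Hx.
    apply is_derive_line, HF. lra.
  - intros x. rewrite Rmin_left, Rmax_right by lra. intros Hx.
    apply continuity_pt_filterlim.
    apply (@ex_derive_continuous R_AbsRing R_NormedModule).
    eexists. apply is_derive_line, HF. lra.
  - rewrite Rmin_left, Rmax_right in Ht by lra.
    replace (z + 1%R * h) with (z + h) in Et by ring.
    replace (z + 0%R * h) with z in Et by ring.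
    rewrite <- Re_minus in Et.
    replace (c * F (z + h) - c * F z) with (c * (F (z + h) - F z)) in Et by ring.
    rewrite E in Et. simpl Re in Et at 1. rewrite Et.
    eapply Rle_trans. apply Rle_abs. rewrite Rminus_0_r, Rmult_1_r.
    eapply Rle_trans. apply re_le_Cmod. rewrite !Cmod_mult, Hc, Rmult_1_l.
    apply Rmult_le_compat_r. apply Cmod_ge_0. auto.
Qed.

Lemma mean_value_ineq_affine (F F' : C -> C) (A z h : C) (M : R) :
  (forall t, 0 <= t <= 1 -> cderiv F (z + t * h) (F' (z + t * h))) ->
  (forall t, 0 <= t <= 1 -> Cmod (F' (z + t * h) - A) <= M) ->
  Cmod (F (z + h) - F z - A * h) <= M * Cmod h.
Proof.
  intros HF HM.
  pose proof (mean_value_ineq (fun w => F w - A * w) (fun w => F' w - A * 1) z h M).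
  replace (F (z + h) - F z - A * h) with
    (F (z + h) - A * (z + h) - (F z - A * z)) by ring.
  apply H.
  - intros t Ht. apply cderiv_minus; auto. apply cderiv_scal, cderiv_id.
  - intros t Ht. rewrite Cmult_1_r. auto.
Qed.

(** * Integrals of complex-valued functions on an interval *)

Definition CRInt (f : R -> C) (a b : R) : C := @RInt C_R_CompleteNormedModule f a b.

Definition rcont (f : R -> C) (t : R) : Prop :=
  forall eps : R, 0 < eps -> exists d : R, 0 < d /\
    forall s : R, Rabs (s - t) < d -> Cmod (f s - f t) < eps.

Lemma rcont_continuous (f : R -> C) (t : R) :
  rcont f t <-> @continuous R_UniformSpace C_UniformSpace f t.
Proof.
  split.
  - intros H P HP. apply locally_Cmod in HP. destruct HP as [d [Hd HP]].
    destruct (H d Hd) as [e [He H']]. exists (mkposreal e He).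
    intros s Hs. apply HP, H'. exact Hs.
  - intros H eps He. destruct (H (fun y => Cmod (y - f t) < eps)) as [d Hd].
    apply locally_Cmod. exists eps. auto.
    exists d. split. apply cond_pos. intros s Hs. apply Hd. exact Hs.
Qed.

Lemma rcont_ex_RInt (f : R -> C) (a b : R) : a <= b ->
  (forall t, a <= t <= b -> rcont f t) -> @ex_RInt C_R_NormedModule f a b.
Proof.
  intros Hab H. apply (@ex_RInt_continuous C_R_CompleteNormedModule).
  intros z. rewrite Rmin_left, Rmax_right by auto. intros Hz.
  apply rcont_continuous; auto.
Qed.

Lemma CRInt_bound (f : R -> C) (a b M : R) : a <= b ->
  (forall t, a <= t <= b -> rcont f t) ->
  (forall t, a <= t <= b -> Cmod (f t) <= M) -> Cmod (CRInt f a b) <= (b - a) * M.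
Proof.
  intros Hab Hc HM. pose proof (rcont_ex_RInt f a b Hab Hc) as E.
  apply (@RInt_correct C_R_CompleteNormedModule) in E.
  pose proof (fun lf => @norm_RInt_le_const C_R_NormedModule f a b lf M Hab) as N.
  unfold CRInt. rewrite Cmod_norm. apply N; auto.
  intros x Hx. eapply Rle_trans; [|apply HM, Hx]. right. symmetry. apply Cmod_norm.
Qed.

Lemma CRInt_ext (f g : R -> C) (a b : R) : a <= b ->
  (forall t, a <= t <= b -> f t = g t) -> CRInt f a b = CRInt g a b.
Proof.
  intros Hab H. apply (@RInt_ext C_R_CompleteNormedModule).
  intros x. rewrite Rmin_left, Rmax_right by auto. intros. apply H. lra.
Qed.

Lemma CRInt_minus (f g : R -> C) (a b : R) : a <= b ->
  (forall t, a <= t <= b -> rcont f t) -> (forall t, a <= t <= b -> rcont g t) ->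
  CRInt (fun t => f t - g t) a b = CRInt f a b - CRInt g a b.
Proof.
  intros Hab Hf Hg.
  exact (@RInt_minus C_R_CompleteNormedModule f g a b (rcont_ex_RInt f a b Hab Hf)
    (rcont_ex_RInt g a b Hab Hg)).
Qed.

Lemma CRInt_Chasles (f : R -> C) (a b c : R) : a <= b -> b <= c ->
  (forall t, a <= t <= c -> rcont f t) ->
  CRInt f a b + CRInt f b c = CRInt f a c.
Proof.
  intros Hab Hbc Hf.
  apply (@RInt_Chasles C_R_CompleteNormedModule f a b c);
   apply rcont_ex_RInt; auto; intros; apply Hf; lra.
Qed.

Lemma rderiv_is_derive (f : R -> C) (t : R) (l : C) :
  rderiv f t l -> @is_derive R_AbsRing C_R_NormedModule f t l.
Proof.
  intros H. split.
  - apply (@is_linear_scal_l R_AbsRing C_R_NormedModule l).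
  - intros x Hx eps.
    assert (E : x = t) by (symmetry; now apply (@is_filter_lim_locally_unique R_AbsRing (AbsRing_NormedModule R_AbsRing))).
    subst x. destruct (H eps (cond_pos eps)) as [d [Hd H']].
    exists (mkposreal d Hd). intros s Hs.
    specialize (H' (s - t)%R Hs).
    assert (E0 : forall u : R, (t + (u - t))%R = u) by (intros; ring). rewrite E0 in H'.
    assert (E : (l * (s - t)%R)%C = @scal R_AbsRing C_R_NormedModule (s - t)%R l).
    { rewrite scal_R_Cmult. ring. }
    rewrite E in H'. rewrite Cmod_norm in H'. exact H'.
Qed.

Lemma CRInt_FTC (f df : R -> C) (a b : R) : a <= b ->
  (forall t, a <= t <= b -> rderiv f t (df t)) ->
  (forall t, a <= t <= b -> rcont df t) -> CRInt df a b = f b - f a.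
Proof.
  intros Hab Hf Hc. apply (@is_RInt_unique C_R_CompleteNormedModule).
  apply (@is_RInt_derive C_R_CompleteNormedModule);
   intros x; rewrite Rmin_left, Rmax_right by auto; intros Hx.
  - apply rderiv_is_derive; auto.
  - apply rcont_continuous; auto.
Qed.

Lemma rcont_line (F : C -> C) (z h : C) (t : R) :
  ccont F (z + t * h) -> rcont (fun s : R => F (z + s * h)) t.
Proof.
  intros H eps He. destruct (H eps He) as [d [Hd H']]. pose proof (Cmod_ge_0 h).
  exists (d / (Cmod h + 1))%R. split. apply Rdiv_lt_0_compat; lra.
  intros s Hs. apply H'.
  replace (z + s * h - (z + t * h)) with ((s - t)%R * h) by (rewrite RtoC_minus; ring).
  now apply Cmod_scaled_small.
Qed.

(** * Goursat's theorem *)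

Definition int_h (f : C -> C) (x0 x1 y : R) : C := CRInt (fun x => f (x, y)) x0 x1.
Definition int_v (f : C -> C) (x y0 y1 : R) : C := CRInt (fun y => f (x, y)) y0 y1.
(** The contour integral along the boundary, counterclockwise; the factor [Ci] is dz = i dy on
    vertical sides. *)
Definition rect_int (f : C -> C) (x0 x1 y0 y1 : R) : C :=
  int_h f x0 x1 y0 + Ci * int_v f x1 y0 y1 - int_h f x0 x1 y1 - Ci * int_v f x0 y0 y1.

Lemma pair_horizontal (x y : R) : ((x, y) : C) = (0%R, y) + x * 1.
Proof. apply injective_projections; simpl; ring. Qed.

Lemma pair_vertical (x y : R) : ((x, y) : C) = (x, 0%R) + y * Ci.
Proof. apply injective_projections; simpl; ring. Qed.

Lemma rcont_ext (f g : R -> C) (t : R) : (forall s, f s = g s) -> rcont f t -> rcont g t.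
Proof.
  intros E H eps He. destruct (H eps He) as [d [Hd H']]. exists d. split; auto.
  intros s Hs. rewrite <- !E. auto.
Qed.

Lemma rderiv_ext (f g : R -> C) (t : R) (l : C) :
  (forall s, f s = g s) -> rderiv f t l -> rderiv g t l.
Proof.
  intros E H eps He. destruct (H eps He) as [d [Hd H']]. exists d. split; auto.
  intros s Hs. rewrite <- !E. auto.
Qed.

Lemma rcont_horizontal (f : C -> C) (x y : R) :
  ccont f (x, y) -> rcont (fun s => f (s, y)) x.
Proof.
  intros H. apply rcont_ext with (fun s => f ((0%R, y) + s * 1)).
  intros s. f_equal. symmetry. apply pair_horizontal.
  apply rcont_line. now rewrite <- pair_horizontal.
Qed.

Lemma rcont_vertical (f : C -> C) (x y : R) :
  ccont f (x, y) -> rcont (fun s => f (x, s)) y.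
Proof.
  intros H. apply rcont_ext with (fun s => f ((x, 0%R) + s * Ci)).
  intros s. f_equal. symmetry. apply pair_vertical.
  apply rcont_line. now rewrite <- pair_vertical.
Qed.

Lemma int_h_FTC (F f : C -> C) (x0 x1 y : R) : x0 <= x1 ->
  (forall x, x0 <= x <= x1 -> cderiv F (x, y) (f (x, y))) ->
  (forall x, x0 <= x <= x1 -> ccont f (x, y)) ->
  int_h f x0 x1 y = F (x1, y) - F (x0, y).
Proof.
  intros Hx HF Hf. apply (CRInt_FTC (fun x => F (x, y))); auto.
  - intros t Ht. apply rderiv_ext with (fun s => F ((0%R, y) + s * 1)).
    intros s. f_equal. symmetry. apply pair_horizontal.
    replace (f (t, y)) with (f (t, y) * 1) by ring.
    apply rderiv_line. rewrite <- pair_horizontal. auto.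
  - intros t Ht. apply rcont_horizontal; auto.
Qed.

Lemma int_v_FTC (F f : C -> C) (x y0 y1 : R) : y0 <= y1 ->
  (forall y, y0 <= y <= y1 -> cderiv F (x, y) (f (x, y))) ->
  (forall y, y0 <= y <= y1 -> ccont f (x, y)) ->
  Ci * int_v f x y0 y1 = F (x, y1) - F (x, y0).
Proof.
  intros Hx HF Hf.
  replace (F (x, y1) - F (x, y0)) with (Ci * (- Ci * F (x, y1) - - Ci * F (x, y0))).
  2:{ replace (Ci * (- Ci * F (x, y1) - - Ci * F (x, y0))) with
      (- (Ci * Ci) * (F (x, y1) - F (x, y0))) by ring.
      replace (- (Ci * Ci)) with (RtoC 1). ring.
      apply injective_projections; simpl; ring. }
  f_equal. apply (CRInt_FTC (fun y => - Ci * F (x, y))); auto.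
  - intros t Ht. apply rderiv_ext with (fun s => - Ci * F ((x, 0%R) + s * Ci)).
    intros s. f_equal. f_equal. symmetry. apply pair_vertical.
    replace (f (x, t)) with (- Ci * f (x, t) * Ci).
    2:{ replace (- Ci * f (x, t) * Ci) with (- (Ci * Ci) * f (x, t)) by ring.
      replace (- (Ci * Ci)) with (RtoC 1). ring.
      apply injective_projections; simpl; ring. }
    apply (rderiv_line (fun w => - Ci * F w)). rewrite <- pair_vertical.
    apply cderiv_scal. auto.
  - intros t Ht. apply rcont_vertical; auto.
Qed.

Definition in_rect (x0 x1 y0 y1 : R) (z : C) : Prop :=
  x0 <= Re z <= x1 /\ y0 <= Im z <= y1.

(** The corner values of the primitive cancel in pairs. *)
Lemma rect_int_primitive (F f : C -> C) (x0 x1 y0 y1 : R) : x0 <= x1 -> y0 <= y1 ->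
  (forall z, in_rect x0 x1 y0 y1 z -> cderiv F z (f z)) ->
  (forall z, in_rect x0 x1 y0 y1 z -> ccont f z) ->
  rect_int f x0 x1 y0 y1 = 0.
Proof.
  intros Hx Hy HF Hf. unfold rect_int.
  rewrite (int_h_FTC F f x0 x1 y0), (int_h_FTC F f x0 x1 y1),
    (int_v_FTC F f x1 y0 y1), (int_v_FTC F f x0 y0 y1); auto; try ring;
  intros; (apply HF || apply Hf); split; simpl; lra.
Qed.

Lemma ccont_minus (f g : C -> C) (z : C) :
  ccont f z -> ccont g z -> ccont (fun w => f w - g w) z.
Proof.
  rewrite !ccont_continuous. apply (@continuous_minus (AbsRing_UniformSpace C_AbsRing) C_AbsRing (AbsRing_NormedModule C_AbsRing)).
Qed.

Lemma rect_int_minus (f g : C -> C) (x0 x1 y0 y1 : R) : x0 <= x1 -> y0 <= y1 ->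
  (forall z, in_rect x0 x1 y0 y1 z -> ccont f z) ->
  (forall z, in_rect x0 x1 y0 y1 z -> ccont g z) ->
  rect_int (fun z => f z - g z) x0 x1 y0 y1 =
  rect_int f x0 x1 y0 y1 - rect_int g x0 x1 y0 y1.
Proof.
  intros Hx Hy Hf Hg. unfold rect_int, int_h, int_v.
  rewrite (CRInt_minus (fun x => f (x, y0)) (fun x => g (x, y0))),
    (CRInt_minus (fun x => f (x, y1)) (fun x => g (x, y1))),
    (CRInt_minus (fun y => f (x0, y)) (fun y => g (x0, y))),
    (CRInt_minus (fun y => f (x1, y)) (fun y => g (x1, y))); auto; try ring;
  intros; (apply rcont_horizontal || apply rcont_vertical);
   (apply Hf || apply Hg); split; simpl; lra.
Qed.

Lemma rect_int_bound (f : C -> C) (x0 x1 y0 y1 M : R) : x0 <= x1 -> y0 <= y1 ->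
  (forall z, in_rect x0 x1 y0 y1 z -> ccont f z) ->
  (forall z, in_rect x0 x1 y0 y1 z -> Cmod (f z) <= M) ->
  Cmod (rect_int f x0 x1 y0 y1) <= 2 * ((x1 - x0) + (y1 - y0)) * M.
Proof.
  intros Hx Hy Hf HM. unfold rect_int, int_h, int_v.
  assert (B1 : forall y, y0 <= y <= y1 -> Cmod (CRInt (fun x => f (x, y)) x0 x1) <= (x1 - x0) * M).
  { intros y Hy'. apply CRInt_bound; auto; intros.
    apply rcont_horizontal, Hf. split; simpl; lra.
    apply HM. split; simpl; lra. }
  assert (B2 : forall x, x0 <= x <= x1 -> Cmod (Ci * CRInt (fun y => f (x, y)) y0 y1) <= (y1 - y0) * M).
  { intros x Hx'. rewrite Cmod_mult, Cmod_Ci, Rmult_1_l. apply CRInt_bound; auto; intros.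
    apply rcont_vertical, Hf. split; simpl; lra.
    apply HM. split; simpl; lra. }
  pose proof (B1 y0 ltac:(lra)). pose proof (B1 y1 ltac:(lra)).
  pose proof (B2 x0 ltac:(lra)). pose proof (B2 x1 ltac:(lra)).
  eapply Rle_trans. apply Cmod_triangle_minus.
  eapply Rle_trans. apply Rplus_le_compat_r, Cmod_triangle_minus.
  eapply Rle_trans. apply Rplus_le_compat_r, Rplus_le_compat_r, Cmod_triangle. lra.
Qed.

(** Each inner side is traversed twice, in opposite directions. *)
Lemma rect_int_split4 (f : C -> C) (x0 xm x1 y0 ym y1 : R) :
  x0 <= xm <= x1 -> y0 <= ym <= y1 ->
  (forall z, in_rect x0 x1 y0 y1 z -> ccont f z) ->
  rect_int f x0 x1 y0 y1 =
  rect_int f x0 xm y0 ym + rect_int f xm x1 y0 ym +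
  rect_int f x0 xm ym y1 + rect_int f xm x1 ym y1.
Proof.
  intros Hx Hy Hf. unfold rect_int, int_h, int_v.
  rewrite <- (CRInt_Chasles (fun x => f (x, y0)) x0 xm x1),
    <- (CRInt_Chasles (fun x => f (x, y1)) x0 xm x1),
    <- (CRInt_Chasles (fun y => f (x0, y)) y0 ym y1),
    <- (CRInt_Chasles (fun y => f (x1, y)) y0 ym y1); try lra; try ring;
  intros; (apply rcont_horizontal || apply rcont_vertical); apply Hf; split; simpl; lra.
Qed.

Record rect := mkrect { rx0 : R; rx1 : R; ry0 : R; ry1 : R }.

Definition rect_wf (Q : rect) := rx0 Q < rx1 Q /\ ry0 Q < ry1 Q.
Definition rint (f : C -> C) (Q : rect) := rect_int f (rx0 Q) (rx1 Q) (ry0 Q) (ry1 Q).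
Definition rarea (Q : rect) := ((rx1 Q - rx0 Q) * (ry1 Q - ry0 Q))%R.
Definition rmem (Q : rect) (z : C) := in_rect (rx0 Q) (rx1 Q) (ry0 Q) (ry1 Q) z.
Definition rsub (P Q : rect) :=
  rx0 Q <= rx0 P /\ rx1 P <= rx1 Q /\ ry0 Q <= ry0 P /\ ry1 P <= ry1 Q.

Lemma rsub_mem (P Q : rect) z : rsub P Q -> rmem P z -> rmem Q z.
Proof. unfold rsub, rmem, in_rect. lra. Qed.

(** One of the four quarters carries at least a quarter of the integral. Phrased as a lower bound c
    per unit of area, the invariant is the same at every stage of the subdivision. *)
Lemma goursat_step (f : C -> C) (c : R) (Q : rect) : rect_wf Q ->
  (forall z, rmem Q z -> ccont f z) -> c * rarea Q <= Cmod (rint f Q) ->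
  exists P, rect_wf P /\ rsub P Q /\
    (rx1 P - rx0 P)%R = ((rx1 Q - rx0 Q) / 2)%R /\
    (ry1 P - ry0 P)%R = ((ry1 Q - ry0 Q) / 2)%R /\
    c * rarea P <= Cmod (rint f P).
Proof.
  destruct Q as [x0 x1 y0 y1]. unfold rect_wf, rint, rarea, rmem, rsub. simpl.
  intros [Hx Hy] Hf Hc.
  set (xm := ((x0 + x1) / 2)%R). set (ym := ((y0 + y1) / 2)%R).
  assert (Ex : x0 < xm < x1) by (unfold xm; lra).
  assert (Ey : y0 < ym < y1) by (unfold ym; lra).
  rewrite (rect_int_split4 f x0 xm x1 y0 ym y1) in Hc; auto; try lra.
  set (A := ((x1 - x0) * (y1 - y0) / 4)%R).
  set (I1 := rect_int f x0 xm y0 ym) in *. set (I2 := rect_int f xm x1 y0 ym) in *.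
  set (I3 := rect_int f x0 xm ym y1) in *. set (I4 := rect_int f xm x1 ym y1) in *.
  assert (T : Cmod (I1 + I2 + I3 + I4) <= Cmod I1 + Cmod I2 + Cmod I3 + Cmod I4).
  { eapply Rle_trans. apply Cmod_triangle. apply Rplus_le_compat_r.
    eapply Rle_trans. apply Cmod_triangle. apply Rplus_le_compat_r. apply Cmod_triangle. }
  assert (D : c * A <= Cmod I1 \/ c * A <= Cmod I2 \/ c * A <= Cmod I3 \/ c * A <= Cmod I4).
  { apply NNPP. intros N. apply not_or_and in N. destruct N as [N1 N].
    apply not_or_and in N. destruct N as [N2 N]. apply not_or_and in N. destruct N as [N3 N4].
    apply Rnot_le_lt in N1, N2, N3, N4.
    assert (c * ((x1 - x0) * (y1 - y0)) = 4 * (c * A))%R by (unfold A; field). lra. }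
  destruct D as [D|[D|[D|D]]];
  [exists (mkrect x0 xm y0 ym)|exists (mkrect xm x1 y0 ym)
  |exists (mkrect x0 xm ym y1)|exists (mkrect xm x1 ym y1)]; simpl;
  (split; [lra|split; [lra|split; [unfold xm; lra|split; [unfold ym; lra|]]]]);
  match goal with |- _ * (?a) <= _ => replace a with A by (unfold A, xm, ym; field) end; exact D.
Qed.

Lemma nested_limit (a b : nat -> R) :
  (forall n, a n <= a (S n)) -> (forall n, b (S n) <= b n) -> (forall n, a n <= b n) ->
  exists p, forall n, a n <= p <= b n.
Proof.
  intros Ha Hb Hab.
  assert (Ma : forall n k, a n <= a (n + k)%nat).
  { intros n k. induction k. rewrite Nat.add_0_r. lra. rewrite Nat.add_succ_r.
    eapply Rle_trans. apply IHk. apply Ha. }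
  assert (Mb : forall n k, b (n + k)%nat <= b n).
  { intros n k. induction k. rewrite Nat.add_0_r. lra. rewrite Nat.add_succ_r.
    eapply Rle_trans. apply Hb. apply IHk. }
  assert (AB : forall n m, a n <= b m).
  { intros n m. eapply Rle_trans. apply (Ma n m). eapply Rle_trans. apply Hab.
    rewrite Nat.add_comm. apply Mb. }
  destruct (completeness (fun x => exists n, x = a n)) as [p [Hp1 Hp2]].
  - exists (b 0%nat). intros x [n ->]. apply AB.
  - exists (a 0%nat). now exists 0%nat.
  - exists p. intros n. split. apply Hp1. now exists n.
    apply Hp2. intros x [m ->]. apply AB.
Qed.

Theorem goursat (f : C -> C) (x0 x1 y0 y1 : R) : x0 < x1 -> y0 < y1 ->
  (forall z, in_rect x0 x1 y0 y1 z -> exists l, cderiv f z l) ->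
  rect_int f x0 x1 y0 y1 = 0.
Proof.
  intros Hx Hy Hf. set (Q0 := mkrect x0 x1 y0 y1).
  assert (Hcont : forall z, rmem Q0 z -> ccont f z).
  { intros z Hz. destruct (Hf z Hz) as [l Hl]. eapply cderiv_ccont; eauto. }
  apply NNPP. intros Hne. change (rint f Q0 <> 0) in Hne. apply Cmod_pos in Hne.
  set (c := (Cmod (rint f Q0) / rarea Q0)%R).
  assert (HA : 0 < rarea Q0) by (unfold rarea; simpl; apply Rmult_lt_0_compat; lra).
  assert (Hc : 0 < c) by (apply Rdiv_lt_0_compat; auto).
  set (good := fun Q => rect_wf Q /\ rsub Q Q0 /\ c * rarea Q <= Cmod (rint f Q)).
  assert (G0 : good Q0).
  { split; [split; simpl; lra|]. split. unfold rsub; lra.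
    right. unfold c. field. lra. }
  (* [choice] wants a successor for every rectangle; one that is not [good] is sent to itself. *)
  assert (STEP : forall Q : rect, exists P, good Q -> good P /\ rsub P Q /\
    (rx1 P - rx0 P)%R = ((rx1 Q - rx0 Q) / 2)%R /\
    (ry1 P - ry0 P)%R = ((ry1 Q - ry0 Q) / 2)%R).
  { intros Q. destruct (classic (good Q)) as [G|N]; [|exists Q; tauto].
    destruct G as [W [S E]]. destruct (goursat_step f c Q) as [P [P1 [P2 [P3 [P4 P5]]]]]; auto.
    intros z Hz. apply Hcont. eapply rsub_mem; eauto.
    exists P. intros _. split; [|auto]. split; auto. split; auto.
    unfold rsub in *. lra. }
  destruct (choice _ STEP) as [nxt Hnxt].
  set (Qs := fix Qs n := match n with O => Q0 | S m => nxt (Qs m) end).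
  assert (GQ : forall n, good (Qs n)).
  { induction n. exact G0. simpl. apply Hnxt, IHn. }
  assert (SQ : forall n, rsub (Qs (S n)) (Qs n)).
  { intros n. apply (Hnxt (Qs n) (GQ n)). }
  assert (WX : forall n, (rx1 (Qs n) - rx0 (Qs n))%R = ((x1 - x0) * (/ 2) ^ n)%R).
  { induction n. simpl. ring. destruct (Hnxt (Qs n) (GQ n)) as [_ [_ [E _]]].
    simpl. rewrite E, IHn. field. }
  assert (WY : forall n, (ry1 (Qs n) - ry0 (Qs n))%R = ((y1 - y0) * (/ 2) ^ n)%R).
  { induction n. simpl. ring. destruct (Hnxt (Qs n) (GQ n)) as [_ [_ [_ E]]].
    simpl. rewrite E, IHn. field. }
  destruct (nested_limit (fun n => rx0 (Qs n)) (fun n => rx1 (Qs n))) as [px Hpx];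
   try (intros n; specialize (SQ n); unfold rsub in SQ; lra).
  { intros n. destruct (GQ n) as [[W _] _]. lra. }
  destruct (nested_limit (fun n => ry0 (Qs n)) (fun n => ry1 (Qs n))) as [py Hpy];
   try (intros n; specialize (SQ n); unfold rsub in SQ; lra).
  { intros n. destruct (GQ n) as [[_ W] _]. lra. }
  set (p := ((px, py) : C)).
  destruct (Hf p) as [l Hl].
  { split; [apply (Hpx 0%nat)|apply (Hpy 0%nat)]. }
  set (D := ((x1 - x0) + (y1 - y0))%R).
  assert (HD : 0 < D) by (unfold D; lra).
  (* On a rectangle of width plus height D t the remainder contributes at most 2 eps (D t)^2; this
     eps makes it half of c times the area. *)
  set (eps := (c * rarea Q0 / (4 * (D * D)))%R).
  assert (He : 0 < eps) by (unfold eps; apply Rdiv_lt_0_compat; nra).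
  destruct (Hl eps He) as [d [Hd Hlin]].
  destruct (pow_lt_1_zero (/ 2) ltac:(rewrite Rabs_pos_eq; lra) (d / D)) as [N HN].
  { apply Rdiv_lt_0_compat; auto. }
  specialize (HN N (le_n N)).
  set (t := ((/ 2) ^ N)%R) in *.
  assert (Ht : 0 < t) by (apply pow_lt; lra).
  rewrite Rabs_pos_eq in HN by lra.
  assert (HtD : D * t < d).
  { apply Rlt_le_trans with (D * (d / D))%R. apply Rmult_lt_compat_l; auto. right. field. lra. }
  specialize (WX N). specialize (WY N). fold t in WX, WY.
  destruct (GQ N) as [[W1 W2] [WS WE]].
  set (Q := Qs N) in *.
  (* The affine part of f at p has a quadratic primitive, so only the remainder contributes to the
     integral over Q. *)
  set (aff := fun z : C => f p - l * p + l * z).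
  assert (Haff : forall z, cderiv aff z l).
  { intros z. replace l with (0 + l * 1) by ring. apply cderiv_plus.
    apply cderiv_const. apply cderiv_scal, cderiv_id. }
  assert (Ez : rint aff Q = 0).
  { unfold rint. apply (rect_int_primitive (fun z => (f p - l * p) * z + l / 2 * (z * z)) aff); [lra|lra| |].
    - intros z _. unfold aff.
      replace (f p - l * p + l * z) with ((f p - l * p) * 1 + l / 2 * (1 * z + z * 1)).
      2:{ apply injective_projections; simpl; field. }
      apply cderiv_plus. apply cderiv_scal, cderiv_id.
      apply cderiv_scal, cderiv_mult; apply cderiv_id.
    - intros z _. eapply cderiv_ccont, Haff. }
  assert (Hcq : forall z, in_rect (rx0 Q) (rx1 Q) (ry0 Q) (ry1 Q) z -> ccont f z).
  { intros z Hz. apply Hcont. eapply rsub_mem; eauto. }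
  assert (B : Cmod (rint (fun z => f z - aff z) Q) <= 2 * (D * t) * (eps * (D * t))).
  { unfold rint. replace (D * t)%R with ((rx1 Q - rx0 Q) + (ry1 Q - ry0 Q))%R at 1
      by (rewrite WX, WY; unfold D; ring).
    apply rect_int_bound; try lra.
    - intros z Hz. apply ccont_minus. auto. eapply cderiv_ccont, Haff.
    - intros z [Hz1 Hz2]. specialize (Hlin (z - p)).
      assert (Hzp : Cmod (z - p) <= D * t).
      { replace (z - p) with ((Re z - px)%R + Ci * (Im z - py)%R).
        2:{ unfold p. destruct z as [zx zy]. apply injective_projections; simpl; ring. }
        eapply Rle_trans. apply Cmod_triangle. rewrite Cmod_mult, Cmod_Ci, !Cmod_R, Rmult_1_l.
        assert (Rabs (Re z - px) <= (x1 - x0) * t).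
        { rewrite <- WX. apply Rabs_le. specialize (Hpx N). fold Q in Hpx. lra. }
        assert (Rabs (Im z - py) <= (y1 - y0) * t).
        { rewrite <- WY. apply Rabs_le. specialize (Hpy N). fold Q in Hpy. lra. }
        unfold D. lra. }
      specialize (Hlin ltac:(lra)).
      replace (p + (z - p)) with z in Hlin by ring.
      replace (f z - aff z) with (f z - f p - l * (z - p)) by (unfold aff; ring).
      eapply Rle_trans. apply Hlin. apply Rmult_le_compat_l; lra. }
  unfold rint in B. rewrite rect_int_minus in B; auto; try lra.
  2:{ intros z _. eapply cderiv_ccont, Haff. }
  change (rect_int aff (rx0 Q) (rx1 Q) (ry0 Q) (ry1 Q)) with (rint aff Q) in B.
  rewrite Ez in B. replace (rect_int f (rx0 Q) (rx1 Q) (ry0 Q) (ry1 Q) - 0)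
    with (rint f Q) in B by (unfold rint; ring).
  unfold rarea in WE. rewrite WX, WY in WE.
  assert (E1 : (2 * (D * t) * (eps * (D * t)) = c * rarea Q0 * (t * t) / 2)%R).
  { unfold eps. field. lra. }
  rewrite E1 in B. unfold rarea in B. simpl in B.
  assert (0 < c * ((x1 - x0) * (y1 - y0)) * (t * t))%R.
  { unfold rarea in HA. simpl in HA. apply Rmult_lt_0_compat; nra. }
  nra.
Qed.

(** * The complex exponential and circle means *)

Definition Cexp (w : C) : C := RtoC (exp (Re w)) * (cos (Im w), sin (Im w)).

Lemma Cexp_plus (z w : C) : Cexp (z + w) = Cexp z * Cexp w.
Proof.
  unfold Cexp. destruct z as [x y], w as [x' y']. simpl.
  rewrite exp_plus, cos_plus, sin_plus.
  apply injective_projections; simpl; ring.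
Qed.

Lemma Cexp_0 : Cexp 0 = 1.
Proof.
  unfold Cexp. simpl. rewrite exp_0, cos_0, sin_0. apply injective_projections; simpl; ring.
Qed.

Lemma Cmod_Cexp (w : C) : Cmod (Cexp w) = exp (Re w).
Proof.
  unfold Cexp. rewrite Cmod_mult, Cmod_R, Rabs_pos_eq by (left; apply exp_pos).
  replace (Cmod (cos (Im w), sin (Im w))) with 1%R. ring.
  unfold Cmod. simpl. rewrite !Rmult_1_r.
  pose proof (sin2_cos2 (Im w)) as E. unfold Rsqr in E. rewrite Rplus_comm in E.
  rewrite E. symmetry. apply sqrt_1.
Qed.

Lemma Cexp_neq_0 (w : C) : Cexp w <> 0.
Proof.
  apply Cmod_gt_0. rewrite Cmod_Cexp. apply exp_pos.
Qed.

Lemma Cexp_opp (w : C) : Cexp (- w) = / Cexp w.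
Proof.
  assert (E : Cexp w * Cexp (- w) = 1).
  { rewrite <- Cexp_plus. replace (w + - w) with (RtoC 0) by ring. apply Cexp_0. }
  pose proof (Cexp_neq_0 w). rewrite <- (Cmult_1_r (/ Cexp w)), <- E. field. auto.
Qed.

Lemma derivable_pt_lim_bound (f : R -> R) (x l : R) : derivable_pt_lim f x l ->
  forall eps, 0 < eps -> exists d, 0 < d /\ forall h, Rabs h < d ->
   (Rabs (f (x + h) - f x - l * h) <= eps * Rabs h)%R.
Proof.
  intros H eps He. destruct (H eps He) as [d Hd]. exists d. split. apply cond_pos.
  intros h Hh. destruct (Req_dec h 0) as [->|N].
  - rewrite Rplus_0_r. replace (f x - f x - l * 0)%R with 0%R by ring. rewrite Rabs_R0. lra.
  - specialize (Hd h N Hh).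
    replace (f (x + h) - f x - l * h)%R with (((f (x + h) - f x) / h - l) * h)%R by (field; auto).
    rewrite Rabs_mult. apply Rmult_le_compat_r. apply Rabs_pos. lra.
Qed.

Lemma Cmod_le_ReIm (z : C) : Cmod z <= Rabs (Re z) + Rabs (Im z).
Proof.
  replace z with (RtoC (Re z) + Ci * RtoC (Im z)) at 1.
  2:{ destruct z. apply injective_projections; simpl; ring. }
  eapply Rle_trans. apply Cmod_triangle. rewrite Cmod_mult, Cmod_Ci, !Cmod_R. lra.
Qed.

Lemma im_le_Cmod (z : C) : Rabs (Im z) <= Cmod z.
Proof. eapply Rle_trans; [|apply Rmax_Cmod]. apply Rmax_r. Qed.

Lemma cderiv_Cexp_0 : cderiv Cexp 0 1.
Proof.
  intros eps He. set (e := Rmin 1 (eps / 8)).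
  assert (He0 : 0 < e) by (unfold e; apply Rmin_pos; lra).
  assert (He1 : e <= 1) by apply Rmin_l.
  assert (He2 : e <= eps / 8) by apply Rmin_r. clearbody e.
  destruct (derivable_pt_lim_bound exp 0 1 derivable_pt_lim_exp_0 e He0) as [d1 [Hd1 H1]].
  destruct (derivable_pt_lim_bound sin 0 1 ltac:(rewrite <- cos_0; apply derivable_pt_lim_sin) e He0) as [d2 [Hd2 H2]].
  destruct (derivable_pt_lim_bound cos 0 (- sin 0) (derivable_pt_lim_cos 0) e He0) as [d3 [Hd3 H3]].
  exists (Rmin (Rmin d1 d2) (Rmin d3 e)). split. repeat apply Rmin_pos; auto.
  intros h Hh. rewrite Cplus_0_l, Cexp_0.
  pose proof (re_le_Cmod h) as Rh. pose proof (im_le_Cmod h) as Ih.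
  assert (Cmod h < d1 /\ Cmod h < d2 /\ Cmod h < d3 /\ Cmod h < e) as [h1 [h2 [h3 h4]]].
  { pose proof (Rmin_l (Rmin d1 d2) (Rmin d3 e)). pose proof (Rmin_r (Rmin d1 d2) (Rmin d3 e)).
    pose proof (Rmin_l d1 d2). pose proof (Rmin_r d1 d2). pose proof (Rmin_l d3 e). pose proof (Rmin_r d3 e). lra. }
  set (x := Re h) in *. set (y := Im h) in *.
  specialize (H1 x ltac:(lra)). specialize (H2 y ltac:(lra)). specialize (H3 y ltac:(lra)).
  rewrite !Rplus_0_l in H1, H2, H3. rewrite exp_0 in H1. rewrite sin_0 in H2, H3. rewrite cos_0 in H3.
  replace (exp x - 1 - 1 * x)%R with (exp x - 1 - x)%R in H1 by ring.
  replace (sin y - 0 - 1 * y)%R with (sin y - y)%R in H2 by ring.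
  replace (cos y - 1 - - 0 * y)%R with (cos y - 1)%R in H3 by ring.
  eapply Rle_trans. apply Cmod_le_ReIm.
  replace (Re (Cexp h - 1 - 1 * h)) with ((exp x - 1 - x) * cos y + (1 + x) * (cos y - 1))%R
    by (unfold Cexp; fold x y; destruct h; simpl; unfold x; simpl; ring).
  replace (Im (Cexp h - 1 - 1 * h)) with ((exp x - 1) * sin y + (sin y - y))%R
    by (unfold Cexp; fold x y; destruct h; simpl; unfold y; simpl; ring).
  pose proof (COS_bound y). assert (Hc : Rabs (cos y) <= 1) by (apply Rabs_le; lra).
  pose proof (Rabs_pos x) as Px. pose proof (Rabs_pos y) as Py.
  assert (B1 : Rabs ((exp x - 1 - x) * cos y + (1 + x) * (cos y - 1)) <= e * Rabs x + 2 * (e * Rabs y)).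
  { eapply Rle_trans. apply Rabs_triang. rewrite !Rabs_mult. apply Rplus_le_compat.
    - pose proof (Rabs_pos (exp x - 1 - x)). pose proof (Rabs_pos (cos y)). nra.
    - apply Rmult_le_compat; try apply Rabs_pos; auto.
      eapply Rle_trans. apply Rabs_triang. rewrite Rabs_R1. lra. }
  assert (B2 : Rabs (exp x - 1) <= 2 * Rabs x).
  { replace (exp x - 1)%R with ((exp x - 1 - x) + x)%R by ring.
    eapply Rle_trans. apply Rabs_triang. nra. }
  assert (B3 : Rabs (sin y) <= 2 * Rabs y).
  { replace (sin y)%R with ((sin y - y) + y)%R by ring.
    eapply Rle_trans. apply Rabs_triang. nra. }
  assert (B4 : Rabs ((exp x - 1) * sin y + (sin y - y)) <= 4 * (e * Rabs y) + e * Rabs y).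
  { eapply Rle_trans. apply Rabs_triang. rewrite Rabs_mult. apply Rplus_le_compat; auto.
    apply Rle_trans with ((2 * Rabs x) * (2 * Rabs y))%R.
    apply Rmult_le_compat; auto; apply Rabs_pos. nra. }
  pose proof (Cmod_ge_0 h). nra.
Qed.

Lemma cderiv_Cexp (w : C) : cderiv Cexp w (Cexp w).
Proof.
  apply cderiv_ext with (fun u => Cexp w * Cexp (u - w)).
  - intros u. rewrite <- Cexp_plus. f_equal. ring.
  - apply cderiv_eq with (Cexp w * (1 * (1 - 0))). ring.
    apply (cderiv_scal (Cexp w) (fun u => Cexp (u - w))). apply (cderiv_comp Cexp (fun u => u - w)).
    replace (w - w) with (RtoC 0) by ring. apply cderiv_Cexp_0.
    apply cderiv_minus. apply cderiv_id. apply cderiv_const.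
Qed.

Definition cis (t : R) : C := Cexp (t * Ci).

Lemma Cmod_cis (t : R) : Cmod (cis t) = 1%R.
Proof.
  unfold cis. rewrite Cmod_Cexp. replace (Re (t * Ci)) with 0%R by (simpl; ring). apply exp_0.
Qed.

Lemma Cexp_2PI : Cexp ((2 * PI)%R * Ci) = 1.
Proof.
  unfold Cexp. replace (Re ((2 * PI)%R * Ci)) with 0%R by (simpl; ring).
  replace (Im ((2 * PI)%R * Ci)) with (2 * PI)%R by (simpl; ring).
  rewrite exp_0, cos_2PI, sin_2PI. apply injective_projections; simpl; ring.
Qed.

(** The pullback of f(z) dz / (z - a)^2 under z = a + exp w: circles round a become vertical
    segments, and annuli become rectangles to which [goursat] applies. *)
Definition polar (f : C -> C) (a w : C) : C := f (a + Cexp w) * Cexp (- w).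

Lemma Cexp_ln (r t : R) : 0 < r -> Cexp (ln r, t) = r * cis t.
Proof.
  intros Hr. unfold cis, Cexp. simpl. rewrite exp_ln by auto.
  replace (exp (t * 0 - 0 * 1)) with 1%R. 2:{ rewrite <- exp_0. f_equal. ring. }
  replace (t * 1 + 0 * 0)%R with t by ring. apply injective_projections; simpl; ring.
Qed.

Lemma polar_circle (f : C -> C) (a : C) (r t : R) : 0 < r ->
  polar f a (ln r, t) = f (a + r * cis t) * / (r * cis t).
Proof.
  intros Hr. unfold polar. now rewrite Cexp_opp, Cexp_ln.
Qed.

Lemma polar_cderiv (f : C -> C) (a w l : C) :
  cderiv f (a + Cexp w) l -> exists m, cderiv (polar f a) w m.
Proof.
  intros H. eexists. apply cderiv_mult.
  - apply (cderiv_comp f (fun u => a + Cexp u)). apply H.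
    apply cderiv_plus. apply cderiv_const. apply cderiv_Cexp.
  - apply (cderiv_comp Cexp (fun u => - u)). apply cderiv_Cexp.
    apply cderiv_opp, cderiv_id.
Qed.

Definition holo_disc (f : C -> C) (a : C) (rho : R) : Prop :=
  forall z, Cmod (z - a) < rho -> exists l, cderiv f z l.

(** The integral of f(z) dz / (z - a)^2 over the circle, divided by i. The weight is that of the
    derivative and not of the value at a, since what is needed first is a bound for derivatives. *)
Definition circle_mean (f : C -> C) (a : C) (r : R) : C :=
  CRInt (fun t => f (a + r * cis t) * / (r * cis t)) 0 (2 * PI).

Lemma circle_mean_int_v (f : C -> C) (a : C) (r : R) : 0 < r ->
  circle_mean f a r = int_v (polar f a) (ln r) 0 (2 * PI).
Proof.
  intros Hr. apply CRInt_ext. pose proof PI_RGT_0. lra.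
  intros t _. symmetry. apply polar_circle; auto.
Qed.

(* Goursat's theorem for polar f a on [ln r0, ln r1] x [0, 2 pi]: the horizontal
   sides cancel by periodicity. *)
Lemma circle_mean_const (f : C -> C) (a : C) (rho r0 r1 : R) : holo_disc f a rho ->
  0 < r0 -> r0 < r1 -> r1 < rho -> circle_mean f a r0 = circle_mean f a r1.
Proof.
  intros Hf H0 H01 H1. rewrite !circle_mean_int_v by lra. pose proof PI_RGT_0 as P.
  assert (G : rect_int (polar f a) (ln r0) (ln r1) 0 (2 * PI) = 0).
  { apply goursat; try lra. apply ln_increasing; auto.
    intros z [Hz _]. destruct (Hf (a + Cexp z)) as [l Hl].
    - replace (a + Cexp z - a) with (Cexp z) by ring. rewrite Cmod_Cexp.
      apply Rle_lt_trans with (2 := H1). rewrite <- (exp_ln r1) by lra.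
      destruct (proj2 Hz) as [L|E]. left. now apply exp_increasing. rewrite E. lra.
    - eapply polar_cderiv; eauto. }
  unfold rect_int in G.
  replace (int_h (polar f a) (ln r0) (ln r1) (2 * PI)) with (int_h (polar f a) (ln r0) (ln r1) 0) in G.
  - apply Cminus_eq_0.
    replace (int_v (polar f a) (ln r0) 0 (2 * PI) - int_v (polar f a) (ln r1) 0 (2 * PI)) with
     (Ci * (int_h (polar f a) (ln r0) (ln r1) 0 +
      Ci * int_v (polar f a) (ln r1) 0 (2 * PI) -
      int_h (polar f a) (ln r0) (ln r1) 0 - Ci * int_v (polar f a) (ln r0) 0 (2 * PI))).
    rewrite G. ring.
    replace (Ci * (int_h (polar f a) (ln r0) (ln r1) 0 +
      Ci * int_v (polar f a) (ln r1) 0 (2 * PI) -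
      int_h (polar f a) (ln r0) (ln r1) 0 - Ci * int_v (polar f a) (ln r0) 0 (2 * PI)))
     with (- (Ci * Ci) * (int_v (polar f a) (ln r0) 0 (2 * PI) - int_v (polar f a) (ln r1) 0 (2 * PI))) by ring.
    replace (- (Ci * Ci)) with (RtoC 1). ring. apply injective_projections; simpl; ring.
  - apply CRInt_ext. left. apply ln_increasing; auto. intros x _. unfold polar.
    assert (E : ((x, 2 * PI)%R : C) = (x, 0%R) + (2 * PI)%R * Ci).
    { apply injective_projections; simpl; ring. }
    rewrite !Cexp_opp, E, Cexp_plus, Cexp_2PI, Cmult_1_r. reflexivity.
Qed.

Lemma ccont_comp (f g : C -> C) (z : C) :
  ccont f (g z) -> ccont g z -> ccont (fun w => f (g w)) z.
Proof.
  intros Hf Hg eps He. destruct (Hf eps He) as [d [Hd H]].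
  destruct (Hg d Hd) as [e [He' H']]. exists e. split; auto.
Qed.

Lemma ccont_mult (f g : C -> C) (z : C) :
  ccont f z -> ccont g z -> ccont (fun w => f w * g w) z.
Proof.
  rewrite !ccont_continuous. apply (@continuous_mult (AbsRing_UniformSpace C_AbsRing) C_AbsRing).
Qed.

Lemma ccont_polar_gen (f : C -> C) (a : C) (r t : R) : 0 < r ->
  ccont f (a + r * cis t) -> ccont (polar f a) (ln r, t).
Proof.
  intros Hr H. unfold polar. apply ccont_mult.
  - apply (ccont_comp f (fun w => a + Cexp w)).
    + rewrite Cexp_ln; auto.
    + eapply cderiv_ccont. apply cderiv_plus. apply cderiv_const. apply cderiv_Cexp.
  - eapply cderiv_ccont. apply (cderiv_comp Cexp (fun u => - u)). apply cderiv_Cexp.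
    apply cderiv_opp, cderiv_id.
Qed.

Lemma rcont_circle_gen (f : C -> C) (a : C) (r t : R) : 0 < r ->
  ccont f (a + r * cis t) -> rcont (fun t => f (a + r * cis t) * / (r * cis t)) t.
Proof.
  intros Hr H. apply rcont_ext with (fun s => polar f a (ln r, s)).
  intros s. apply polar_circle; lra.
  apply rcont_vertical. apply ccont_polar_gen; auto.
Qed.

Lemma rcont_circle (f : C -> C) (a : C) (rho r t : R) : holo_disc f a rho -> 0 < r < rho ->
  rcont (fun t => f (a + r * cis t) * / (r * cis t)) t.
Proof.
  intros Hf Hr. apply rcont_circle_gen. lra. destruct (Hf (a + r * cis t)) as [l Hl].
  - replace (a + r * cis t - a) with (r * cis t) by ring.
    rewrite Cmod_mult, Cmod_cis, Cmod_RtoC; lra.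
  - eapply cderiv_ccont; eauto.
Qed.

(* The n = 1 Cauchy coefficient: the mean does not depend on the radius, and
   tends to the derivative as the radius tends to 0. *)
Theorem circle_mean_deriv (f : C -> C) (a l : C) (rho r : R) : holo_disc f a rho ->
  0 < r < rho -> cderiv f a l -> circle_mean f a r = (2 * PI)%R * l.
Proof.
  intros Hf Hr Hl. pose proof PI_RGT_0 as P.
  apply Cminus_eq_0, Cmod_eq_0. apply Rle_antisym; [|apply Cmod_ge_0].
  apply le_epsilon. intros eps He. rewrite Rplus_0_l.
  destruct (Hl (eps / (2 * PI))%R) as [d [Hd H]].
  { apply Rdiv_lt_0_compat; lra. }
  set (s := Rmin (d / 2) (r / 2)).
  assert (Hs : 0 < s) by (unfold s; apply Rmin_pos; lra).
  assert (Hsd : s < d) by (apply Rle_lt_trans with (d / 2)%R; [apply Rmin_l|lra]).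
  assert (Hsr : s < r) by (apply Rle_lt_trans with (r / 2)%R; [apply Rmin_r|lra]).
  rewrite <- (circle_mean_const f a rho s r Hf) by lra.
  assert (Hs0 : RtoC s <> 0) by (intros E; apply RtoC_inj in E; lra).
  (* A primitive of l + f a / (s cis t), which is what the affine approximation of f at a
     contributes. The exponential term is periodic, so the integral over a period is 2 pi l. The
     rest of the integrand is at most eps / (2 pi). *)
  set (F := fun z : C => l * z + f a / s * Ci * Cexp (- Ci * z)).
  set (F' := fun z : C => l * 1 + f a / s * Ci * (Cexp (- Ci * z) * (- Ci * 1))).
  assert (HF : forall z, cderiv F z (F' z)).
  { intros z. apply cderiv_plus. apply cderiv_scal, cderiv_id. apply cderiv_scal.
    apply (cderiv_comp Cexp). apply cderiv_Cexp. apply cderiv_scal, cderiv_id. }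
  assert (HF' : forall z, exists m, cderiv F' z m).
  { intros z. eexists. apply cderiv_plus. apply cderiv_const. apply cderiv_scal.
    apply cderiv_mult. apply (cderiv_comp Cexp). apply cderiv_Cexp. apply cderiv_scal, cderiv_id.
    apply cderiv_const. }
  assert (EF : forall t : R, F' (0 + t * 1) = l + f a * / (s * cis t)).
  { intros t. unfold F'. replace (- Ci * (0 + t * 1)) with (- (t * Ci)) by ring.
    rewrite Cexp_opp. fold (cis t). assert (cis t <> 0) by apply Cexp_neq_0.
    replace (f a / s * Ci * (/ cis t * (- Ci * 1))) with (- (Ci * Ci) * (f a * / (s * cis t)))
      by (field; auto).
    replace (- (Ci * Ci)) with (RtoC 1). ring. apply injective_projections; simpl; ring. }
  assert (C1 : forall t : R, rcont (fun t => F' (0 + t * 1)) t).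
  { intros t. apply rcont_line. destruct (HF' (0 + t * 1)) as [m Hm]. eapply cderiv_ccont; eauto. }
  assert (I1 : CRInt (fun t => F' (0 + t * 1)) 0 (2 * PI) = (2 * PI)%R * l).
  { rewrite (CRInt_FTC (fun t => F (0 + t * 1))).
    - unfold F. replace (- Ci * (0 + (2 * PI)%R * 1)) with (- ((2 * PI)%R * Ci)) by ring.
      replace (- Ci * (0 + 0%R * 1)) with (RtoC 0) by ring.
      rewrite Cexp_opp, Cexp_2PI, Cexp_0. field. auto.
    - lra.
    - intros t _. replace (F' (0 + t * 1)) with (F' (0 + t * 1) * 1) by ring. apply rderiv_line, HF.
    - auto. }
  rewrite <- I1. unfold circle_mean.
  rewrite <- CRInt_minus; try lra; auto.
  2:{ intros t _. apply (rcont_circle f a rho); auto. lra. }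
  eapply Rle_trans. apply CRInt_bound with (M := (eps / (2 * PI))%R). lra.
  - intros t _. set (g1 := fun t : R => f (a + s * cis t) * / (s * cis t)).
    intros e He'. assert (He2 : 0 < e / 2) by lra.
    destruct (rcont_circle f a rho s t Hf ltac:(lra) _ He2) as [d1 [Hd1 G1]].
    destruct (C1 t _ He2) as [d2 [Hd2 G2]].
    exists (Rmin d1 d2). split. apply Rmin_pos; auto. intros u Hu.
    specialize (G1 u (Rlt_le_trans _ _ _ Hu (Rmin_l _ _))).
    specialize (G2 u (Rlt_le_trans _ _ _ Hu (Rmin_r _ _))).
    match goal with |- Cmod (?A - ?B - (?A' - ?B')) < _ =>
      replace (A - B - (A' - B')) with ((A - A') - (B - B')) by ring;
      pose proof (Cmod_triangle_minus (A - A') (B - B')) end. lra.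
  - intros t _. rewrite EF. assert (Hc : cis t <> 0) by apply Cexp_neq_0.
    replace (f (a + s * cis t) * / (s * cis t) - (l + f a * / (s * cis t)))
      with ((f (a + s * cis t) - f a - l * (s * cis t)) / (s * cis t)) by (field; auto).
    assert (Cm : Cmod (s * cis t) = s).
    { rewrite Cmod_mult, Cmod_cis, Cmod_RtoC; lra. }
    rewrite Cmod_div. 2: apply Cmult_neq_0; auto.
    specialize (H (s * cis t)). rewrite Cm in *. specialize (H Hsd).
    apply Rmult_le_reg_r with s; auto. unfold Rdiv at 1. rewrite Rmult_assoc, Rinv_l by lra. lra.
  - right. field. lra.
Qed.

(** * Cauchy estimates and Taylor expansions *)

(* Unspecified where f is not differentiable. *)
Definition cder (f : C -> C) (z : C) : C := epsilon (inhabits (RtoC 0)) (cderiv f z).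

Lemma cder_correct (f : C -> C) (z : C) :
  (exists l, cderiv f z l) -> cderiv f z (cder f z).
Proof. apply epsilon_spec. Qed.

Lemma cder_unique (f : C -> C) (z l : C) : cderiv f z l -> cder f z = l.
Proof.
  intros H. apply cderiv_unique with f z; auto. apply cder_correct. now exists l.
Qed.

Lemma holo_cder (f : C -> C) (a z : C) (rho : R) : holo_disc f a rho ->
  Cmod (z - a) < rho -> cderiv f z (cder f z).
Proof. intros H Hz. apply cder_correct, H, Hz. Qed.

Lemma holo_sub (f : C -> C) (a b : C) (rho r : R) : holo_disc f a rho ->
  Cmod (b - a) + r <= rho -> holo_disc f b r.
Proof.
  intros H Hr z Hz. apply H. pose proof (Cmod_dist z b a). lra.
Qed.

Lemma Cmod_diag (a : C) : Cmod (a - a) = 0%R.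
Proof. replace (a - a) with (RtoC 0) by ring. apply Cmod_0. Qed.

Theorem cauchy_estimate (f : C -> C) (a : C) (rho M : R) : 0 < rho ->
  holo_disc f a rho -> (forall z, Cmod (z - a) < rho -> Cmod (f z) <= M) ->
  Cmod (cder f a) * rho <= M.
Proof.
  intros Hr Hf HM. pose proof PI_RGT_0 as P.
  assert (HM0 : 0 <= M).
  { eapply Rle_trans; [apply Cmod_ge_0|apply (HM a)]. rewrite Cmod_diag. auto. }
  assert (Hl : cderiv f a (cder f a)).
  { apply holo_cder with a rho; auto. rewrite Cmod_diag; auto. }
  assert (S : forall r, 0 < r < rho -> Cmod (cder f a) * r <= M).
  { intros r Hr'.
    pose proof (circle_mean_deriv f a _ rho r Hf Hr' Hl) as E.
    assert (B : Cmod (circle_mean f a r) <= (2 * PI - 0) * (M / r)).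
    { apply CRInt_bound. lra. intros; eapply rcont_circle; eauto.
      intros t _. rewrite Cmod_mult, Cmod_inv.
      2:{ apply Cmod_gt_0. rewrite Cmod_mult, Cmod_cis, Cmod_RtoC; lra. }
      rewrite (Cmod_mult r), Cmod_cis, Cmod_RtoC, Rmult_1_r by lra.
      apply Rmult_le_compat_r. left. apply Rinv_0_lt_compat. lra.
      apply HM. replace (a + r * cis t - a) with (r * cis t) by ring.
      rewrite Cmod_mult, Cmod_cis, Cmod_RtoC; lra. }
    rewrite E, Cmod_mult, Cmod_RtoC, Rminus_0_r in B by lra.
    apply Rmult_le_reg_l in B; [|lra].
    apply Rmult_le_compat_r with (r := r) in B; [|lra].
    replace (M / r * r)%R with M in B by (field; lra). exact B. }
  apply le_epsilon. intros eps He. pose proof (Cmod_ge_0 (cder f a)) as G.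
  set (k := Cmod (cder f a)) in *.
  (* A radius below rho with k (rho - r) <= eps; the maximum with rho / 2 keeps it positive. *)
  set (r := Rmax (rho / 2) (rho - eps / (k + 1))).
  assert (0 < eps / (k + 1)) by (apply Rdiv_lt_0_compat; lra).
  assert (Hr1 : 0 < r < rho).
  { split. apply Rlt_le_trans with (rho / 2)%R; [lra|apply Rmax_l].
    apply Rmax_lub_lt; lra. }
  specialize (S r Hr1). assert (rho - eps / (k + 1) <= r) by apply Rmax_r.
  assert (k * (eps / (k + 1)) <= eps).
  { apply Rle_trans with ((k + 1) * (eps / (k + 1)))%R.
    apply Rmult_le_compat_r; lra. right. field. lra. }
  nra.
Qed.

Lemma cderiv_shift (f : C -> C) (h z l : C) :
  cderiv f (z + h) l -> cderiv (fun w => f (w + h)) z l.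
Proof.
  intros H. apply cderiv_eq with (l * (1 + 0)). ring.
  apply (cderiv_comp f (fun w => w + h)); auto.
  apply cderiv_plus. apply cderiv_id. apply cderiv_const.
Qed.

Lemma cder_bound (f : C -> C) (a z : C) (rho r M : R) : 0 < r ->
  holo_disc f a rho -> (forall w, Cmod (w - a) < rho -> Cmod (f w) <= M) ->
  Cmod (z - a) + r <= rho -> Cmod (cder f z) <= M / r.
Proof.
  intros Hr Hf HM Hz.
  assert (Cmod (cder f z) * r <= M).
  { apply cauchy_estimate; auto. apply holo_sub with a rho; auto.
    intros w Hw. apply HM. pose proof (Cmod_dist w z a). lra. }
  apply Rmult_le_reg_r with r; auto. unfold Rdiv. rewrite Rmult_assoc, Rinv_l by lra. lra.
Qed.

Lemma Cmod_seg (a z h : C) (t : R) : 0 <= t <= 1 ->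
  Cmod (z + t * h - a) <= Cmod (z - a) + Cmod h.
Proof.
  intros Ht. replace (z + t * h - a) with ((z - a) + t * h) by ring.
  eapply Rle_trans. apply Cmod_triangle. rewrite Cmod_mult, Cmod_RtoC by lra.
  pose proof (Cmod_ge_0 h). nra.
Qed.

(** Cauchy's estimate on radius rho / 4 for the difference f (w + h) - f w, which the mean value
    inequality bounds by 2 M |h| / rho; hence 8 = 2 x 4. It is available before f' is known to be
    differentiable. *)
Lemma cder_lipschitz (f : C -> C) (a h : C) (rho M : R) : 0 < rho ->
  holo_disc f a rho -> (forall z, Cmod (z - a) < rho -> Cmod (f z) <= M) ->
  Cmod h < rho / 4 -> Cmod (cder f (a + h) - cder f a) <= 8 * M / (rho * rho) * Cmod h.
Proof.
  intros Hr Hf HM Hh. pose proof (Cmod_ge_0 h) as Ph.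
  set (g := fun w => f (w + h) - f w).
  assert (Hg : forall w, Cmod (w - a) < rho / 4 ->
     cderiv g w (cder f (w + h) - cder f w)).
  { intros w Hw. apply cderiv_minus.
    - apply cderiv_shift, (holo_cder f a _ rho); auto.
      replace (w + h - a) with ((w - a) + h) by ring.
      pose proof (Cmod_triangle (w - a) h). lra.
    - apply (holo_cder f a _ rho); auto. lra. }
  assert (B : forall w, Cmod (w - a) < rho / 4 -> Cmod (g w) <= M / (rho / 2) * Cmod h).
  { intros w Hw. apply mean_value_ineq with (F' := cder f).
    - intros t Ht. apply (holo_cder f a _ rho); auto. pose proof (Cmod_seg a w h t Ht). lra.
    - intros t Ht. apply cder_bound with a rho; auto. lra. pose proof (Cmod_seg a w h t Ht). lra. }
  assert (E : Cmod (cder g a) * (rho / 4) <= M / (rho / 2) * Cmod h).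
  { apply cauchy_estimate; auto. lra. intros z Hz. eexists. apply Hg; auto. }
  rewrite (cder_unique g a (cder f (a + h) - cder f a)) in E.
  2:{ apply Hg. rewrite Cmod_diag. lra. }
  apply Rmult_le_reg_r with (rho / 4)%R. lra. eapply Rle_trans. apply E.
  right. field. lra.
Qed.

Lemma taylor1 (f : C -> C) (a h : C) (rho M : R) : 0 < rho ->
  holo_disc f a rho -> (forall z, Cmod (z - a) < rho -> Cmod (f z) <= M) ->
  Cmod h < rho / 4 ->
  Cmod (f (a + h) - f a - cder f a * h) <= 8 * M / (rho * rho) * Cmod h * Cmod h.
Proof.
  intros Hr Hf HM Hh. pose proof (Cmod_ge_0 h) as Ph.
  assert (HM0 : 0 <= M).
  { eapply Rle_trans; [apply Cmod_ge_0|apply (HM a)]. rewrite Cmod_diag. auto. }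
  assert (K0 : 0 <= 8 * M / (rho * rho)) by (apply Rle_mult_inv_pos; nra).
  apply mean_value_ineq_affine with (F' := cder f).
  - intros t Ht. apply (holo_cder f a _ rho); auto. pose proof (Cmod_seg a a h t Ht).
    rewrite Cmod_diag in H. lra.
  - intros t Ht. assert (T : Cmod (t * h) <= Cmod h).
    { rewrite Cmod_mult, Cmod_RtoC by lra. nra. }
    eapply Rle_trans. apply cder_lipschitz with (rho := rho) (M := M); auto. lra.
    apply Rmult_le_compat_l; auto.
Qed.

(** The integral is that of a real vector space, and a complex factor mixes the two components;
    hence the passage through [fst] and [snd]. *)
Lemma CRInt_scal (c : C) (f : R -> C) (a b : R) : a <= b ->
  (forall t, a <= t <= b -> rcont f t) ->
  CRInt (fun t => c * f t) a b = c * CRInt f a b.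
Proof.
  intros Hab Hf. pose proof (rcont_ex_RInt f a b Hab Hf) as E.
  apply (@RInt_correct C_R_CompleteNormedModule) in E. fold (CRInt f a b) in E.
  apply (@is_RInt_unique C_R_CompleteNormedModule).
  pose proof (@is_RInt_fct_extend_fst R_NormedModule R_NormedModule f a b (CRInt f a b) E) as E1.
  pose proof (@is_RInt_fct_extend_snd R_NormedModule R_NormedModule f a b (CRInt f a b) E) as E2.
  apply (@is_RInt_fct_extend_pair R_NormedModule R_NormedModule (fun t => c * f t)
    a b (fst (c * CRInt f a b)) (snd (c * CRInt f a b))).
  - apply (@is_RInt_minus R_NormedModule (fun t => fst c * fst (f t))%R (fun t => snd c * snd (f t))%R).
    + apply (@is_RInt_scal R_NormedModule (fun t => fst (f t)) a b (fst c) (fst (CRInt f a b)) E1).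
    + apply (@is_RInt_scal R_NormedModule (fun t => snd (f t)) a b (snd c) (snd (CRInt f a b)) E2).
  - apply (@is_RInt_plus R_NormedModule (fun t => fst c * snd (f t))%R (fun t => snd c * fst (f t))%R).
    + apply (@is_RInt_scal R_NormedModule (fun t => snd (f t)) a b (fst c) (snd (CRInt f a b)) E2).
    + apply (@is_RInt_scal R_NormedModule (fun t => fst (f t)) a b (snd c) (fst (CRInt f a b)) E1).
Qed.

Lemma holo_locally_bounded (f : C -> C) (a : C) (rho : R) : 0 < rho ->
  holo_disc f a rho -> exists r M, 0 < r <= rho /\
   forall z, Cmod (z - a) < r -> Cmod (f z) <= M.
Proof.
  intros Hr Hf. destruct (Hf a) as [l Hl]. rewrite Cmod_diag; auto.
  destruct (cderiv_ccont _ _ _ Hl 1%R Rlt_0_1) as [d [Hd H]].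
  exists (Rmin d rho), (Cmod (f a) + 1)%R. split.
  - split. apply Rmin_pos; auto. apply Rmin_r.
  - intros z Hz. specialize (H z (Rlt_le_trans _ _ _ Hz (Rmin_l _ _))).
    pose proof (Cmod_reverse (f z) (f a)). lra.
Qed.

Lemma rcont_minus (f g : R -> C) (t : R) : rcont f t -> rcont g t -> rcont (fun s => f s - g s) t.
Proof. rewrite !rcont_continuous. apply (@continuous_minus R_UniformSpace R_AbsRing C_R_NormedModule). Qed.

Lemma rcont_scal (c : C) (f : R -> C) (t : R) : rcont f t -> rcont (fun s => c * f s) t.
Proof.
  intros Hf eps He.
  destruct (cderiv_ccont _ _ _ (cderiv_scal c _ _ _ (cderiv_id (f t))) eps He) as [e [He' Hc]].
  destruct (Hf e He') as [d [Hd Hd']]. exists d. split; auto.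
Qed.

(** Differentiation under the integral sign in the formula 2 pi f'(a) = [circle_mean f a r]: on the
    circle, [taylor1] bounds the error uniformly in t. *)
Lemma cder_derivable (f : C -> C) (a : C) (rho M : R) : 0 < rho ->
  holo_disc f a rho -> (forall z, Cmod (z - a) < rho -> Cmod (f z) <= M) ->
  exists l, cderiv (cder f) a l.
Proof.
  intros Hr Hf HM. pose proof PI_RGT_0 as P.
  (* Points of the circle of radius r keep a disc of radius 2 r inside the domain, and so does a +
     h. *)
  set (r := (rho / 4)%R). assert (Pr : 0 < r) by (unfold r; lra).
  assert (HM0 : 0 <= M).
  { eapply Rle_trans; [apply Cmod_ge_0|apply (HM a)]. rewrite Cmod_diag. auto. }
  set (c2 := RtoC (2 * PI)).
  assert (Hc2 : c2 <> 0) by (intros E; apply RtoC_inj in E; lra).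
  assert (Mc2 : Cmod c2 = (2 * PI)%R) by (apply Cmod_RtoC; lra).
  exists (circle_mean (cder f) a r / c2).
  intros eps He.
  set (K := (8 * M / (2 * r * (2 * r)) / r)%R).
  assert (HK : 0 <= K).
  { unfold K. apply Rle_mult_inv_pos; auto. apply Rle_mult_inv_pos; nra. }
  set (d := Rmin (r / 2) (eps / (K + 1))).
  assert (Hd : 0 < d) by (apply Rmin_pos; [lra|apply Rdiv_lt_0_compat; lra]).
  exists d. split; auto. intros h Hh.
  destruct (proj1 (Rmin_Rgt _ _ _) Hh) as [Hh1 Hh2].
  pose proof (Cmod_ge_0 h) as Ph.
  assert (Hpt : forall t, Cmod (a + r * cis t - a) = r).
  { intros t. replace (a + r * cis t - a) with (r * cis t) by ring.
    rewrite Cmod_mult, Cmod_cis, Cmod_RtoC; lra. }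
  assert (Hrho : rho = (4 * r)%R) by (unfold r; field).
  assert (holo_h : holo_disc f (a + h) (2 * r)).
  { apply holo_sub with a rho; auto. replace (a + h - a) with h by ring. lra. }
  assert (cont_d : forall t, ccont (cder f) (a + r * cis t)).
  { intros t e Het. set (b := a + r * cis t).
    set (k := (8 * M / (2 * r * (2 * r)))%R).
    assert (Hk : 0 <= k) by (apply Rle_mult_inv_pos; nra).
    exists (Rmin (r / 2) (e / (k + 1))). split.
    apply Rmin_pos; [lra|apply Rdiv_lt_0_compat; lra]. intros w Hw.
    destruct (proj1 (Rmin_Rgt _ _ _) Hw) as [Hw1 Hw2].
    replace w with (b + (w - b)) by ring.
    eapply Rle_lt_trans. apply cder_lipschitz with (rho := (2 * r)%R) (M := M). lra.
    apply holo_sub with a rho; auto. unfold b. rewrite Hpt. lra.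
    intros z Hz. apply HM. pose proof (Cmod_dist z b a). assert (Hb : Cmod (b - a) = r) by apply Hpt. lra.
    lra. fold k. pose proof (Cmod_ge_0 (w - b)).
    apply Rle_lt_trans with ((k + 1) * Cmod (w - b))%R. nra.
    apply Rlt_le_trans with ((k + 1) * (e / (k + 1)))%R.
    apply Rmult_lt_compat_l; lra. right. field. lra. }
  assert (E1 : circle_mean f (a + h) r = c2 * cder f (a + h)).
  { apply circle_mean_deriv with (2 * r)%R; auto. lra.
    apply (holo_cder f a _ rho); auto. replace (a + h - a) with h by ring. lra. }
  assert (E2 : circle_mean f a r = c2 * cder f a).
  { apply circle_mean_deriv with rho; auto. lra.
    apply (holo_cder f a _ rho); auto. rewrite Cmod_diag. lra. }
  set (phi := fun t => f (a + h + r * cis t) * / (r * cis t)).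
  set (psi := fun t => f (a + r * cis t) * / (r * cis t)).
  set (chi := fun t => cder f (a + r * cis t) * / (r * cis t)).
  assert (Cphi : forall t, rcont phi t) by (intros t; apply (rcont_circle f (a + h) (2 * r)); auto; lra).
  assert (Cpsi : forall t, rcont psi t) by (intros t; apply (rcont_circle f a rho); auto; lra).
  assert (Cchi : forall t, rcont chi t) by (intros t; apply rcont_circle_gen; auto).
  assert (EI : CRInt (fun t => phi t - psi t - h * chi t) 0 (2 * PI) =
     c2 * (cder f (a + h) - cder f a - circle_mean (cder f) a r / c2 * h)).
  { rewrite (CRInt_minus (fun t => phi t - psi t) (fun t => h * chi t)); try lra.
    2:{ intros; now apply rcont_minus. } 2:{ intros; now apply rcont_scal. }
    rewrite CRInt_minus, CRInt_scal by (auto; lra).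
    change (CRInt phi 0 (2 * PI)) with (circle_mean f (a + h) r).
    change (CRInt psi 0 (2 * PI)) with (circle_mean f a r).
    change (CRInt chi 0 (2 * PI)) with (circle_mean (cder f) a r).
    rewrite E1, E2. field. auto. }
  assert (B : Cmod (CRInt (fun t => phi t - psi t - h * chi t) 0 (2 * PI)) <=
     (2 * PI - 0) * (K * Cmod h * Cmod h)).
  { apply CRInt_bound. lra.
    intros; apply rcont_minus; [now apply rcont_minus|now apply rcont_scal].
    intros t _. unfold phi, psi, chi. set (b := a + r * cis t).
    replace (a + h + r * cis t) with (b + h) by (unfold b; ring).
    replace (f (b + h) * / (r * cis t) - f b * / (r * cis t) - h * (cder f b * / (r * cis t)))
      with ((f (b + h) - f b - cder f b * h) * / (r * cis t)) by ring.
    rewrite Cmod_mult, Cmod_inv.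
    2:{ apply Cmod_gt_0. rewrite Cmod_mult, Cmod_cis, Cmod_RtoC; lra. }
    rewrite Cmod_mult, Cmod_cis, Cmod_RtoC, Rmult_1_r by lra.
    assert (T : Cmod (f (b + h) - f b - cder f b * h) <= 8 * M / (2 * r * (2 * r)) * Cmod h * Cmod h).
    { apply taylor1. lra.
      apply holo_sub with a rho; auto. unfold b. rewrite Hpt. lra.
      intros z Hz. apply HM. pose proof (Cmod_dist z b a). assert (Hb : Cmod (b - a) = r) by apply Hpt. lra.
      lra. }
    apply Rmult_le_compat_r with (r := (/ r)%R) in T.
    2:{ left. apply Rinv_0_lt_compat; auto. }
    unfold K, Rdiv in *. lra. }
  rewrite EI, Cmod_mult, Mc2, Rminus_0_r in B.
  apply Rmult_le_reg_l in B; [|lra]. eapply Rle_trans. apply B.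
  apply Rmult_le_compat_r; auto.
  apply Rle_trans with ((K + 1) * (eps / (K + 1)))%R. nra. right. field. lra.
Qed.

Theorem holo_cder_holo (f : C -> C) (a : C) (rho : R) :
  holo_disc f a rho -> holo_disc (cder f) a rho.
Proof.
  intros Hf z Hz. set (s := (rho - Cmod (z - a))%R).
  assert (Hs : 0 < s) by (unfold s; lra).
  assert (Hf' : holo_disc f z s) by (apply holo_sub with a rho; auto; unfold s; lra).
  destruct (holo_locally_bounded f z s Hs Hf') as [r [M [Hr HM]]].
  apply cder_derivable with r M; auto. lra.
  apply holo_sub with z s; auto. rewrite Cmod_diag. lra.
Qed.

(** [taylor1] for f' on radius rho / 2, where |f'| <= 2 M / rho, followed by the mean value
    inequality: 64 = 8 x 2 x 4. *)
Lemma taylor2 (f : C -> C) (a h : C) (rho M : R) : 0 < rho ->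
  holo_disc f a rho -> (forall z, Cmod (z - a) < rho -> Cmod (f z) <= M) ->
  Cmod h < rho / 8 ->
  Cmod (f (a + h) - f a - cder f a * h - cder (cder f) a / 2 * (h * h))
   <= 64 * M / (rho * rho * rho) * Cmod h * Cmod h * Cmod h.
Proof.
  intros Hr Hf HM Hh. pose proof (Cmod_ge_0 h) as Ph.
  assert (HM0 : 0 <= M).
  { eapply Rle_trans; [apply Cmod_ge_0|apply (HM a)]. rewrite Cmod_diag. auto. }
  set (l1 := cder f a). set (l2 := cder (cder f) a).
  set (F := fun w => f w - l1 * w - l2 / 2 * ((w - a) * (w - a))).
  set (F' := fun w => cder f w - l1 - l2 * (w - a)).
  replace (f (a + h) - f a - l1 * h - l2 / 2 * (h * h)) with (F (a + h) - F a).
  2:{ unfold F. replace (a + h - a) with h by ring. replace (a - a) with (RtoC 0) by ring. ring. }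
  assert (K0 : 0 <= 64 * M / (rho * rho * rho)).
  { apply Rle_mult_inv_pos. nra. repeat apply Rmult_lt_0_compat; auto. }
  apply mean_value_ineq with (F' := F').
  - intros t Ht. unfold F'. set (w := a + t * h).
    apply cderiv_eq with (cder f w - l1 * 1 - l2 / 2 * ((1 - 0) * (w - a) + (w - a) * (1 - 0))).
    { replace (l2 / 2 * ((1 - 0) * (w - a) + (w - a) * (1 - 0))) with (l2 * (w - a)). ring.
      apply injective_projections; simpl; field. }
    apply cderiv_minus. apply cderiv_minus.
    apply (holo_cder f a _ rho); auto. pose proof (Cmod_seg a a h t Ht).
    rewrite Cmod_diag in H. unfold w. lra.
    apply cderiv_scal, cderiv_id.
    apply cderiv_scal. apply (cderiv_mult (fun u => u - a) (fun u => u - a)); apply cderiv_minus; try apply cderiv_id; apply cderiv_const.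
  - intros t Ht. unfold F'. replace (a + t * h - a) with (t * h) by ring.
    assert (T : Cmod (t * h) <= Cmod h).
    { rewrite Cmod_mult, Cmod_RtoC by lra. nra. }
    eapply Rle_trans. apply taylor1 with (rho := (rho / 2)%R) (M := (M / (rho / 2))%R). lra.
    + apply holo_sub with a rho. now apply holo_cder_holo. rewrite Cmod_diag. lra.
    + intros z Hz. apply cder_bound with a rho; auto; lra.
    + lra.
    + replace (8 * (M / (rho / 2)) / (rho / 2 * (rho / 2)))%R with (64 * M / (rho * rho * rho))%R by (field; lra).
      pose proof (Cmod_ge_0 (t * h)).
      rewrite !(Rmult_assoc (64 * M / (rho * rho * rho))). apply Rmult_le_compat_l; auto. nra.
Qed.

(** * Ultrafilter limits *)

Definition tail_filter (P : nat -> Prop) : Prop :=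
  exists N : nat, forall n : nat, (N <= n)%nat -> P n.

Lemma tail_filter_proper : filter.ProperFilter tail_filter.
Proof.
  split.
  - intros [N H]. exact (H N (le_n N)).
  - split.
    + exists 0%nat. intros; exact I.
    + intros P Q [N HN] [M HM]. exists (Nat.max N M). intros n Hn.
      split; [apply HN|apply HM]; lia.
    + intros P Q S [N HN]. exists N. intros n Hn. apply S, HN, Hn.
Qed.

(** An ultrafilter finer than the filter of tails, given by the closure properties used below, so
    that the library of filters enters only the existence proof. *)
Record free_ultrafilter (U : (nat -> Prop) -> Prop) : Prop := {
  uf_mono : forall P Q : nat -> Prop, (forall n, P n -> Q n) -> U P -> U Q;
  uf_and : forall P Q : nat -> Prop, U P -> U Q -> U (fun n => P n /\ Q n);
  uf_or : forall P : nat -> Prop, U P \/ U (fun n => ~ P n);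
  uf_ex : forall P : nat -> Prop, U P -> exists n, P n;
  uf_tail : forall N : nat, U (fun n => (N <= n)%nat) }.

Lemma free_ultrafilter_exists : exists U, free_ultrafilter U.
Proof.
  destruct (filter.ultraFilterLemma tail_filter_proper) as [G [UG HG]].
  pose proof (@filter.ultra_proper _ _ UG) as PG.
  pose proof (@filter.filter_filter _ _ PG) as FG.
  exists G. constructor.
  - intros P Q. exact (@filter.filterS _ _ FG P Q).
  - intros P Q. exact (@filter.filterI _ _ FG P Q).
  - intros P. exact (@filter.in_ultra_setVsetC _ _ P UG).
  - intros P HP. apply NNPP. intros N. apply (@filter.filter_not_empty _ _ PG).
    apply (@filter.filterS _ _ FG P); auto. intros n Hn. apply N. now exists n.
  - intros N. apply HG. exists N. auto.
Qed.

Lemma uf_INR (U : (nat -> Prop) -> Prop) (HU : free_ultrafilter U) (r : R) :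
  U (fun n => r < INR n).
Proof.
  destruct (INR_unbounded r) as [N HN].
  apply (uf_mono U HU (fun n => (N <= n)%nat)); [|apply uf_tail; auto].
  intros n Hn. apply le_INR in Hn. lra.
Qed.

Definition ulim (U : (nat -> Prop) -> Prop) (x : nat -> C) (l : C) : Prop :=
  forall eps : R, 0 < eps -> U (fun n => Cmod (x n - l) < eps).

Lemma uf_all (U : (nat -> Prop) -> Prop) (HU : free_ultrafilter U) (P : nat -> Prop) : (forall n, P n) -> U P.
Proof.
  intros H. apply (uf_mono U HU (fun n => (0 <= n)%nat)); auto. apply uf_tail, HU.
Qed.

(** The limit is the supremum of the t that are below x n for U-almost all n; [uf_or] decides on
    which side of a given bound x n lies. *)
Lemma ulim_real (U : (nat -> Prop) -> Prop) (HU : free_ultrafilter U) (x : nat -> R) (M : R) : U (fun n => Rabs (x n) <= M) ->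
  exists l : R, forall eps, 0 < eps -> U (fun n => Rabs (x n - l) < eps).
Proof.
  intros HM. destruct (completeness (fun t => U (fun n => t <= x n))) as [l [Hl1 Hl2]].
  - exists M. intros t Ht. destruct (uf_ex U HU _ (uf_and U HU _ _ HM Ht)) as [n [H1 H2]].
    pose proof (Rle_abs (x n)). lra.
  - exists (- M)%R. apply (uf_mono U HU _ _ (fun n (Hn : Rabs (x n) <= M) =>
      proj1 (Rabs_le_between _ _) Hn)) in HM. revert HM. apply (uf_mono U HU). intros n. lra.
  - exists l. intros eps He.
    assert (A : U (fun n => l - eps < x n)).
    { apply NNPP. intros N. assert (l <= l - eps); [|lra]. apply Hl2. intros t Ht.
      apply Rnot_lt_le. intros L. apply N. revert Ht. apply (uf_mono U HU). intros n. lra. }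
    assert (B : U (fun n => x n < l + eps)).
    { destruct (uf_or U HU (fun n => x n < l + eps)) as [B|B]; auto. exfalso.
      assert (l + eps <= l); [|lra]. apply Hl1. revert B. apply (uf_mono U HU). intros n. lra. }
    generalize (uf_and U HU _ _ A B). apply (uf_mono U HU). intros n Hn.
    apply Rabs_lt_between. lra.
Qed.

Lemma ulim_exists (U : (nat -> Prop) -> Prop) (HU : free_ultrafilter U) (x : nat -> C) (M : R) : U (fun n => Cmod (x n) <= M) ->
  exists l, ulim U x l.
Proof.
  intros HM.
  destruct (ulim_real U HU (fun n => Re (x n)) M) as [a Ha].
  { revert HM. apply (uf_mono U HU). intros n Hn. eapply Rle_trans. apply re_le_Cmod. auto. }
  destruct (ulim_real U HU (fun n => Im (x n)) M) as [b Hb].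
  { revert HM. apply (uf_mono U HU). intros n Hn. eapply Rle_trans. apply im_le_Cmod. auto. }
  exists (a, b). intros eps He. assert (H2 : 0 < eps / 2) by lra.
  generalize (uf_and U HU _ _ (Ha _ H2) (Hb _ H2)). apply (uf_mono U HU).
  intros n [H1 H3]. eapply Rle_lt_trans. apply Cmod_le_ReIm.
  rewrite Re_minus, Im_minus. simpl Re at 2. simpl Im at 2. lra.
Qed.

Lemma ulim_le (U : (nat -> Prop) -> Prop) (HU : free_ultrafilter U) (x : nat -> C) (l : C) (M : R) : ulim U x l ->
  U (fun n => Cmod (x n) <= M) -> Cmod l <= M.
Proof.
  intros Hl HM. apply le_epsilon. intros eps He.
  destruct (uf_ex U HU _ (uf_and U HU _ _ HM (Hl eps He))) as [n [H1 H2]].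
  pose proof (Cmod_reverse l (x n)). rewrite Cmod_minus_sym in H. lra.
Qed.

Lemma ulim_ccont (U : (nat -> Prop) -> Prop) (HU : free_ultrafilter U) (f : C -> C) (x : nat -> C) (l : C) :
  ccont f l -> ulim U x l -> ulim U (fun n => f (x n)) (f l).
Proof.
  intros Hf Hx eps He. destruct (Hf eps He) as [d [Hd H]].
  generalize (Hx d Hd). apply (uf_mono U HU). auto.
Qed.

Lemma ulim_plus (U : (nat -> Prop) -> Prop) (HU : free_ultrafilter U) (x y : nat -> C) (l m : C) :
  ulim U x l -> ulim U y m -> ulim U (fun n => x n + y n) (l + m).
Proof.
  intros Hx Hy eps He. assert (H2 : 0 < eps / 2) by lra.
  generalize (uf_and U HU _ _ (Hx _ H2) (Hy _ H2)). apply (uf_mono U HU).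
  intros n [H1 H3]. replace (x n + y n - (l + m)) with ((x n - l) + (y n - m)) by ring.
  eapply Rle_lt_trans. apply Cmod_triangle. lra.
Qed.

Lemma ulim_scal (U : (nat -> Prop) -> Prop) (HU : free_ultrafilter U) (c : C) (x : nat -> C) (l : C) :
  ulim U x l -> ulim U (fun n => c * x n) (c * l).
Proof.
  intros Hx. apply (ulim_ccont U HU (fun z => c * z)); auto.
  eapply cderiv_ccont. apply cderiv_scal, cderiv_id.
Qed.

(** * Maxima of continuous functions on compact sets *)

Definition rccont (f : C -> R) (z : C) : Prop :=
  forall eps : R, 0 < eps -> exists d : R, 0 < d /\
    forall w : C, Cmod (w - z) < d -> Rabs (f w - f z) < eps.

Lemma rccont_comp (phi : R -> R) (f : C -> R) (z : C) :
  continuity_pt phi (f z) -> rccont f z -> rccont (fun w => phi (f w)) z.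
Proof.
  intros Hp Hf eps He.
  destruct (proj1 (continuity_pt_locally phi (f z)) Hp (mkposreal eps He)) as [e Hc]. destruct (Hf e (cond_pos e)) as [d [Hd Hd']].
  exists d. split; auto. intros w Hw. exact (Hc _ (Hd' w Hw)).
Qed.

(* Composing with atan makes f bounded without changing where it is maximal. *)
Lemma extreme_value (S : C -> Prop) (f : C -> R) (z0 : C) (B : R) :
  S z0 -> (forall z, S z -> Cmod z <= B) ->
  (forall z, (forall d, 0 < d -> exists w, S w /\ Cmod (w - z) < d) -> S z) ->
  (forall z, S z -> rccont f z) ->
  exists m, S m /\ forall z, S z -> f z <= f m.
Proof.
  intros H0 HB Hcl Hf. destruct free_ultrafilter_exists as [U HU].
  set (g := fun z => atan (f z)).
  destruct (completeness (fun y => exists z, S z /\ y = g z)) as [s [Hs1 Hs2]].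
  { exists PI. intros y [z [_ ->]]. pose proof (atan_bound (f z)). pose proof PI_RGT_0. unfold g. lra. }
  { exists (g z0), z0. auto. }
  assert (A : forall n : nat, exists z, S z /\ s - / (INR n + 1) < g z).
  { intros n. apply NNPP. intros N. pose proof (pos_INR n).
    assert (P : 0 < / (INR n + 1)) by (apply Rinv_0_lt_compat; lra).
    assert (s <= s - / (INR n + 1)); [|lra]. apply Hs2. intros y [z [Hz ->]].
    apply Rnot_lt_le. intros L. apply N. now exists z. }
  apply choice in A. destruct A as [x Hx].
  destruct (ulim_exists U HU x B) as [m Lm].
  { apply uf_all; auto. intros n. apply HB, Hx. }
  assert (Hm : S m).
  { apply Hcl. intros d Hd. destruct (uf_ex U HU _ (Lm d Hd)) as [n Hn]. exists (x n). split; auto. apply Hx. }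
  assert (Hg : rccont g m).
  { apply (rccont_comp atan); auto. apply derivable_continuous_pt, derivable_pt_atan. }
  exists m. split; auto. intros z Hz. apply Rnot_lt_le. intros L. apply atan_increasing in L.
  assert (s <= g m); [|assert (g z <= s) by (apply Hs1; now exists z); unfold g in *; lra].
  apply le_epsilon. intros eps He. assert (He2 : 0 < eps / 2) by lra.
  destruct (Hg _ He2) as [d [Hd Hc]].
  destruct (archimed_cor1 (eps / 2) He2) as [N0 [HN0 HN1]].
  destruct (uf_ex U HU _ (uf_and U HU _ _ (Lm d Hd) (uf_tail U HU N0))) as [n [G1 G2]].
  specialize (Hc _ G1). apply Rabs_lt_between in Hc. destruct (Hx n) as [_ G3].
  assert (/ (INR n + 1) <= / INR N0).
  { apply Rinv_le_contravar. apply lt_0_INR; auto. apply le_INR in G2. lra. }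
  lra.
Qed.

(** * The maximum principle *)

Lemma rccont_Cmod (f : C -> C) (z : C) : ccont f z -> rccont (fun w => Cmod (f w)) z.
Proof.
  intros H eps He. destruct (H eps He) as [d [Hd H']]. exists d. split; auto.
  intros w Hw. specialize (H' w Hw). apply Rabs_lt_between.
  pose proof (Cmod_reverse (f w) (f z)). pose proof (Cmod_reverse (f z) (f w)) as H1.
  rewrite (Cmod_minus_sym (f z)) in H1. lra.
Qed.

Lemma rccont_continuous (f : C -> R) (z : C) : rccont f z <->
  @continuous (AbsRing_UniformSpace C_AbsRing) R_UniformSpace f z.
Proof.
  split.
  - intros H P [e He]. destruct (H e (cond_pos e)) as [d [Hd Hf]]. exists (mkposreal d Hd).
    intros w Hw. apply He, Hf, Hw.
  - intros H eps He. destruct (H (fun y => Rabs (y - f z) < eps)) as [d Hd].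
    exists (mkposreal eps He). auto.
    exists d. split. apply cond_pos. exact Hd.
Qed.

Lemma rccont_plus (f g : C -> R) (z : C) : rccont f z -> rccont g z ->
  rccont (fun w => (f w + g w)%R) z.
Proof. rewrite !rccont_continuous. apply (@continuous_plus (AbsRing_UniformSpace C_AbsRing) R_AbsRing R_NormedModule). Qed.

Lemma rccont_mult (f g : C -> R) (z : C) : rccont f z -> rccont g z ->
  rccont (fun w => (f w * g w)%R) z.
Proof. rewrite !rccont_continuous. apply (@continuous_mult (AbsRing_UniformSpace C_AbsRing) R_AbsRing). Qed.

Lemma rccont_const (c : R) (z : C) : rccont (fun _ => c) z.
Proof. apply rccont_continuous, (@continuous_const (AbsRing_UniformSpace C_AbsRing)). Qed.

Lemma ccont_id (z : C) : ccont (fun w => w) z.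
Proof. eapply cderiv_ccont, cderiv_id. Qed.

(* The values at z0 +- t, z0 +- it cancel the first- and second-order Taylor terms. *)
Lemma four_point_sum (f : C -> C) (z0 : C) (rho : R) : 0 < rho -> holo_disc f z0 rho ->
  exists K r, 0 <= K /\ 0 < r /\ forall t, 0 < t < r ->
   Cmod (f (z0 + t) + f (z0 + - t) + f (z0 + Ci * t) + f (z0 + - (Ci * t)) - (1 + 1 + 1 + 1) * f z0)
     <= K * t * t * t.
Proof.
  intros Hr Hf. destruct (holo_locally_bounded f z0 rho Hr Hf) as [s [M [Hs HM]]].
  assert (Hfs : holo_disc f z0 s).
  { apply holo_sub with z0 rho; auto. rewrite Cmod_diag. lra. }
  assert (HM0 : 0 <= M).
  { eapply Rle_trans; [apply Cmod_ge_0|apply (HM z0)]. rewrite Cmod_diag. lra. }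
  set (K := (64 * M / (s * s * s))%R).
  assert (K0 : 0 <= K).
  { apply Rle_mult_inv_pos. nra. repeat apply Rmult_lt_0_compat; lra. }
  exists (4 * K)%R, (s / 8)%R. split. lra. split. lra. intros t Ht.
  assert (T : forall h, Cmod h = t ->
    Cmod (f (z0 + h) - f z0 - cder f z0 * h - cder (cder f) z0 / 2 * (h * h)) <= K * t * t * t).
  { intros h Hh. rewrite <- Hh. apply taylor2; auto; lra. }
  assert (Ct : Cmod t = t) by (apply Cmod_RtoC; lra).
  assert (Cit : Cmod (Ci * t) = t) by (rewrite Cmod_mult, Cmod_Ci, Ct; ring).
  pose proof (T (RtoC t) Ct) as T1.
  pose proof (T (- t)%C ltac:(rewrite Cmod_opp; auto)) as T2.
  pose proof (T (Ci * t)%C Cit) as T3.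
  pose proof (T (- (Ci * t))%C ltac:(rewrite Cmod_opp; auto)) as T4.
  assert (E2 : Ci * Ci = - (1)) by (apply injective_projections; simpl; ring).
  replace (Ci * t * (Ci * t)) with (Ci * Ci * (t * t)) in T3 by ring.
  replace (- (Ci * t) * (- (Ci * t))) with (Ci * Ci * (t * t)) in T4 by ring.
  rewrite E2 in T3, T4.
  set (e1 := f (z0 + t) - f z0 - cder f z0 * t - cder (cder f) z0 / 2 * (t * t)) in *.
  set (e2 := f (z0 + - t) - f z0 - cder f z0 * - t - cder (cder f) z0 / 2 * (- t * - t)) in *.
  set (e3 := f (z0 + Ci * t) - f z0 - cder f z0 * (Ci * t) - cder (cder f) z0 / 2 * (- (1) * (t * t))) in *.
  set (e4 := f (z0 + - (Ci * t)) - f z0 - cder f z0 * - (Ci * t) - cder (cder f) z0 / 2 * (- (1) * (t * t))) in *.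
  replace (f (z0 + t) + f (z0 + - t) + f (z0 + Ci * t) + f (z0 + - (Ci * t)) - (1 + 1 + 1 + 1) * f z0)
    with (e1 + e2 + e3 + e4) by (unfold e1, e2, e3, e4; ring).
  eapply Rle_trans. apply Cmod_triangle.
  eapply Rle_trans. apply Rplus_le_compat_r. apply Cmod_triangle.
  eapply Rle_trans. apply Rplus_le_compat_r, Rplus_le_compat_r. apply Cmod_triangle. lra.
Qed.

Lemma Cmod_sqr (z : C) : (Cmod z * Cmod z = Re z * Re z + Im z * Im z)%R.
Proof. pose proof (Cmod2_alt z). simpl in H. lra. Qed.

Lemma parallelogram_4 (w : C) (t : R) :
  (Cmod (w + t) * Cmod (w + t) + Cmod (w + - t) * Cmod (w + - t) +
   Cmod (w + Ci * t) * Cmod (w + Ci * t) + Cmod (w + - (Ci * t)) * Cmod (w + - (Ci * t)) =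
   4 * (Cmod w * Cmod w) + 4 * (t * t))%R.
Proof.
  rewrite !Cmod_sqr. destruct w. simpl. ring.
Qed.

Definition bounded_closed (S : C -> Prop) : Prop :=
  (exists B, forall z, S z -> Cmod z <= B) /\
  (forall z, (forall d, 0 < d -> exists w, S w /\ Cmod (w - z) < d) -> S z).

(** If |f z1| > B, add a small strictly subharmonic term: u = |f| + eps |z - z1|^2 still has its
    maximum at an interior point z0. Sum over the four points z0 +- t, z0 +- it. With c f z0 = |f
    z0|, Re (c f) loses at most K t^3 against 4 |f z0|, while the quadratic term gains 4 eps t^2.
    For small t this contradicts maximality. *)
Theorem maximum_principle (S : C -> Prop) (f : C -> C) (B : R) :
  bounded_closed S -> (forall z, S z -> ccont f z) ->
  (forall z, S z -> Cmod (f z) <= B \/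
     exists rho, 0 < rho /\ (forall w, Cmod (w - z) < rho -> S w) /\ holo_disc f z rho) ->
  forall z, S z -> Cmod (f z) <= B.
Proof.
  intros [[D HD] Hcl] Hc HB z1 Hz1. apply Rnot_lt_le. intros L.
  set (D2 := ((2 * D) * (2 * D) + 1)%R).
  assert (HD2 : 0 < D2) by (unfold D2; nra).
  (* D2 dominates |z - z1|^2 on S: the perturbation is at most half of the gap |f z1| - B, so the
     maximum of u is not at a point where |f| <= B. *)
  set (eps := ((Cmod (f z1) - B) / D2 / 2)%R).
  assert (He : 0 < eps) by (unfold eps; repeat apply Rdiv_lt_0_compat; lra).
  set (u := fun z => (Cmod (f z) + eps * (Cmod (z - z1) * Cmod (z - z1)))%R).
  assert (Cq : forall z, rccont (fun w => (Cmod (w - z1) * Cmod (w - z1))%R) z).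
  { intros z. assert (rccont (fun w => Cmod (w - z1)) z).
    { apply (rccont_Cmod (fun w => w - z1)). eapply cderiv_ccont.
      apply cderiv_minus. apply cderiv_id. apply cderiv_const. }
    now apply rccont_mult. }
  destruct (extreme_value S u z1 D) as [z0 [Hz0 Hmax]]; auto.
  { intros z Hz. apply rccont_plus. apply rccont_Cmod; auto.
    apply rccont_mult. apply rccont_const. apply Cq. }
  assert (Q : forall z, S z -> Cmod (z - z1) * Cmod (z - z1) <= (2 * D) * (2 * D)).
  { intros z Hz. pose proof (Cmod_ge_0 (z - z1)). pose proof (Cmod_triangle_minus z z1).
    pose proof (HD z Hz). pose proof (HD z1 Hz1). apply Rmult_le_compat; lra. }
  assert (G : Cmod (f z1) <= u z0).
  { replace (Cmod (f z1)) with (u z1). auto. unfold u. rewrite Cmod_diag. ring. }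
  destruct (HB z0 Hz0) as [L0|[rho [Hrho [Hin Hf]]]].
  - specialize (Q z0 Hz0).
    assert (eps * (Cmod (z0 - z1) * Cmod (z0 - z1)) <= eps * D2).
    { apply Rmult_le_compat_l. lra. unfold D2. lra. }
    assert (eps * D2 = (Cmod (f z1) - B) / 2)%R by (unfold eps; field; lra).
    unfold u in G. lra.
  - destruct (four_point_sum f z0 rho Hrho Hf) as [K [r [HK [Hr H4]]]].
    destruct (Re_conj_unit (f z0)) as [c [Hc1 Hc2]].
    (* The last bound makes K t^3 <= eps t^2, less than the gain 4 eps t^2. *)
    set (t := Rmin (Rmin (r / 2) (rho / 2)) (eps / (K + 1))).
    assert (Ht : 0 < t).
    { unfold t. repeat apply Rmin_pos; try lra. apply Rdiv_lt_0_compat; lra. }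
    assert (Ht1 : t < r).
    { apply Rle_lt_trans with (r / 2)%R; [|lra]. unfold t. eapply Rle_trans. apply Rmin_l. apply Rmin_l. }
    assert (Ht2 : t < rho).
    { apply Rle_lt_trans with (rho / 2)%R; [|lra]. unfold t. eapply Rle_trans. apply Rmin_l. apply Rmin_r. }
    assert (Ht3 : t <= eps / (K + 1)) by apply Rmin_r.
    assert (Ht4 : (K + 1) * t <= eps).
    { apply Rle_trans with ((K + 1) * (eps / (K + 1)))%R. apply Rmult_le_compat_l; lra.
      right. field. lra. }
    clearbody t. specialize (H4 t ltac:(lra)).
    assert (Ct : Cmod t = t) by (apply Cmod_RtoC; lra).
    assert (Cit : Cmod (Ci * t) = t) by (rewrite Cmod_mult, Cmod_Ci, Ct; ring).
    assert (P : forall h, Cmod h = t -> Re (c * f (z0 + h))%C +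
       eps * (Cmod (z0 - z1 + h) * Cmod (z0 - z1 + h)) <= u z0).
    { intros h Hh. eapply Rle_trans; [|apply (Hmax (z0 + h))].
      2:{ apply Hin. replace (z0 + h - z0) with h by ring. lra. }
      unfold u. replace (z0 - z1 + h) with (z0 + h - z1) by ring.
      apply Rplus_le_compat_r. eapply Rle_trans. apply Rle_abs.
      eapply Rle_trans. apply re_le_Cmod. rewrite Cmod_mult, Hc1. lra. }
    pose proof (P (RtoC t) Ct) as P1.
    pose proof (P (- t)%C ltac:(rewrite Cmod_opp; auto)) as P2.
    pose proof (P (Ci * t)%C Cit) as P3.
    pose proof (P (- (Ci * t))%C ltac:(rewrite Cmod_opp; auto)) as P4.
    pose proof (parallelogram_4 (z0 - z1) t) as PL.
    set (Sm := f (z0 + t) + f (z0 + - t) + f (z0 + Ci * t) + f (z0 + - (Ci * t)) - (1 + 1 + 1 + 1) * f z0) in *.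
    assert (RS : Re (c * Sm)%C = (Re (c * f (z0 + t)%C)%C + Re (c * f (z0 + - t)%C)%C +
       Re (c * f (z0 + Ci * t)%C)%C + Re (c * f (z0 + - (Ci * t))%C)%C - 4 * Cmod (f z0))%R).
    { replace (c * Sm) with (c * f (z0 + t) + c * f (z0 + - t) + c * f (z0 + Ci * t) +
        c * f (z0 + - (Ci * t)) - (1 + 1 + 1 + 1) * (c * f z0)) by (unfold Sm; ring).
      rewrite Hc2, Re_minus, !Re_plus. simpl. ring. }
    assert (RB : - (K * t * t * t) <= Re (c * Sm)%C).
    { pose proof (re_le_Cmod (c * Sm)) as R1. rewrite Cmod_mult, Hc1, Rmult_1_l in R1.
      pose proof (Rle_abs (- Re (c * Sm)%C)) as R2. rewrite Rabs_Ropp in R2. lra. }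
    unfold u in *. assert (0 < t * t)%R by nra.
    assert (K * t * t * t <= eps * (t * t))%R.
    { replace (K * t * t * t)%R with (K * t * (t * t))%R by ring. apply Rmult_le_compat_r; nra. }
    nra.
Qed.

Lemma closed_disc_bounded_closed (a : C) (r : R) :
  bounded_closed (fun z => Cmod (z - a) <= r).
Proof.
  split.
  - exists (r + Cmod a)%R. intros z Hz. pose proof (Cmod_reverse z a). lra.
  - intros z H. apply le_epsilon. intros eps He. destruct (H eps He) as [w [Hw1 Hw2]].
    pose proof (Cmod_dist z w a). rewrite (Cmod_minus_sym z w) in H0. lra.
Qed.

Lemma closed_annulus_bounded_closed (a : C) (r s : R) :
  bounded_closed (fun z => r <= Cmod (z - a) <= s).
Proof.
  split.
  - exists (s + Cmod a)%R. intros z Hz. pose proof (Cmod_reverse z a). lra.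
  - intros z H. split; apply le_epsilon; intros eps He; destruct (H eps He) as [w [Hw1 Hw2]].
    pose proof (Cmod_dist w z a). lra.
    pose proof (Cmod_dist z w a). rewrite (Cmod_minus_sym z w) in H0. lra.
Qed.

Lemma maximum_principle_disc (f : C -> C) (a : C) (r rho B : R) : 0 < r < rho ->
  holo_disc f a rho -> (forall z, Cmod (z - a) = r -> Cmod (f z) <= B) ->
  forall z, Cmod (z - a) <= r -> Cmod (f z) <= B.
Proof.
  intros Hr Hf HB. apply maximum_principle.
  - apply closed_disc_bounded_closed.
  - intros z Hz. destruct (Hf z) as [l Hl]. lra. eapply cderiv_ccont; eauto.
  - intros z Hz. destruct (Rle_lt_or_eq_dec _ _ Hz) as [L|E]; [right|left; auto].
    exists (r - Cmod (z - a))%R. split. lra. split.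
    + intros w Hw. pose proof (Cmod_dist w z a). lra.
    + apply holo_sub with a rho; auto. lra.
Qed.

Lemma holo_div (f g : C -> C) (a : C) (rho : R) : holo_disc f a rho -> holo_disc g a rho ->
  (forall z, Cmod (z - a) < rho -> g z <> 0) -> holo_disc (fun z => f z / g z) a rho.
Proof.
  intros Hf Hg N z Hz. destruct (Hf z Hz) as [l Hl]. destruct (Hg z Hz) as [m Hm].
  eexists. apply cderiv_div; eauto.
Qed.

Lemma holo_const (c a : C) (rho : R) : holo_disc (fun _ => c) a rho.
Proof. intros z _. exists 0. apply cderiv_const. Qed.

Lemma holo_minus (f g : C -> C) (a : C) (rho : R) : holo_disc f a rho -> holo_disc g a rho ->
  holo_disc (fun z => f z - g z) a rho.
Proof.
  intros Hf Hg z Hz. destruct (Hf z Hz) as [l Hl]. destruct (Hg z Hz) as [m Hm].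
  eexists. apply cderiv_minus; eauto.
Qed.

(* Maximum principle for 1 / f. *)
Theorem zero_in_disc (f : C -> C) (a : C) (r rho m : R) : 0 < r < rho ->
  holo_disc f a rho -> (forall z, Cmod (z - a) = r -> m <= Cmod (f z)) ->
  Cmod (f a) < m -> exists z, Cmod (z - a) < r /\ f z = 0.
Proof.
  intros Hr Hf Hm Ha. apply NNPP. intros N.
  pose proof (Cmod_ge_0 (f a)) as P0.
  assert (NZ : forall z, Cmod (z - a) <= r -> f z <> 0).
  { intros z Hz E. destruct (Rle_lt_or_eq_dec _ _ Hz) as [L|E'].
    - apply N. now exists z.
    - specialize (Hm z E'). rewrite E, Cmod_0 in Hm. lra. }
  assert (Ha0 : f a <> 0) by (apply NZ; rewrite Cmod_diag; lra).
  pose proof (Cmod_pos _ Ha0) as Pa.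
  assert (Hd : forall z, Cmod (z - a) <= r -> exists l, cderiv (fun w => / f w) z l).
  { intros z Hz. destruct (Hf z) as [l Hl]. lra. eexists. apply cderiv_inv; eauto. }
  assert (I : Cmod (/ f a) <= / m).
  { apply (maximum_principle (fun z => Cmod (z - a) <= r) (fun w => / f w)).
    - apply closed_disc_bounded_closed.
    - intros z Hz. destruct (Hd z Hz) as [l Hl]. eapply cderiv_ccont; eauto.
    - intros z Hz. destruct (Rle_lt_or_eq_dec _ _ Hz) as [L|E]; [right|left; auto].
      exists (r - Cmod (z - a))%R. split. lra. split.
      + intros w Hw. pose proof (Cmod_dist w z a). lra.
      + intros w Hw. apply Hd. pose proof (Cmod_dist w z a). lra.
      + specialize (Hm z E). rewrite Cmod_inv by auto. apply Rinv_le_contravar; lra.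
    - rewrite Cmod_diag. lra. }
  rewrite Cmod_inv in I by auto.
  apply Rinv_le_contravar in I; [|apply Rinv_0_lt_compat; lra].
  rewrite !Rinv_inv in I. lra.
Qed.

(** * Local inversion, isolated zeros, Liouville's theorem *)

Lemma Cmod_convex (a z w : C) (t r : R) : 0 <= t <= 1 ->
  Cmod (z - a) < r -> Cmod (w - a) < r -> Cmod (z + t * (w - z) - a) < r.
Proof.
  intros Ht Hz Hw.
  replace (z + t * (w - z) - a) with ((1 - t)%R * (z - a) + t * (w - a)) by (rewrite RtoC_minus; ring).
  eapply Rle_lt_trans. apply Cmod_triangle. rewrite !Cmod_mult, !Cmod_RtoC by lra.
  destruct (Req_dec t 0) as [->|N]. lra. nra.
Qed.

Lemma expansion_of_nearly_constant_derivative (K : C -> C) (w0 A z w : C) (s : R) :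
  holo_disc K w0 s ->
  (forall w, Cmod (w - w0) < s -> Cmod (cder K w - A) <= Cmod A / 2) ->
  Cmod (z - w0) < s -> Cmod (w - w0) < s ->
  Cmod A / 2 * Cmod (w - z) <= Cmod (K w - K z).
Proof.
  intros HK HA Hz Hw.
  pose proof (mean_value_ineq_affine K (cder K) A z (w - z) (Cmod A / 2)) as M.
  replace (z + (w - z)) with w in M by ring.
  assert (B : Cmod (K w - K z - A * (w - z)) <= Cmod A / 2 * Cmod (w - z)).
  { apply M; intros t Ht.
    - apply (holo_cder K w0 _ s); auto. apply Cmod_convex; auto.
    - apply HA. apply Cmod_convex; auto. }
  pose proof (Cmod_reverse (A * (w - z)) (K w - K z)) as R.
  rewrite (Cmod_minus_sym (A * (w - z))), Cmod_mult in R. lra.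
Qed.

(** An inverse function theorem with explicit radius: the domain of the section depends only on |A|
    and s, so it does not shrink along a sequence of functions for which these are bounded below.
    [zero_in_disc] gives surjectivity, the expansion estimate gives differentiability. *)
Theorem local_section (K : C -> C) (w0 A : C) (s : R) : 0 < s -> A <> 0 ->
  holo_disc K w0 s ->
  (forall w, Cmod (w - w0) < s -> Cmod (cder K w - A) <= Cmod A / 2) ->
  exists sigma : C -> C, forall y, Cmod (y - K w0) < Cmod A * s / 8 ->
    Cmod (sigma y - w0) < s /\ K (sigma y) = y /\ exists l, cderiv sigma y l.
Proof.
  intros Hs HA HK HD. pose proof (Cmod_pos _ HA) as PA.
  pose proof (fun z w => expansion_of_nearly_constant_derivative K w0 A z w s HK HD) as EXP.
  (* On the circle of radius s / 2 the expansion estimate gives |K z - K w0| >= 2 q, hence |K z - y|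
     >= q when |y - K w0| < q. *)
  set (q := (Cmod A * s / 8)%R) in *. assert (Hq : 0 < q) by (unfold q; nra).
  assert (SURJ : forall y, exists w, Cmod (y - K w0) < q -> Cmod (w - w0) < s / 2 /\ K w = y).
  { intros y. destruct (Rlt_le_dec (Cmod (y - K w0)) q) as [L|G]; [|exists 0; intros; lra].
    destruct (zero_in_disc (fun w => K w - y) w0 (s / 2) s q) as [w [W1 W2]].
    - lra.
    - apply holo_minus; auto. apply holo_const.
    - intros z Hz. assert (Hw0 : Cmod (w0 - w0) < s) by (rewrite Cmod_diag; auto).
      pose proof (EXP w0 z Hw0 ltac:(lra)) as E. rewrite Hz in E.
      pose proof (Cmod_dist (K z) y (K w0)). unfold q in *. nra.
    - rewrite Cmod_minus_sym. auto.
    - exists w. intros _. split; auto. now apply Cminus_eq_0. }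
  apply choice in SURJ. destruct SURJ as [sigma Hsig].
  exists sigma. intros y Hy. destruct (Hsig y Hy) as [S1 S2].
  split. lra. split. auto.
  set (w := sigma y) in *. assert (Hw : Cmod (w - w0) < s) by lra.
  set (l := cder K w).
  assert (Hl : Cmod A / 2 <= Cmod l).
  { pose proof (HD w Hw). pose proof (Cmod_reverse A l). rewrite Cmod_minus_sym in H0. fold l in H. lra. }
  assert (Hl0 : l <> 0) by (intros E; rewrite E, Cmod_0 in Hl; lra).
  exists (/ l). intros eps He.
  (* One factor |A| / 2 pays for |w' - w| <= 2 |k| / |A|, the other for the division by l. *)
  set (e := (eps * (Cmod A / 2) * (Cmod A / 2))%R).
  assert (He' : 0 < e) by (unfold e; repeat apply Rmult_lt_0_compat; lra).
  destruct (holo_cder K w0 w s HK Hw e He') as [d [Hd HdK]]. fold l in HdK.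
  set (d1 := (q - Cmod (y - K w0))%R). assert (Hd1 : 0 < d1) by (unfold d1; lra).
  exists (Rmin d1 (d * (Cmod A / 2))). split. apply Rmin_pos; nra.
  intros k Hk.
  destruct (proj1 (Rmin_Rgt _ _ _) Hk) as [k1 k2].
  assert (Hyk : Cmod (y + k - K w0) < q).
  { replace (y + k - K w0) with ((y - K w0) + k) by ring. eapply Rle_lt_trans. apply Cmod_triangle.
    unfold d1 in k1. lra. }
  destruct (Hsig (y + k) Hyk) as [T1 T2]. fold w. set (w' := sigma (y + k)) in *.
  assert (Ex : Cmod A / 2 * Cmod (w' - w) <= Cmod k).
  { pose proof (EXP w w' Hw ltac:(lra)) as E. rewrite T2, S2 in E.
    replace (y + k - y) with k in E by ring. exact E. }
  assert (Hw' : Cmod (w' - w) < d) by nra.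
  specialize (HdK (w' - w) Hw'). replace (w + (w' - w)) with w' in HdK by ring.
  rewrite T2, S2 in HdK. replace (y + k - y) with k in HdK by ring.
  replace (w' - w - / l * k) with (- / l * (k - l * (w' - w))) by (field; auto).
  rewrite Cmod_mult, Cmod_opp, Cmod_inv by auto.
  pose proof (Cmod_ge_0 (w' - w)). pose proof (Cmod_ge_0 k).
  apply Rmult_le_reg_l with (Cmod l). lra.
  rewrite <- Rmult_assoc, Rinv_r, Rmult_1_l by lra.
  eapply Rle_trans. apply HdK. unfold e.
  apply Rle_trans with (eps * (Cmod A / 2) * Cmod k)%R.
  - rewrite !Rmult_assoc. apply Rmult_le_compat_l; [lra|]. apply Rmult_le_compat_l; lra.
  - apply Rle_trans with (Cmod A / 2 * (eps * Cmod k))%R. right; ring.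
    apply Rmult_le_compat_r; auto. apply Rmult_le_pos; lra.
Qed.

Lemma holo_bounded_closed_disc (f : C -> C) (a : C) (r rho : R) : 0 <= r < rho ->
  holo_disc f a rho -> exists M, 0 <= M /\ forall z, Cmod (z - a) <= r -> Cmod (f z) <= M.
Proof.
  intros Hr Hf. destruct (closed_disc_bounded_closed a r) as [[B HB] Hcl].
  destruct (extreme_value (fun z => Cmod (z - a) <= r) (fun z => Cmod (f z)) a B) as [m [_ Hm]]; auto.
  - rewrite Cmod_diag. lra.
  - intros z Hz. apply rccont_Cmod. destruct (Hf z) as [l Hl]. lra. eapply cderiv_ccont; eauto.
  - exists (Cmod (f m)). split. apply Cmod_ge_0. auto.
Qed.

(** * Difference quotients, removable singularities, isolated zeros *)

Definition dquot (f : C -> C) (a z : C) : C :=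
  if excluded_middle_informative (z = a) then cder f a else (f z - f a) / (z - a).

Lemma dquot_at (f : C -> C) (a : C) : dquot f a a = cder f a.
Proof. unfold dquot. destruct excluded_middle_informative; congruence. Qed.

Lemma dquot_off (f : C -> C) (a z : C) : z <> a -> dquot f a z = (f z - f a) / (z - a).
Proof. unfold dquot. destruct excluded_middle_informative; congruence. Qed.

Lemma dquot_eq (f : C -> C) (a z : C) : f z = f a + (z - a) * dquot f a z.
Proof.
  destruct (classic (z = a)) as [->|N]. ring. rewrite dquot_off by auto.
  field. now apply Cminus_neq_0.
Qed.

(** At the centre [taylor2] gives the derivative f''(a) / 2; elsewhere the quotient rule applies. *)
Lemma dquot_holo (f : C -> C) (a : C) (rho : R) :
  holo_disc f a rho -> holo_disc (dquot f a) a rho.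
Proof.
  intros Hf z Hz. destruct (classic (z = a)) as [->|N].
  - assert (Hr : 0 < rho) by (rewrite Cmod_diag in Hz; auto).
    destruct (holo_locally_bounded f a rho Hr Hf) as [s [M [Hs HM]]].
    assert (Hfs : holo_disc f a s).
    { apply holo_sub with a rho; auto. rewrite Cmod_diag. lra. }
    assert (HM0 : 0 <= M).
    { eapply Rle_trans; [apply Cmod_ge_0|apply (HM a)]. rewrite Cmod_diag. lra. }
    set (K := (64 * M / (s * s * s))%R).
    assert (K0 : 0 <= K).
    { apply Rle_mult_inv_pos. nra. repeat apply Rmult_lt_0_compat; lra. }
    exists (cder (cder f) a / 2). intros eps He.
    exists (Rmin (s / 8) (eps / (K + 1))). split.
    apply Rmin_pos; [lra|apply Rdiv_lt_0_compat; lra]. intros h Hh.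
    destruct (proj1 (Rmin_Rgt _ _ _) Hh) as [h1 h2].
    rewrite dquot_at. destruct (classic (h = 0)) as [->|Nh].
    + rewrite Cplus_0_r, dquot_at. replace (cder f a - cder f a - _ * 0) with (RtoC 0) by ring.
      rewrite Cmod_0. lra.
    + rewrite dquot_off.
      2:{ intros E. apply Nh. replace h with (a + h - a) by ring. rewrite E. ring. }
      replace (a + h - a) with h by ring.
      pose proof (taylor2 f a h s M ltac:(lra) Hfs HM h1) as T. fold K in T.
      replace ((f (a + h) - f a) / h - cder f a - cder (cder f) a / 2 * h) with
        ((f (a + h) - f a - cder f a * h - cder (cder f) a / 2 * (h * h)) / h).
      2:{ assert (RtoC 2 <> 0) by (intros E; apply RtoC_inj in E; lra). field. auto. }
      rewrite Cmod_div by auto. pose proof (Cmod_pos _ Nh) as Ph.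
      apply Rmult_le_reg_r with (Cmod h); auto. unfold Rdiv.
      rewrite Rmult_assoc, Rinv_l, Rmult_1_r by lra. eapply Rle_trans. apply T.
      rewrite !Rmult_assoc. rewrite <- !(Rmult_assoc _ (Cmod h)).
      assert (K * Cmod h <= eps).
      { apply Rle_trans with ((K + 1) * (eps / (K + 1)))%R. nra. right. field. lra. }
      assert (0 <= Cmod h * Cmod h)%R by nra. nra.
  - destruct (Hf z Hz) as [l Hl]. pose proof (Cminus_neq_0 _ _ N) as N'.
    eexists. apply cderiv_ext_loc with (f := fun w => (f w - f a) / (w - a)) (r := Cmod (z - a)).
    + now apply Cmod_pos.
    + intros w Hw. symmetry. apply dquot_off. intros ->. rewrite Cmod_minus_sym in Hw. lra.
    + apply cderiv_div; auto. apply cderiv_minus; eauto. apply cderiv_const.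
      apply cderiv_minus. apply cderiv_id. apply cderiv_const.
Qed.

(** The function (z - a)^2 f z vanishes at a together with its derivative, whatever value f has
    there. Two divisions by z - a through [dquot] then recover a holomorphic extension of f. *)
Theorem riemann_removable (f : C -> C) (a : C) (rho M : R) : 0 < rho ->
  (forall z, z <> a -> Cmod (z - a) < rho -> exists l, cderiv f z l) ->
  (forall z, z <> a -> Cmod (z - a) < rho -> Cmod (f z) <= M) ->
  exists h, holo_disc h a rho /\ forall z, z <> a -> h z = f z.
Proof.
  intros Hr Hf HM. set (k := fun z => (z - a) * (z - a) * f z).
  assert (Dk : forall z, cderiv (fun z => (z - a) * (z - a)) z ((1 - 0) * (z - a) + (z - a) * (1 - 0))).
  { intros z. apply (cderiv_mult (fun z => z - a) (fun z => z - a));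
    apply cderiv_minus; (apply cderiv_id || apply cderiv_const). }
  assert (Ka : cderiv k a 0).
  { intros eps He. set (A := (Rabs M + 1)%R). pose proof (Rabs_pos M).
    exists (Rmin rho (eps / A)). split. apply Rmin_pos; auto. apply Rdiv_lt_0_compat; unfold A; lra.
    intros h Hh. unfold k. replace (a + h - a) with h by ring. replace (a - a) with (RtoC 0) by ring.
    replace (h * h * f (a + h) - 0 * 0 * f a - 0 * h) with (h * h * f (a + h)) by ring.
    destruct (proj1 (Rmin_Rgt _ _ _) Hh) as [h1 h2].
    destruct (classic (h = 0)) as [->|N].
    - rewrite !Cmod_mult, Cmod_0. lra.
    - rewrite !Cmod_mult. assert (B : Cmod (f (a + h)) <= A).
      { eapply Rle_trans. apply HM. intros E. apply N. replace h with (a + h - a) by ring. rewrite E. ring.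
        replace (a + h - a) with h by ring. auto. pose proof (Rle_abs M). unfold A. lra. }
      pose proof (Cmod_ge_0 h). pose proof (Cmod_ge_0 (f (a + h))).
      assert (Cmod h * A <= eps).
      { apply Rle_trans with (eps / A * A)%R. unfold A in *. nra. right. field. unfold A. lra. }
      apply Rle_trans with (Cmod h * (Cmod h * A))%R. rewrite Rmult_assoc.
      apply Rmult_le_compat_l; auto. apply Rmult_le_compat_l; auto. nra. }
  assert (Hk : holo_disc k a rho).
  { intros z Hz. destruct (classic (z = a)) as [->|N]. now exists 0.
    destruct (Hf z N Hz) as [l Hl]. eexists. unfold k.
    apply (cderiv_mult (fun z => (z - a) * (z - a)) f); eauto. }
  set (q := dquot k a). assert (Hq : holo_disc q a rho) by (apply dquot_holo; auto).
  assert (Eq : forall z, q z = (z - a) * f z).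
  { intros z. unfold q. destruct (classic (z = a)) as [->|N].
    - rewrite dquot_at, (cder_unique k a 0 Ka). ring.
    - rewrite dquot_off by auto. unfold k. field. now apply Cminus_neq_0. }
  exists (dquot q a). split. now apply dquot_holo.
  intros z N. rewrite dquot_off, !Eq by auto. field. now apply Cminus_neq_0.
Qed.

(** Divide repeatedly by z - a. If the quotients all vanish at a, the maximum principle on |z - a| =
    r gives |f z| <= M (|z - a| / r)^n for every n, so f = 0. Otherwise the first quotient that is
    nonzero at a is nonzero nearby by continuity. *)
Theorem zeros_isolated (f : C -> C) (a : C) (rho : R) : 0 < rho -> holo_disc f a rho ->
  (forall z, Cmod (z - a) < rho -> f z = 0) \/
  exists d, 0 < d /\ forall z, z <> a -> Cmod (z - a) < d -> f z <> 0.
Proof.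
  intros Hr Hf.
  set (fs := fix fs n := match n with O => f | S m => dquot (fs m) a end).
  assert (Hfs : forall n, holo_disc (fs n) a rho).
  { induction n. exact Hf. now apply dquot_holo. }
  assert (FACT : forall n, (forall m, (m < n)%nat -> fs m a = 0) -> forall z, f z = (z - a) ^ n * fs n z).
  { induction n; intros H z.
    - simpl. ring.
    - rewrite IHn by (intros m Hm; apply H; lia). rewrite (dquot_eq (fs n) a z), H by lia.
      simpl. ring. }
  destruct (classic (forall n, fs n a = 0)) as [Z|N].
  - left. intros z Hz. set (r := ((Cmod (z - a) + rho) / 2)%R). pose proof (Cmod_ge_0 (z - a)) as Pz.
    assert (Hr2 : Cmod (z - a) < r < rho) by (unfold r; lra).
    destruct (holo_bounded_closed_disc f a r rho ltac:(lra) Hf) as [M [HM0 HM]].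
    assert (B : forall n, Cmod (f z) <= M * (Cmod (z - a) / r) ^ n).
    { intros n. assert (Pr : 0 < r ^ n) by (apply pow_lt; lra).
      assert (B1 : Cmod (fs n z) <= M / r ^ n).
      { apply (maximum_principle_disc (fs n) a r rho); auto; try lra.
        intros w Hw. specialize (HM w ltac:(lra)). rewrite (FACT n) in HM by auto.
        rewrite Cmod_mult, Cmod_pow, Hw in HM. apply Rmult_le_reg_l with (r ^ n)%R; auto.
        replace (r ^ n * (M / r ^ n))%R with M by (field; lra). auto. }
      rewrite (FACT n) by auto. rewrite Cmod_mult, Cmod_pow.
      unfold Rdiv. rewrite Rpow_mult_distr, pow_inv.
      apply Rle_trans with (Cmod (z - a) ^ n * (M / r ^ n))%R.
      apply Rmult_le_compat_l; auto. apply pow_le; auto. right. unfold Rdiv. ring. }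
    apply Cmod_eq_0. apply Rle_antisym; [|apply Cmod_ge_0]. apply le_epsilon. intros eps He.
    set (x := (Cmod (z - a) / r)%R) in *.
    assert (Hx : 0 <= x < 1).
    { unfold x. split. apply Rle_mult_inv_pos; lra. apply Rmult_lt_reg_r with r. lra.
      unfold Rdiv. rewrite Rmult_assoc, Rinv_l by lra. lra. }
    destruct (pow_lt_1_zero x ltac:(rewrite Rabs_pos_eq; lra) (eps / (M + 1))) as [n Hn].
    { apply Rdiv_lt_0_compat; lra. }
    specialize (Hn n (le_n n)). rewrite Rabs_pos_eq in Hn by (apply pow_le; lra).
    specialize (B n). assert (0 <= x ^ n)%R by (apply pow_le; lra).
    assert ((M + 1) * x ^ n <= eps)%R.
    { apply Rle_trans with ((M + 1) * (eps / (M + 1)))%R. apply Rmult_le_compat_l; lra.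
      right. field. lra. }
    nra.
  - right. apply not_all_ex_not in N. destruct N as [n0 Hn0].
    assert (MIN : exists n, fs n a <> 0 /\ forall m, (m < n)%nat -> fs m a = 0).
    { revert Hn0. pattern n0. apply (well_founded_induction Wf_nat.lt_wf). clear n0. intros n IH Hn.
      destruct (classic (exists m, (m < n)%nat /\ fs m a <> 0)) as [[m [Hm1 Hm2]]|N].
      - now apply (IH m).
      - exists n. split; auto. intros m Hm. apply NNPP. intros E. apply N. now exists m. }
    destruct MIN as [n [Hn Hm]]. destruct (Hfs n a) as [l Hl]. rewrite Cmod_diag; auto.
    destruct (cderiv_ccont _ _ _ Hl (Cmod (fs n a)) (Cmod_pos _ Hn)) as [d [Hd H]].
    exists d. split; auto. intros z Nz Hz E. rewrite (FACT n) in E by auto.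
    specialize (H z Hz). apply (f_equal Cmod) in E. rewrite Cmod_mult, Cmod_pow, Cmod_0 in E.
    pose proof (pow_lt (Cmod (z - a)) n (Cmod_pos _ (Cminus_neq_0 _ _ Nz))).
    apply Rmult_integral in E. destruct E as [E|E]; [lra|]. apply Cmod_eq_0 in E.
    rewrite E in H. replace (0 - fs n a) with (- fs n a) in H by ring. rewrite Cmod_opp in H. lra.
Qed.

Lemma identity_on_disc (f : C -> C) (a : C) (rho eps : R) : 0 < eps -> holo_disc f a rho ->
  (forall z, Cmod (z - a) < eps -> f z = 0) -> forall z, Cmod (z - a) < rho -> f z = 0.
Proof.
  intros He Hf Hz z Hzr. assert (Hr : 0 < rho) by (pose proof (Cmod_ge_0 (z - a)); lra).
  destruct (zeros_isolated f a rho Hr Hf) as [Z|[d [Hd N]]]; auto. exfalso.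
  set (t := (Rmin eps d / 2)%R). pose proof (Rmin_pos _ _ He Hd).
  pose proof (Rmin_l eps d). pose proof (Rmin_r eps d).
  assert (Ht : Cmod t = t) by (apply Cmod_RtoC; unfold t; lra).
  apply (N (a + t)).
  - intros E. assert (E' : RtoC t = 0) by (replace (RtoC t) with (a + t - a) by ring; rewrite E; ring).
    apply RtoC_inj in E'. unfold t in E'. lra.
  - replace (a + t - a) with (RtoC t) by ring. rewrite Ht. unfold t. lra.
  - apply Hz. replace (a + t - a) with (RtoC t) by ring. rewrite Ht. unfold t. lra.
Qed.

Lemma liouville (f : C -> C) (M : R) : (forall z, exists l, cderiv f z l) ->
  (forall z, Cmod (f z) <= M) -> forall z w, f z = f w.
Proof.
  intros Hf HM.
  assert (Z : forall z, cder f z = 0).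
  { intros z. apply Cmod_eq_0. apply Rle_antisym; [|apply Cmod_ge_0]. apply Rnot_lt_le. intros P.
    assert (HM0 : 0 <= M) by (eapply Rle_trans; [apply Cmod_ge_0|apply (HM z)]).
    assert (E : Cmod (cder f z) * ((M + 1) / Cmod (cder f z)) <= M).
    { apply cauchy_estimate. apply Rdiv_lt_0_compat; lra. intros w _; auto. auto. }
    replace (Cmod (cder f z) * ((M + 1) / Cmod (cder f z)))%R with (M + 1)%R in E by (field; lra). lra. }
  intros z w. apply Cminus_eq_0, Cmod_eq_0. apply Rle_antisym; [|apply Cmod_ge_0].
  pose proof (mean_value_ineq f (cder f) w (z - w) 0) as B.
  replace (w + (z - w)) with z in B by ring. rewrite Rmult_0_l in B. apply B.
  - intros t _. apply cder_correct, Hf.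
  - intros t _. rewrite Z, Cmod_0. lra.
Qed.

(** * Zero-free functions *)

Definition ray_primitive (L : C -> C) (a z : C) : C :=
  CRInt (fun t => (z - a) * L (a + t * (z - a))) 0 1.

Lemma Cmod_ray (a z : C) (t : R) : 0 <= t <= 1 ->
  Cmod (a + t * (z - a) - a) <= Cmod (z - a).
Proof.
  intros Ht. replace (a + t * (z - a) - a) with (t * (z - a)) by ring.
  rewrite Cmod_mult, Cmod_RtoC by lra. pose proof (Cmod_ge_0 (z - a)). nra.
Qed.

Lemma rcont_ray (L : C -> C) (a z : C) (rho t : R) : holo_disc L a rho ->
  Cmod (z - a) < rho -> 0 <= t <= 1 -> rcont (fun t => (z - a) * L (a + t * (z - a))) t.
Proof.
  intros HL Hz Ht. apply rcont_scal. apply (rcont_line L a (z - a) t).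
  destruct (HL (a + t * (z - a))) as [l Hl]. eapply Rle_lt_trans. apply Cmod_ray; auto. auto.
  eapply cderiv_ccont; eauto.
Qed.

(** To first order in k the integrand changes by k times the t-derivative of t L (a + t (z - a)),
    whose integral over [0, 1] is L z. [F] and [F'] are this function and its derivative; [taylor1]
    controls the error uniformly in t. *)
Lemma ray_primitive_deriv (L : C -> C) (a z : C) (rho : R) : holo_disc L a rho ->
  Cmod (z - a) < rho -> cderiv (ray_primitive L a) z (L z).
Proof.
  intros HL Hz. set (w := z - a) in *. pose proof (Cmod_ge_0 w) as Pw.
  (* Discs of radius 2 s round the points of the ray stay in the closed disc of radius r2 < rho,
     where L is bounded. *)
  set (s := ((rho - Cmod w) / 3)%R). assert (Hs : 0 < s) by (unfold s; lra).
  set (r2 := (Cmod w + 2 * s)%R).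
  destruct (holo_bounded_closed_disc L a r2 rho) as [M [HM0 HM]]; auto. unfold r2, s; lra.
  set (C1 := (8 * M / (s * s))%R). assert (HC1 : 0 <= C1) by (apply Rle_mult_inv_pos; nra).
  set (K := (Cmod w * C1 + M / s)%R).
  assert (HMs : 0 <= M / s) by (apply Rle_mult_inv_pos; lra).
  assert (HK : 0 <= K) by (unfold K; nra).
  intros eps He. exists (Rmin (s / 4) (eps / (K + 1))). split.
  apply Rmin_pos; [lra|apply Rdiv_lt_0_compat; lra]. intros k Hk.
  destruct (proj1 (Rmin_Rgt _ _ _) Hk) as [k1 k2].
  pose proof (Cmod_ge_0 k) as Pk.
  assert (Hzk : Cmod (z + k - a) < rho).
  { replace (z + k - a) with (w + k) by (unfold w; ring).
    eapply Rle_lt_trans. apply Cmod_triangle. unfold s in k1. lra. }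
  set (F := fun u : C => u * L (a + u * w)).
  set (F' := fun u : C => 1 * L (a + u * w) + u * (cder L (a + u * w) * (0 + (1 * w + u * 0)))).
  assert (Hray : forall t, 0 <= t <= 1 -> Cmod (a + t * w - a) <= Cmod w).
  { intros t Ht. apply Cmod_ray; auto. }
  assert (Hlin : forall u, cderiv (fun u : C => a + u * w) u (0 + (1 * w + u * 0))).
  { intros u. apply cderiv_plus. apply cderiv_const. apply cderiv_mult. apply cderiv_id. apply cderiv_const. }
  assert (HF : forall t, 0 <= t <= 1 -> cderiv F (0 + t * 1) (F' (0 + t * 1))).
  { intros t Ht. replace (0 + t * 1) with (RtoC t) by ring. unfold F, F'.
    apply (cderiv_mult (fun u => u) (fun u => L (a + u * w))). apply cderiv_id.
    apply (cderiv_comp L (fun u => a + u * w)); auto. apply (holo_cder L a _ rho); auto.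
    eapply Rle_lt_trans. apply Hray; auto. auto. }
  assert (HF' : forall t, 0 <= t <= 1 -> rcont (fun t => F' (0 + t * 1)) t).
  { intros t Ht. apply rcont_line. replace (0 + t * 1) with (RtoC t) by ring.
    assert (Hd : Cmod (a + t * w - a) < rho) by (eapply Rle_lt_trans; [apply Hray|]; auto).
    destruct (holo_cder_holo L a rho HL _ Hd) as [l2 Hl2].
    eapply cderiv_ccont. apply cderiv_plus.
    - apply (cderiv_scal 1 (fun u => L (a + u * w))).
      apply (cderiv_comp L (fun u => a + u * w)); auto. apply (holo_cder L a _ rho); auto.
    - apply (cderiv_mult (fun u => u)). apply cderiv_id.
      apply cderiv_mult. apply (cderiv_comp (cder L) (fun u => a + u * w)); eauto.
      apply cderiv_plus. apply cderiv_const. apply cderiv_plus. apply cderiv_const.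
      apply cderiv_mult. apply cderiv_id. apply cderiv_const. }
  assert (I1 : CRInt (fun t => k * F' (0 + t * 1)) 0 1 = k * L z).
  { rewrite CRInt_scal by (auto; lra). f_equal. rewrite (CRInt_FTC (fun t => F (0 + t * 1))).
    - unfold F. replace (a + (0 + 1%R * 1) * w) with z by (unfold w; ring). ring.
    - lra.
    - intros t Ht. replace (F' (0 + t * 1)) with (F' (0 + t * 1) * 1) by ring. apply rderiv_line; auto.
    - auto. }
  unfold ray_primitive. rewrite (Cmult_comm (L z)), <- I1.
  assert (R1 : forall t, 0 <= t <= 1 -> rcont (fun t => (z + k - a) * L (a + t * (z + k - a))) t).
  { intros t Ht. apply rcont_ray with rho; auto. }
  assert (R2 : forall t, 0 <= t <= 1 -> rcont (fun t => (z - a) * L (a + t * (z - a))) t).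
  { intros t Ht. apply rcont_ray with rho; auto. }
  rewrite <- (CRInt_minus (fun t => (z + k - a) * L (a + t * (z + k - a)))
     (fun t => (z - a) * L (a + t * (z - a)))) by (auto; lra).
  rewrite <- (CRInt_minus (fun t => (z + k - a) * L (a + t * (z + k - a)) - (z - a) * L (a + t * (z - a)))
     (fun t => k * F' (0 + t * 1))).
  2: lra. 2: { intros. apply rcont_minus; auto. } 2: { intros. apply rcont_scal; auto. }
  eapply Rle_trans. apply CRInt_bound with (M := (K * Cmod k * Cmod k)%R). lra.
  { intros t Ht. apply rcont_minus. apply rcont_minus; auto. apply rcont_scal; auto. }
  2:{ rewrite Rminus_0_r, Rmult_1_l. apply Rmult_le_compat_r; auto.
      apply Rle_trans with ((K + 1) * (eps / (K + 1)))%R. nra. right. field. lra. }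
  intros t Ht. set (b := a + t * w). fold w.
  replace (z + k - a) with (w + k) by (unfold w; ring).
  replace (a + t * (w + k)) with (b + t * k) by (unfold b; ring).
  unfold F'. replace (0 + t * 1) with (RtoC t) by ring. fold b.
  replace ((w + k) * L (b + t * k) - w * L b - k * (1 * L b + t * (cder L b * (0 + (1 * w + t * 0)))))
    with (w * (L (b + t * k) - L b - cder L b * (t * k)) + k * (L (b + t * k) - L b)) by ring.
  assert (Hb : Cmod (b - a) <= Cmod w) by (apply Hray; auto).
  assert (Htk : Cmod (t * k) <= Cmod k) by (rewrite Cmod_mult, Cmod_RtoC by lra; nra).
  assert (Hbd : forall u, Cmod (u - b) < 2 * s -> Cmod (u - a) <= r2).
  { intros u Hu. pose proof (Cmod_dist u b a). unfold r2. lra. }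
  assert (HLb : holo_disc L b (2 * s)).
  { apply holo_sub with a rho; auto. unfold s in *. lra. }
  assert (T1 : Cmod (L (b + t * k) - L b - cder L b * (t * k)) <= C1 * Cmod k * Cmod k).
  { eapply Rle_trans. apply taylor1 with (rho := s) (M := M); auto.
    - apply holo_sub with b (2 * s)%R; auto. rewrite Cmod_diag. lra.
    - intros u Hu. apply HM, Hbd. lra.
    - lra.
    - fold C1. pose proof (Cmod_ge_0 (t * k)). rewrite !Rmult_assoc. apply Rmult_le_compat_l; auto. nra. }
  assert (T2 : Cmod (L (b + t * k) - L b) <= M / s * Cmod k).
  { apply Rle_trans with (M / s * Cmod (t * k))%R; [|apply Rmult_le_compat_l; auto].
    apply mean_value_ineq with (F' := cder L).
    - intros u Hu. apply (holo_cder L b _ (2 * s)); auto. pose proof (Cmod_seg b b (t * k) u Hu).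
      rewrite Cmod_diag in H. lra.
    - intros u Hu. apply cder_bound with b (2 * s)%R; auto.
      pose proof (Cmod_seg b b (t * k) u Hu).
      rewrite Cmod_diag in H. lra. }
  eapply Rle_trans. apply Cmod_triangle. rewrite !(Cmod_mult w), !(Cmod_mult k).
  unfold K. assert (Cmod w * Cmod (L (b + t * k) - L b - cder L b * (t * k)) <= Cmod w * (C1 * Cmod k * Cmod k)) by
   (apply Rmult_le_compat_l; auto).
  assert (Cmod k * Cmod (L (b + t * k) - L b) <= Cmod k * (M / s * Cmod k)) by (apply Rmult_le_compat_l; auto).
  lra.
Qed.

Lemma ray_primitive_center (L : C -> C) (a : C) : ray_primitive L a a = 0.
Proof.
  assert (Z : forall t, rcont (fun _ : R => RtoC 0) t).
  { intros t eps He. exists 1%R. split. lra. intros. rewrite Cmod_diag. auto. }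
  unfold ray_primitive. rewrite (CRInt_ext _ (fun _ => 0 * 0)); [|lra|].
  - rewrite CRInt_scal. ring. lra. auto.
  - intros. ring.
Qed.

(** As F exp (- h) has derivative 0, h is a logarithm of F / F a. The condition |F| > 1 says that h
    takes values in the half-plane Re > - ln |F a|. A Moebius map takes that half-plane to the unit
    disc, where Cauchy's estimate bounds the derivative at a. *)
Theorem zero_free_log_derivative (F : C -> C) (a : C) (rho : R) : 0 < rho ->
  holo_disc F a rho -> (forall z, Cmod (z - a) < rho -> 1 < Cmod (F z)) ->
  Cmod (cder F a) * rho <= 2 * Cmod (F a) * ln (Cmod (F a)).
Proof.
  intros Hr HF H1.
  assert (Ha : Cmod (a - a) < rho) by (rewrite Cmod_diag; auto).
  assert (NZ : forall z, Cmod (z - a) < rho -> F z <> 0).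
  { intros z Hz E. specialize (H1 z Hz). rewrite E, Cmod_0 in H1. lra. }
  set (L := fun z => cder F z / F z).
  assert (HL : holo_disc L a rho).
  { apply holo_div; auto. now apply holo_cder_holo. }
  set (h := ray_primitive L a).
  assert (Hh : forall z, Cmod (z - a) < rho -> cderiv h z (L z)).
  { intros z Hz. now apply ray_primitive_deriv with rho. }
  assert (ha : h a = 0) by apply ray_primitive_center.
  set (c := ln (Cmod (F a))).
  pose proof (H1 a Ha) as H1a.
  assert (Hc : 0 < c) by (unfold c; rewrite <- ln_1; apply ln_increasing; lra).
  assert (CONST : forall z, Cmod (z - a) < rho -> F z = F a * Cexp (h z)).
  { intros z Hz. set (G := fun u => F u * Cexp (- h u)).
    assert (EG : G z = G a).
    { apply Cminus_eq_0, Cmod_eq_0. apply Rle_antisym; [|apply Cmod_ge_0].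
      pose proof (mean_value_ineq G (fun _ => 0) a (z - a) 0) as B.
      replace (a + (z - a)) with z in B by ring. rewrite Rmult_0_l in B. apply B.
      - intros t Ht. assert (Hu : Cmod (a + t * (z - a) - a) < rho).
        { eapply Rle_lt_trans. apply Cmod_ray; auto. auto. }
        set (u := a + t * (z - a)) in *.
        apply cderiv_eq with (cder F u * Cexp (- h u) + F u * (Cexp (- h u) * - L u)).
        + unfold L. field. auto.
        + apply (cderiv_mult F (fun u => Cexp (- h u)) u). now apply (holo_cder F a _ rho).
          apply (cderiv_comp Cexp (fun u => - h u)). apply cderiv_Cexp. apply cderiv_opp; auto.
      - intros. rewrite Cmod_0. lra. }
    unfold G in EG. rewrite ha in EG. replace (- 0) with (RtoC 0) in EG by ring.
    rewrite Cexp_0, Cexp_opp in EG. pose proof (Cexp_neq_0 (h z)).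
    rewrite Cmult_1_r in EG. rewrite <- EG. field. auto. }
  assert (RE : forall z, Cmod (z - a) < rho -> - c < Re (h z)).
  { intros z Hz. specialize (H1 z Hz). rewrite (CONST z Hz), Cmod_mult, Cmod_Cexp in H1.
    rewrite <- (exp_ln (Cmod (F a))) in H1 by lra. fold c in H1.
    rewrite <- exp_plus in H1. rewrite <- exp_0 in H1. apply exp_lt_inv in H1. lra. }
  (* The map h / (h + 2 c) fixes 0 and sends Re h > - c into the unit disc, because - 2 c is the
     reflection of 0 in the line Re = - c. *)
  set (d := RtoC (2 * c)).
  assert (Dn : forall z, Cmod (z - a) < rho -> h z + d <> 0).
  { intros z Hz E. specialize (RE z Hz). apply (f_equal Re) in E. rewrite Re_plus in E.
    change (Re d) with (2 * c)%R in E. change (Re 0) with 0%R in E. lra. }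
  set (u := fun z => h z / (h z + d)).
  assert (Hu : forall z, Cmod (z - a) < rho ->
     cderiv u z ((L z * (h z + d) - h z * (L z + 0)) / ((h z + d) * (h z + d)))).
  { intros z Hz. apply (cderiv_div h (fun z => h z + d)); auto.
    apply cderiv_plus; auto. apply cderiv_const. }
  assert (E : Cmod (cder u a) * rho <= 1).
  { apply cauchy_estimate; auto.
    - intros z Hz. eexists. apply Hu; auto.
    - intros z Hz. unfold u. rewrite Cmod_div by auto.
      pose proof (Cmod_pos _ (Dn z Hz)) as P. apply Rmult_le_reg_r with (Cmod (h z + d)); auto.
      unfold Rdiv. rewrite Rmult_assoc, Rinv_l, Rmult_1_r, Rmult_1_l by lra.
      apply Rsqr_incr_0; try apply Cmod_ge_0. unfold Rsqr.
      rewrite !Cmod_sqr, Re_plus, Im_plus. specialize (RE z Hz).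
      replace (Re d) with (2 * c)%R by reflexivity. replace (Im d) with 0%R by reflexivity. nra. }
  rewrite (cder_unique u a _ (Hu a Ha)), ha in E.
  assert (Hd0 : d <> 0) by (intros E0; apply RtoC_inj in E0; lra).
  replace ((L a * (0 + d) - 0 * (L a + 0)) / ((0 + d) * (0 + d))) with (cder F a / (F a * d)) in E.
  2:{ unfold L. field. split; auto. }
  rewrite Cmod_div, Cmod_mult in E by (apply Cmult_neq_0; auto).
  unfold d in E. rewrite Cmod_RtoC in E by lra.
  assert (P : 0 < Cmod (F a) * (2 * c)) by nra.
  apply Rmult_le_compat_r with (r := (Cmod (F a) * (2 * c))%R) in E; [|lra].
  replace (Cmod (cder F a) / (Cmod (F a) * (2 * c)) * rho * (Cmod (F a) * (2 * c)))%R
    with (Cmod (cder F a) * rho)%R in E by (field; lra). lra.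
Qed.

(** * Growth of functions with controlled derivative *)

(* The derivative of loglog is at most 2 / gauge, so that |F'| <= k gauge |F| makes
   loglog |F| Lipschitz; gauge grows fast enough to exclude rescaling limits at infinity. *)
Definition gauge (x : R) : R := (sqrt (1 + x * x) * (1 + ln (1 + x * x)))%R.
Definition loglog (x : R) : R := ln (1 + ln (1 + x * x)).

Lemma ln_nonneg (y : R) : 1 <= y -> 0 <= ln y.
Proof.
  intros [H|<-]. left. rewrite <- ln_1. apply ln_increasing; lra. rewrite ln_1. lra.
Qed.

Lemma ln_le (x y : R) : 0 < x -> x <= y -> ln x <= ln y.
Proof. intros Hx [H|<-]. left. apply ln_increasing; auto. lra. Qed.

Lemma gauge_ge_1 (x : R) : 1 <= gauge x.
Proof.
  unfold gauge. assert (1 <= 1 + x * x) by nra. pose proof (ln_nonneg _ H).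
  assert (1 <= sqrt (1 + x * x)). { rewrite <- sqrt_1 at 1. apply sqrt_le_1_alt. auto. }
  nra.
Qed.

Lemma loglog_mono (x y : R) : 0 <= x -> x <= y -> loglog x <= loglog y.
Proof.
  intros Hx Hy. assert (1 <= 1 + x * x) by nra. pose proof (ln_nonneg _ H).
  apply ln_le. lra. apply Rplus_le_compat_l. apply ln_le; nra.
Qed.

Lemma le_of_loglog_le (x B : R) : loglog x <= B -> x <= exp (exp B).
Proof.
  unfold loglog. intros H. assert (H1 : 1 <= 1 + x * x) by nra. pose proof (ln_nonneg _ H1).
  assert (1 + ln (1 + x * x) <= exp B).
  { rewrite <- (exp_ln (1 + ln (1 + x * x))) by lra. destruct H as [L|E].
    left. now apply exp_increasing. rewrite E. lra. }
  assert (1 + x * x <= exp (exp B)).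
  { rewrite <- (exp_ln (1 + x * x)) by lra. left. apply exp_increasing. lra. }
  nra.
Qed.

Lemma Im_as_Re (z : C) : Im z = Re (- Ci * z)%C.
Proof. destruct z. simpl. ring. Qed.

(** The quantity bounded is the derivative of loglog |F| along a curve F = a + i b with velocity a'
    + i b'. By Cauchy-Schwarz |a a' + b b'| <= |F| L, and the two factors of [gauge] cancel the two
    denominators. *)
Lemma loglog_derivative_bound (a b a' b' L k : R) :
  a' * a' + b' * b' <= L * L -> 0 <= L -> L <= k * gauge (sqrt (a * a + b * b)) ->
  Rabs ((2 * (a * a' + b * b')) / (1 + (a * a + b * b)) / (1 + ln (1 + (a * a + b * b)))) <= 2 * k.
Proof.
  intros H1 H2 H3. set (q := (a * a + b * b)%R) in *. assert (Hq : 0 <= q) by (unfold q; nra).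
  unfold gauge in H3. rewrite sqrt_sqrt in H3 by auto.
  assert (Hy : 1 <= 1 + q) by lra. pose proof (ln_nonneg _ Hy) as Hl.
  set (y := (1 + q)%R) in *. set (m := (1 + ln y)%R) in *. assert (Hm : 1 <= m) by (unfold m; lra).
  pose proof (sqrt_sqrt y ltac:(lra)) as Hs. pose proof (sqrt_pos y) as Hs0. set (s := sqrt y) in *.
  unfold Rdiv. rewrite !Rabs_mult. rewrite (Rabs_pos_eq (/ y)), (Rabs_pos_eq (/ m)), (Rabs_pos_eq 2);
    try lra; try (left; apply Rinv_0_lt_compat; lra).
  apply Rmult_le_reg_r with m. lra. rewrite Rmult_assoc, Rinv_l, Rmult_1_r by lra.
  apply Rmult_le_reg_r with y. lra. rewrite Rmult_assoc, Rinv_l, Rmult_1_r by lra.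
  assert (A : Rabs (a * a' + b * b') <= s * L).
  { apply Rsqr_incr_0; [|apply Rabs_pos|apply Rmult_le_pos; auto].
    unfold Rsqr. rewrite <- Rabs_mult, Rabs_pos_eq by exact (Rle_0_sqr (a * a' + b * b')).
    replace (s * L * (s * L))%R with (y * (L * L))%R by (rewrite <- Hs; ring).
    assert ((a * a' + b * b') * (a * a' + b * b') <= q * (a' * a' + b' * b'))%R.
    { unfold q. pose proof (Rle_0_sqr (a * b' - b * a')). unfold Rsqr in H. nra. }
    assert (q * (a' * a' + b' * b') <= q * (L * L))%R by (apply Rmult_le_compat_l; auto).
    unfold y. nra. }
  assert (s * L <= s * (k * (s * m)))%R by (apply Rmult_le_compat_l; auto).
  replace (s * (k * (s * m)))%R with (k * m * y)%R in H by (rewrite <- Hs; ring). lra.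
Qed.

Lemma is_derive_loglog (a b : R -> R) (t a' b' : R) :
  is_derive a t a' -> is_derive b t b' ->
  is_derive (fun s => ln (1 + ln (1 + (a s * a s + b s * b s)))) t
    ((2 * (a t * a' + b t * b')) / (1 + (a t * a t + b t * b t)) / (1 + ln (1 + (a t * a t + b t * b t))))%R.
Proof.
  intros Da Db.
  assert (Hy : 1 <= 1 + (a t * a t + b t * b t)) by nra. pose proof (ln_nonneg _ Hy).
  auto_derive.
  - repeat split; try lra; try (eexists; eauto).
  - change (Derive (fun x : R => a x) t) with (Derive a t). change (Derive (fun x : R => b x) t) with (Derive b t).
    rewrite (is_derive_unique a t _ Da), (is_derive_unique b t _ Db).
    field. split; lra.
Qed.

Lemma loglog_growth (F F' : C -> C) (z h : C) (k : R) :
  (forall t, 0 <= t <= 1 -> cderiv F (z + t * h) (F' (z + t * h))) ->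
  (forall t, 0 <= t <= 1 -> Cmod (F' (z + t * h)) <= k * gauge (Cmod (F (z + t * h)))) ->
  Rabs (loglog (Cmod (F (z + h))) - loglog (Cmod (F z))) <= 2 * k * Cmod h.
Proof.
  intros HF HM.
  set (a := fun s : R => Re (1 * F (z + s * h))).
  set (b := fun s : R => Re (- Ci * F (z + s * h))).
  set (a' := fun s : R => Re (1 * F' (z + s * h) * h)).
  set (b' := fun s : R => Re (- Ci * F' (z + s * h) * h)).
  assert (Q : forall s, (a s * a s + b s * b s)%R = (Cmod (F (z + s * h)%C) * Cmod (F (z + s * h)%C))%R).
  { intros s. rewrite Cmod_sqr, Im_as_Re. unfold a, b. rewrite Cmult_1_l. reflexivity. }
  set (E := fun s => ln (1 + ln (1 + (a s * a s + b s * b s)))).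
  assert (EE : forall s, E s = loglog (Cmod (F (z + s * h)))).
  { intros s. unfold E, loglog. now rewrite Q. }
  set (E' := fun s => ((2 * (a s * a' s + b s * b' s)) / (1 + (a s * a s + b s * b s)) / (1 + ln (1 + (a s * a s + b s * b s))))%R).
  assert (DE : forall t, 0 <= t <= 1 -> is_derive E t (E' t)).
  { intros t Ht.
    assert (Da : is_derive a t (a' t)) by (apply is_derive_line, HF; auto).
    assert (Db : is_derive b t (b' t)) by (apply is_derive_line, HF; auto).
    apply is_derive_loglog; auto. }
  destruct (MVT_gen E 0 1 E') as [t [Ht Et]].
  - intros x. rewrite Rmin_left, Rmax_right by lra. intros Hx. apply DE. lra.
  - intros x. rewrite Rmin_left, Rmax_right by lra. intros Hx. apply continuity_pt_filterlim.
    apply (@ex_derive_continuous R_AbsRing R_NormedModule). eexists. apply DE. lra.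
  - rewrite Rmin_left, Rmax_right in Ht by lra. rewrite !EE in Et.
    replace (z + 1%R * h) with (z + h) in Et by ring. replace (z + 0%R * h) with z in Et by ring.
    rewrite Et, Rminus_0_r, Rmult_1_r. unfold E'.
    replace (2 * k * Cmod h)%R with (2 * (k * Cmod h))%R by ring.
    set (l := F' (z + t * h)). pose proof (Cmod_ge_0 h).
    apply loglog_derivative_bound with (Cmod (l * h)).
    + unfold a', b'. fold l. replace (1 * l * h) with (l * h) by ring.
      replace (- Ci * l * h) with (- Ci * (l * h)) by ring. rewrite <- Im_as_Re, Cmod_sqr. lra.
    + apply Cmod_ge_0.
    + rewrite Q, sqrt_square by apply Cmod_ge_0. rewrite Cmod_mult.
      replace (k * Cmod h * gauge (Cmod (F (z + t * h)%C)))%R with (k * gauge (Cmod (F (z + t * h)%C)) * Cmod h)%R by ring.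
      apply Rmult_le_compat_r; auto. apply HM; auto.
Qed.

(** The extra term x is what beats the bound 2 x ln x of [zero_free_log_derivative]; it stems from
    the 1 added to the logarithm in [gauge]. *)
Lemma gauge_ge_xlnx (x : R) : 1 <= x -> x * (1 + 2 * ln x) <= gauge x.
Proof.
  intros Hx. unfold gauge. pose proof (ln_nonneg x Hx).
  assert (x <= sqrt (1 + x * x)).
  { rewrite <- (sqrt_square x) at 1 by lra. apply sqrt_le_1_alt. lra. }
  assert (2 * ln x <= ln (1 + x * x)).
  { replace (2 * ln x)%R with (ln x + ln x)%R by ring. rewrite <- ln_mult by lra. apply ln_le; nra. }
  nra.
Qed.

(* If |F| > 1 on the unit disc, the zero-free estimate contradicts |F'(0)| = gauge |F(0)|:
   so |F| <= 1 somewhere in the unit disc, and growth propagates this bound. *)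
Lemma normalized_locally_bounded (F : C -> C) (rho : R) : 1 <= rho ->
  holo_disc F 0 rho ->
  (forall z, Cmod z < rho -> Cmod (cder F z) <= 2 * gauge (Cmod (F z))) ->
  Cmod (cder F 0) = gauge (Cmod (F 0)) ->
  forall z, Cmod z < rho -> loglog (Cmod (F z)) <= loglog 1 + 4 * (Cmod z + 1).
Proof.
  intros Hr HF HG HN.
  assert (S0 : forall u : C, u - 0 = u) by (intros; ring).
  assert (W : exists w, Cmod w < 1 /\ Cmod (F w) <= 1).
  { apply NNPP. intros N.
    assert (H1 : forall z, Cmod (z - 0) < 1 -> 1 < Cmod (F z)).
    { intros z Hz. rewrite S0 in Hz. apply Rnot_le_lt. intros L. apply N. now exists z. }
    assert (Z := zero_free_log_derivative F 0 1 Rlt_0_1 (holo_sub F 0 0 rho 1 HF ltac:(rewrite Cmod_diag; lra)) H1).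
    specialize (H1 0 ltac:(rewrite S0, Cmod_0; lra)).
    pose proof (gauge_ge_xlnx (Cmod (F 0)) ltac:(lra)). rewrite HN in Z.
    pose proof (ln_nonneg (Cmod (F 0)) ltac:(lra)). nra. }
  destruct W as [w [W1 W2]]. intros z Hz.
  assert (G : Rabs (loglog (Cmod (F (w + (z - w)))) - loglog (Cmod (F w))) <= 2 * 2 * Cmod (z - w)).
  { apply loglog_growth with (F' := cder F).
    - intros t Ht. apply (holo_cder F 0 _ rho); auto. apply Cmod_convex; rewrite ?S0; auto; lra.
    - intros t Ht. apply HG. rewrite <- (S0 (w + t * (z - w))). apply Cmod_convex; rewrite ?S0; auto; lra. }
  replace (w + (z - w)) with z in G by ring. apply Rabs_le_between in G.
  pose proof (loglog_mono _ _ (Cmod_ge_0 (F w)) W2). pose proof (Cmod_triangle_minus z w). lra.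
Qed.

Lemma rccont_gauge (f : C -> C) (z : C) : ccont f z -> rccont (fun w => gauge (Cmod (f w))) z.
Proof.
  intros H. apply (rccont_comp gauge). 2: now apply rccont_Cmod.
  apply continuity_pt_filterlim. apply (@ex_derive_continuous R_AbsRing R_NormedModule).
  unfold gauge. set (x := Cmod (f z)). assert (0 < 1 + x * x) by nra. auto_derive. auto.
Qed.

(** * Simple points of entire functions *)

(* Glaeser-type inequality: a large derivative next to the value a forces a simple a-point. *)
Lemma derivative_at_ramified_value (F : C -> C) (w a : C) (B : R) : 1 <= B ->
  holo_disc F w 1 -> (forall z, Cmod (z - w) < 1 -> Cmod (F z) <= B) ->
  (forall u, Cmod (u - w) < 1 -> F u = a -> cder F u = 0) ->
  Cmod (cder F w) * Cmod (cder F w) <= 128 * B * Cmod (F w - a).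
Proof.
  intros HB HF HM HR. apply Rnot_lt_le. intros L.
  set (A := cder F w) in *. pose proof (Cmod_ge_0 (F w - a)) as P0.
  assert (HA : A <> 0) by (intros E; rewrite E, Cmod_0 in L; nra).
  pose proof (Cmod_pos _ HA) as PA.
  assert (HAB : Cmod A <= B).
  { pose proof (cauchy_estimate F w 1 B Rlt_0_1 HF HM). fold A in H. lra. }
  (* With Lipschitz constant 8 B, F' stays within |A| / 2 of A over radius s. The section of
     [local_section] then lives over the disc of radius |A| s / 8 = |A|^2 / (128 B) round F w, which
     contains a. *)
  set (s := (Cmod A / (16 * B))%R).
  assert (Hs : 0 < s) by (apply Rdiv_lt_0_compat; lra).
  assert (Hs1 : (s * (16 * B))%R = Cmod A) by (unfold s; field; lra).
  assert (Hs2 : s <= 1 / 16) by nra.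
  assert (DER : forall u, Cmod (u - w) < s -> Cmod (cder F u - A) <= Cmod A / 2).
  { intros u Hu. replace u with (w + (u - w)) by ring.
    eapply Rle_trans. apply cder_lipschitz with (rho := 1%R) (M := B); auto; lra.
    rewrite Rmult_1_r, Rdiv_1_r. nra. }
  destruct (local_section F w A s) as [sg Hsg]; auto.
  { apply holo_sub with w 1%R; auto. rewrite Cmod_diag. lra. }
  destruct (Hsg a) as [S1 [S2 _]].
  { rewrite Cmod_minus_sym. nra. }
  pose proof (HR (sg a) ltac:(lra) S2) as Z. pose proof (DER (sg a) S1) as D.
  rewrite Z in D. replace (0 - A) with (- A) in D by ring. rewrite Cmod_opp in D. lra.
Qed.

(** * Lower bounds for polynomials with distinct roots *)

Definition root_poly (l : list C) (z : C) : C := fold_right (fun a p => (z - a) * p) 1 l.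

Lemma root_poly_0 (l : list C) (z : C) : root_poly l z = 0 -> In z l.
Proof.
  induction l; simpl; intros H.
  - apply RtoC_inj in H. lra.
  - destruct (classic (z = a)) as [->|N]; auto. right. apply IHl.
    replace (root_poly l z) with ((z - a) * root_poly l z * / (z - a)).
    rewrite H. ring. field. now apply Cminus_neq_0.
Qed.

Lemma root_poly_deriv (l : list C) (z : C) : exists m, cderiv (root_poly l) z m.
Proof.
  induction l as [|a l [m Hm]].
  - exists 0. exact (cderiv_const 1 z).
  - eexists. refine (cderiv_mult (fun z => z - a) (root_poly l) z _ _ _ Hm).
    apply cderiv_minus. apply cderiv_id. apply cderiv_const.
Qed.

Lemma linear_lower_bound (b : C) (sg : R) : 0 < sg -> exists c, 0 < c /\
  forall z, sg <= Cmod (z - b) -> c * (1 + Cmod z) <= Cmod (z - b).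
Proof.
  intros Hs. pose proof (Cmod_ge_0 b) as Pb.
  (* Combine |z - b| >= |z| - |b| with weight sg and |z - b| >= sg with weight 1 + |b|. *)
  exists (sg / (sg + 1 + Cmod b))%R. split. apply Rdiv_lt_0_compat; lra.
  intros z Hz. pose proof (Cmod_reverse z b).
  set (D := (sg + 1 + Cmod b)%R). assert (HD : 0 < D) by (unfold D; lra).
  apply Rmult_le_reg_r with D; auto.
  replace (sg / D * (1 + Cmod z) * D)%R with (sg * (1 + Cmod z))%R by (field; lra).
  unfold D. nra.
Qed.

Lemma root_poly_far (l : list C) (sg : R) : 0 < sg -> exists c, 0 < c /\
  forall z, (forall b, In b l -> sg <= Cmod (z - b)) ->
   c * (1 + Cmod z) ^ (length l) <= Cmod (root_poly l z).
Proof.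
  intros Hs. induction l as [|b l [c [Hc IH]]].
  - exists 1%R. split. lra. intros z _. simpl. rewrite Cmod_1. lra.
  - destruct (linear_lower_bound b sg Hs) as [c' [Hc' H']].
    exists (c' * c)%R. split. nra. intros z Hz. simpl. rewrite Cmod_mult.
    specialize (H' z (Hz b (or_introl eq_refl))). specialize (IH z (fun b' Hb => Hz b' (or_intror Hb))).
    pose proof (Cmod_ge_0 z).
    assert (0 <= (1 + Cmod z) ^ length l)%R by (apply pow_le; lra).
    replace (c' * c * ((1 + Cmod z) * (1 + Cmod z) ^ length l))%R
      with ((c' * (1 + Cmod z)) * (c * (1 + Cmod z) ^ length l))%R by ring.
    apply Rmult_le_compat; auto. nra. nra.
Qed.

Lemma positive_distance (v : C) (l : list C) : (forall a, In a l -> a <> v) ->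
  exists d, 0 < d /\ forall a, In a l -> d <= Cmod (a - v).
Proof.
  induction l as [|a l IH]; intros H.
  - exists 1%R. split. lra. intros a [].
  - destruct IH as [d [Hd HD]]. { intros b Hb. apply H. now right. }
    assert (P : 0 < Cmod (a - v)) by (apply Cmod_pos, Cminus_neq_0, H; now left).
    exists (Rmin d (Cmod (a - v))). split. apply Rmin_pos; auto.
    intros b [<-|Hb]. apply Rmin_r. eapply Rle_trans. apply Rmin_l. auto.
Qed.

(** A point is within half of the separation of at most one root; the other factors are at least
    multiples of 1 + |z|. The factor |z - a| that is kept serves twice: it is compared with |F'|^2
    close to a, and gives decay of the quotient far from all roots. *)
Lemma root_poly_lower_bound (l : list C) : NoDup l -> l <> nil -> exists c, 0 < c /\
  forall z, exists a, In a l /\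
   c * Cmod (z - a) * (1 + Cmod z) ^ (length l - 1) <= Cmod (root_poly l z).
Proof.
  induction l as [|a l IH]; intros ND NE. congruence.
  inversion ND as [|? ? Na NDl]; subst.
  destruct (positive_distance a l) as [sep [Hsep0 Hsep]]. { intros b Hb ->. auto. }
  set (sg := (sep / 2)%R). assert (Hs : 0 < sg) by (unfold sg; lra).
  destruct (root_poly_far l sg Hs) as [c1 [Hc1 F1]].
  assert (NEAR : forall z, Cmod (z - a) < sg ->
     c1 * Cmod (z - a) * (1 + Cmod z) ^ (length l) <= Cmod (root_poly (a :: l) z)).
  { intros z Hz. simpl. rewrite Cmod_mult.
    assert (c1 * (1 + Cmod z) ^ length l <= Cmod (root_poly l z)).
    { apply F1. intros b Hb. specialize (Hsep b Hb).
      pose proof (Cmod_dist b z a). rewrite (Cmod_minus_sym b z) in H. unfold sg in *. lra. }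
    pose proof (Cmod_ge_0 (z - a)). nra. }
  replace (length (a :: l) - 1)%nat with (length l) by (simpl; lia).
  destruct l as [|b l'].
  - exists 1%R. split. lra. intros z. exists a. split. now left. simpl. rewrite Cmult_1_r. lra.
  - destruct IH as [c2 [Hc2 F2]]; auto. congruence. set (l := b :: l') in *.
    destruct (linear_lower_bound a sg Hs) as [c3 [Hc3 F3]].
    exists (Rmin c1 (c3 * c2)). split. apply Rmin_pos; nra. intros z.
    pose proof (Cmod_ge_0 z). assert (P : 0 <= (1 + Cmod z) ^ length l) by (apply pow_le; lra).
    destruct (Rlt_le_dec (Cmod (z - a)) sg) as [L|G].
    + exists a. split. now left. eapply Rle_trans; [|apply NEAR; auto].
      apply Rmult_le_compat_r; auto. apply Rmult_le_compat_r. apply Cmod_ge_0. apply Rmin_l.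
    + destruct (F2 z) as [d [Hd D]]. exists d. split. now right.
      change (root_poly (a :: l) z) with ((z - a) * root_poly l z). rewrite Cmod_mult.
      specialize (F3 z G). pose proof (Cmod_ge_0 (z - d)).
      apply Rle_trans with (c3 * c2 * Cmod (z - d) * (1 + Cmod z) ^ length l)%R.
      apply Rmult_le_compat_r; auto. apply Rmult_le_compat_r; auto. apply Rmin_r.
      assert (EL : ((1 + Cmod z) ^ length l = (1 + Cmod z) * (1 + Cmod z) ^ (length l - 1))%R).
      { rewrite tech_pow_Rmult. f_equal. unfold l. simpl. lia. }
      rewrite EL. assert (P' : 0 <= (1 + Cmod z) ^ (length l - 1)) by (apply pow_le; lra).
      set (p := ((1 + Cmod z) ^ (length l - 1))%R) in *.
      replace (c3 * c2 * Cmod (z - d) * ((1 + Cmod z) * p))%R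
        with ((c3 * (1 + Cmod z)) * (c2 * Cmod (z - d) * p))%R by ring.
      apply Rmult_le_compat; auto; apply Rmult_le_pos; try lra. apply Rmult_le_pos; lra.
Qed.

Lemma ccont_le_limit (h : C -> C) (z : C) (M d : R) : 0 < d -> ccont h z ->
  (forall w, w <> z -> Cmod (w - z) < d -> Cmod (h w) <= M) -> Cmod (h z) <= M.
Proof.
  intros Hd Hc H. apply le_epsilon. intros eps He. destruct (Hc eps He) as [e [He' H']].
  set (t := (Rmin d e / 2)%R). pose proof (Rmin_pos _ _ Hd He').
  pose proof (Rmin_l d e). pose proof (Rmin_r d e).
  assert (Ht : Cmod (z + t - z) = t).
  { replace (z + t - z) with (RtoC t) by ring. apply Cmod_RtoC. unfold t; lra. }
  assert (B : Cmod (h (z + t)) <= M).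
  { apply H. intros E. rewrite E, Cmod_diag in Ht. unfold t in Ht. lra. rewrite Ht. unfold t; lra. }
  specialize (H' (z + t)). rewrite Ht in H'. specialize (H' ltac:(unfold t; lra)).
  pose proof (Cmod_reverse (h z) (h (z + t))) as R3. rewrite (Cmod_minus_sym (h z)) in R3. lra.
Qed.

Lemma ccont_eq_limit (f h : C -> C) (z : C) (d : R) : 0 < d -> ccont f z -> ccont h z ->
  (forall w, w <> z -> Cmod (w - z) < d -> f w = h w) -> f z = h z.
Proof.
  intros Hd Hf Hh H. apply Cminus_eq_0, Cmod_eq_0. apply Rle_antisym; [|apply Cmod_ge_0].
  apply (ccont_le_limit (fun w => f w - h w) z 0 d Hd).
  - now apply ccont_minus.
  - intros w N L. rewrite (H w N L), Cmod_diag. lra.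
Qed.

(** Each z has its own local extension, and h z is the value at z of that one. Where f is
    differentiable, h agrees with it by continuity. At an exceptional point f may have a default
    value, such as a quotient by 0, so agreement is claimed only at points of differentiability. *)
Lemma removable_everywhere (f : C -> C) (M : R) :
  (forall z, exists d, 0 < d /\ forall w, w <> z -> Cmod (w - z) < d ->
     (exists l, cderiv f w l) /\ Cmod (f w) <= M) ->
  exists h, (forall z, exists l, cderiv h z l) /\ (forall z, Cmod (h z) <= M) /\
    forall z l, cderiv f z l -> h z = f z.
Proof.
  intros H.
  assert (EXT : forall z, exists hd : (C -> C) * R, 0 < snd hd /\ holo_disc (fst hd) z (snd hd) /\
     (forall w, w <> z -> fst hd w = f w) /\
     forall w, w <> z -> Cmod (w - z) < snd hd -> (exists l, cderiv f w l) /\ Cmod (f w) <= M).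
  { intros z. destruct (H z) as [d [Hd Hz]].
    destruct (riemann_removable f z d M Hd) as [h [Hh E]]; try (intros; apply Hz; auto).
    exists (h, d). simpl. auto. }
  apply choice in EXT. destruct EXT as [e He].
  set (h := fun z => fst (e z) z).
  assert (CC : forall z, ccont (fst (e z)) z).
  { intros z. destruct (He z) as [Hd [Hh _]]. destruct (Hh z) as [l Hl].
    rewrite Cmod_diag; auto. eapply cderiv_ccont; eauto. }
  assert (EQ : forall z l, cderiv f z l -> h z = f z).
  { intros z l Hl. destruct (He z) as [Hd [_ [E _]]].
    apply (ccont_eq_limit (fst (e z)) f z (snd (e z))); auto. eapply cderiv_ccont; eauto. }
  exists h. split; [|split]; auto.
  - intros z. destruct (He z) as [Hd [Hh [E B]]]. destruct (Hh z) as [l Hl].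
    rewrite Cmod_diag; auto.
    exists l. apply cderiv_ext_loc with (fst (e z)) (snd (e z)); auto.
    intros w Hw. destruct (classic (w = z)) as [->|N]; auto.
    destruct (B w N Hw) as [[m Hm] _]. rewrite (EQ w m Hm). auto.
  - intros z. destruct (He z) as [Hd [Hh [E B]]].
    apply (ccont_le_limit (fst (e z)) z M (snd (e z))); auto.
    intros w N L. rewrite E by auto. apply B; auto.
Qed.

(** Absorbing the logarithm in one more power makes the square of [gauge] of degree 4, one less than
    the number of values in [entire_simple_points]. *)
Lemma gauge_upper (x : R) : 0 <= x -> gauge x <= 2 * (1 + x) ^ 2.
Proof.
  intros Hx. unfold gauge.
  assert (S : sqrt (1 + x * x) <= 1 + x).
  { rewrite <- (sqrt_square (1 + x)) by lra. apply sqrt_le_1_alt. nra. }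
  assert (L : ln (1 + x * x) <= 2 * x).
  { apply Rle_trans with (ln ((1 + x) * (1 + x))). apply ln_le; nra.
    rewrite ln_mult by lra. assert (ln (1 + x) <= x); [|lra].
    rewrite <- (ln_exp x) at 2. apply ln_le. lra. pose proof (exp_ineq1_le x). lra. }
  pose proof (ln_nonneg (1 + x * x) ltac:(nra)). pose proof (sqrt_pos (1 + x * x)).
  apply Rle_trans with ((1 + x) * (1 + 2 * x))%R. apply Rmult_le_compat; lra. simpl. nra.
Qed.

Theorem entire_simple_points (F : C -> C) (l : list C) : NoDup l -> length l = 5%nat ->
  (forall z, exists m, cderiv F z m) ->
  (forall z, Cmod (cder F z) <= 2 * gauge (Cmod (F z))) ->
  cder F 0 <> 0 -> exists a w, In a l /\ F w = a /\ cder F w <> 0.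
Proof.
  intros ND LEN HF HG H0. apply NNPP. intros N.
  assert (RAM : forall a w, In a l -> F w = a -> cder F w = 0).
  { intros a w Ha Hw. apply NNPP. intros D. apply N. now exists a, w. }
  clear N. assert (HD : forall z, cderiv F z (cder F z)) by (intros; apply cder_correct; auto).
  assert (HH : forall a rho, holo_disc F a rho) by (intros a rho z _; auto).
  destruct (root_poly_lower_bound l ND) as [c [Hc LB]]. { intros ->. discriminate. }
  rewrite LEN in LB. change (5 - 1)%nat with 4%nat in LB.
  assert (AM : exists A, 0 <= A /\ forall a, In a l -> Cmod a <= A).
  { clear. induction l as [|a l [A [HA IH]]]. exists 0%R. split. lra. intros ? [].
    exists (A + Cmod a)%R. pose proof (Cmod_ge_0 a). split. lra. intros b [<-|I]. lra. specialize (IH b I). lra. }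
  destruct AM as [A [HA AM]].
  (* If |F w - a| < 1, then |F w| <= A + 1, and loglog |F| grows by at most 4 over the unit disc
     round w. *)
  set (Bd := exp (exp (loglog (A + 1) + 4))).
  assert (HBd : 1 <= Bd).
  { unfold Bd. rewrite <- exp_0. left. apply exp_increasing, exp_pos. }
  assert (GL : forall a w, In a l -> Cmod (F w - a) < 1 ->
     Cmod (cder F w) * Cmod (cder F w) <= 128 * Bd * Cmod (F w - a)).
  { intros a w Ha Hw. apply derivative_at_ramified_value; auto.
    - intros z Hz. apply le_of_loglog_le.
      assert (G : Rabs (loglog (Cmod (F (w + (z - w)))) - loglog (Cmod (F w))) <= 2 * 2 * Cmod (z - w)).
      { apply loglog_growth with (F' := cder F); intros; auto. }
      replace (w + (z - w)) with z in G by ring. apply Rabs_le_between in G.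
      assert (loglog (Cmod (F w)) <= loglog (A + 1)).
      { apply loglog_mono. apply Cmod_ge_0. pose proof (AM a Ha).
        pose proof (Cmod_reverse (F w) a). lra. }
      lra.
    - intros u _ Hu. apply (RAM a u); auto. }
  set (psi := fun z => cder F z * cder F z / root_poly l (F z)).
  (* Four of the five factors absorb the growth (1 + |F|)^4 of |F'|^2. The fifth, |F z - a|, yields
     decay when it is at least 1, and is matched by [GL] when it is less than 1. *)
  assert (BND : forall z, root_poly l (F z) <> 0 -> exists a, In a l /\
     (1 <= Cmod (F z - a) -> Cmod (psi z) * Cmod (F z - a) <= 16 / c) /\
     (Cmod (F z - a) < 1 -> Cmod (psi z) <= 128 * Bd / c)).
  { intros z Hz. destruct (LB (F z)) as [a [Ha L]]. exists a. split; auto.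
    pose proof (Cmod_pos _ Hz) as PP. unfold psi. rewrite Cmod_div, Cmod_mult by auto.
    set (x := Cmod (F z)) in *. assert (Hx : 0 <= x) by apply Cmod_ge_0.
    set (Q := Cmod (root_poly l (F z))) in *. set (D := (Cmod (cder F z) * Cmod (cder F z))%R).
    assert (HDp : 0 <= D) by (unfold D; pose proof (Cmod_ge_0 (cder F z)); nra).
    assert (X4 : 1 <= (1 + x) ^ 4) by (apply pow_R1_Rle; lra).
    pose proof (Cmod_ge_0 (F z - a)) as Pa. set (da := Cmod (F z - a)) in *.
    split; intros S.
    2:{ pose proof (GL a z Ha S) as GA. fold D in GA. fold da in GA.
      apply Rmult_le_reg_r with (c * Q)%R. nra.
      replace (D / Q * (c * Q))%R with (c * D)%R by (field; lra).
      replace (128 * Bd / c * (c * Q))%R with (128 * Bd * Q)%R by (field; lra).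
      assert (CQ : c * da <= Q).
      { eapply Rle_trans; [|apply L]. rewrite <- (Rmult_1_r (c * da)) at 1.
        apply Rmult_le_compat_l; auto. apply Rmult_le_pos; lra. }
      apply Rle_trans with (c * (128 * Bd * da))%R. apply Rmult_le_compat_l; lra.
      replace (c * (128 * Bd * da))%R with (128 * Bd * (c * da))%R by ring.
      apply Rmult_le_compat_l; lra. }
    assert (GD : D <= 16 * (1 + x) ^ 4).
    { pose proof (HG z) as G1. fold x in G1. pose proof (gauge_upper x Hx).
      assert (G2 : Cmod (cder F z) <= 4 * (1 + x) ^ 2) by lra.
      pose proof (Cmod_ge_0 (cder F z)). unfold D.
      replace (16 * (1 + x) ^ 4)%R with ((4 * (1 + x) ^ 2) * (4 * (1 + x) ^ 2))%R by ring.
      apply Rmult_le_compat; auto. }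
    apply Rmult_le_reg_r with (c * Q)%R. nra.
    replace (D / Q * da * (c * Q))%R with (c * da * D)%R by (field; lra).
    replace (16 / c * (c * Q))%R with (16 * Q)%R by (field; lra).
    assert (c * da * D <= c * da * (16 * (1 + x) ^ 4)) by (apply Rmult_le_compat_l; nra). lra. }
  set (Mp := (128 * Bd / c + 16 / c)%R).
  assert (P1 : 0 < 128 * Bd / c) by (apply Rdiv_lt_0_compat; lra).
  assert (P2 : 0 < 16 / c) by (apply Rdiv_lt_0_compat; lra).
  assert (BND2 : forall z, root_poly l (F z) <> 0 -> Cmod (psi z) <= Mp).
  { intros z Hz. destruct (BND z Hz) as [a [_ [B1 B2]]]. unfold Mp.
    destruct (Rlt_le_dec (Cmod (F z - a)) 1) as [S|S]. specialize (B2 S). lra.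
    specialize (B1 S). pose proof (Cmod_ge_0 (psi z)). nra. }
  assert (HPF : forall z, exists m, cderiv (fun z => root_poly l (F z)) z m).
  { intros z. destruct (root_poly_deriv l (F z)) as [m Hm]. eexists.
    apply (cderiv_comp (root_poly l) F); eauto. }
  assert (NZ0 : root_poly l (F 0) <> 0).
  { intros E. apply root_poly_0 in E. apply H0. now apply (RAM (F 0)). }
  assert (DPSI : forall z, root_poly l (F z) <> 0 -> exists m, cderiv psi z m).
  { intros z Hz. destruct (HPF z) as [m Hm].
    destruct (holo_cder_holo F z 1 (HH z 1%R) z) as [m2 Hm2]. rewrite Cmod_diag; lra.
    eexists. apply cderiv_div; eauto. apply cderiv_mult; eauto. }
  destruct (removable_everywhere psi Mp) as [h [Hh [HhM Hheq]]].
  { intros z. pose proof (Cmod_ge_0 z).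
    (* The radius |z| + 1 puts 0 inside the disc, and [NZ0] then excludes identical vanishing. *)
    destruct (zeros_isolated (fun z => root_poly l (F z)) z (Cmod z + 1)) as [Z|[d [Hd Z]]].
    - lra.
    - intros w _. apply HPF.
    - exfalso. apply NZ0, Z. replace (0 - z) with (- z) by ring. rewrite Cmod_opp. lra.
    - exists d. split; auto. }
  pose proof (liouville h Mp Hh HhM) as CONST.
  assert (UNB : forall T, exists z, T < Cmod (F z)).
  { intros T. apply NNPP. intros N. apply H0.
    pose proof (liouville F T HF) as K. assert (KC : forall z w, F z = F w).
    { apply K. intros z. apply Rnot_lt_le. intros L. apply N. now exists z. }
    apply cder_unique. apply cderiv_ext with (fun _ => F 0). intros; apply KC. apply cderiv_const. }
  assert (Z : h 0 = 0).
  { apply Cmod_eq_0. apply Rle_antisym; [|apply Cmod_ge_0]. apply Rnot_lt_le. intros P.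
    set (k := Cmod (h 0)) in *.
    (* If |F z| > T, every |F z - a| exceeds 16 / (c k) + 1, so that |psi z| = k violates the decay
       bound 16 / c. *)
    set (T := (A + 1 + 16 / c / k + 1)%R).
    destruct (UNB T) as [z Hz].
    assert (Pk : 0 < 16 / c / k) by (apply Rdiv_lt_0_compat; lra).
    assert (Hfar : forall a, In a l -> 16 / c / k + 1 < Cmod (F z - a)).
    { intros a Ha. pose proof (AM a Ha). pose proof (Cmod_reverse (F z) a). unfold T in Hz. lra. }
    assert (NZ : root_poly l (F z) <> 0).
    { intros E. apply root_poly_0 in E. specialize (Hfar _ E). rewrite Cmod_diag in Hfar. lra. }
    destruct (DPSI z NZ) as [m Hm]. pose proof (Hheq z m Hm) as E.
    destruct (BND z NZ) as [a [Ha [Bz _]]]. specialize (Bz ltac:(specialize (Hfar a Ha); lra)).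
    rewrite <- E, (CONST z 0) in Bz. fold k in Bz. specialize (Hfar a Ha).
    assert (k * (16 / c / k + 1) < k * Cmod (F z - a)) by (apply Rmult_lt_compat_l; auto).
    replace (k * (16 / c / k + 1))%R with (16 / c + k)%R in H by (field; lra). lra. }
  destruct (DPSI 0 NZ0) as [m Hm]. rewrite (Hheq 0 m Hm) in Z. unfold psi in Z.
  apply H0. apply Cmod_eq_0.
  assert (E : cder F 0 * cder F 0 = 0).
  { replace (cder F 0 * cder F 0) with (cder F 0 * cder F 0 / root_poly l (F 0) * root_poly l (F 0)) by (field; auto).
    rewrite Z. ring. }
  apply (f_equal Cmod) in E. rewrite Cmod_mult, Cmod_0 in E. apply Rmult_integral in E. tauto.
Qed.

(** * Rescaling near an essential singularity *)

Definition holo_punctured (g : C -> C) (v : C) (rho : R) : Prop :=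
  forall z, z <> v -> Cmod (z - v) < rho -> exists l, cderiv g z l.

Definition bounded_near (g : C -> C) (v : C) : Prop :=
  exists M d, 0 < d /\ forall z, z <> v -> Cmod (z - v) < d -> Cmod (g z) <= M.

Definition frequently_bounded (g : C -> C) (v : C) : Prop :=
  exists M, forall d, 0 < d -> exists z, z <> v /\ Cmod (z - v) < d /\ Cmod (g z) <= M.

Lemma unit_cis (u : C) : Cmod u = 1%R -> exists t, Rabs t <= PI /\ u = cis t.
Proof.
  intros H. pose proof (Cmod_sqr u) as E. rewrite H in E.
  set (x := Re u) in *. set (y := Im u) in *.
  assert (Hx : -1 <= x <= 1) by nra.
  pose proof (acos_bound x) as B.
  assert (C1 : forall t, cis t = (cos t, sin t)).
  { intros t. unfold cis, Cexp. replace (Re (t * Ci)) with 0%R by (simpl; ring).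
    replace (Im (t * Ci)) with t by (simpl; ring). rewrite exp_0. ring. }
  assert (S : sin (acos x) = sqrt (1 - x²)) by (apply sin_acos; auto).
  assert (Y : (1 - x² = y * y)%R) by (unfold Rsqr; lra).
  destruct (Rle_lt_dec 0 y) as [P|N].
  - exists (acos x). split. rewrite Rabs_pos_eq; lra. rewrite C1, cos_acos, S, Y, sqrt_square by lra.
    unfold x, y. destruct u; reflexivity.
  - exists (- acos x)%R. split. rewrite Rabs_Ropp, Rabs_pos_eq; lra.
    rewrite C1, cos_neg, sin_neg, cos_acos, S, Y by lra.
    replace (y * y)%R with ((- y) * (- y))%R by ring. rewrite sqrt_square, Ropp_involutive by lra.
    unfold x, y. destruct u; reflexivity.
Qed.

(** In the logarithmic coordinate u = v + b exp w the derivative becomes g'(u) (u - v), and two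
    points of the circle are joined by a vertical segment of length at most pi; [loglog_growth]
    applies there. *)
Lemma loglog_on_circle (g : C -> C) (v z0 z : C) (k : R) : z0 <> v ->
  (forall u, Cmod (u - v) = Cmod (z0 - v) ->
     cderiv g u (cder g u) /\ Cmod (cder g u) * Cmod (u - v) <= k * gauge (Cmod (g u))) ->
  Cmod (z - v) = Cmod (z0 - v) -> 0 <= k ->
  loglog (Cmod (g z)) <= loglog (Cmod (g z0)) + 2 * k * PI.
Proof.
  intros N H Hz Hk. pose proof (Cminus_neq_0 _ _ N) as N'. set (b := z0 - v) in *.
  pose proof (Cmod_pos _ N') as Pb.
  destruct (unit_cis ((z - v) / b)) as [t [Ht Et]].
  { rewrite Cmod_div, Hz by auto. field. lra. }
  set (G := fun w => g (v + b * Cexp w)).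
  set (G' := fun w => cder g (v + b * Cexp w) * (0 + b * Cexp w)).
  assert (PT : forall s : R, Cmod (v + b * Cexp (0 + s * (t * Ci)) - v) = Cmod b).
  { intros s. replace (v + b * Cexp (0 + s * (t * Ci)) - v) with (b * Cexp (0 + s * (t * Ci))) by ring.
    replace (0 + s * (t * Ci)) with ((s * t)%R * Ci) by (rewrite RtoC_mult; ring).
    fold (cis (s * t)). rewrite Cmod_mult, Cmod_cis. ring. }
  pose proof (loglog_growth G G' 0 (t * Ci) k) as L.
  assert (L' : Rabs (loglog (Cmod (G (0 + t * Ci))) - loglog (Cmod (G 0))) <= 2 * k * Cmod (t * Ci)).
  { apply L.
    - intros s Hs. destruct (H _ (PT s)) as [D _].
      apply (cderiv_comp g (fun w => v + b * Cexp w)). exact D.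
      apply cderiv_plus. apply cderiv_const. apply (cderiv_scal b Cexp). apply cderiv_Cexp.
    - intros s Hs. destruct (H _ (PT s)) as [_ D]. unfold G', G. rewrite Cmod_mult.
      rewrite (Cplus_0_l (b * _)), (PT s) in *.
      replace (Cmod (b * Cexp (0 + s * (t * Ci)))) with (Cmod b). exact D.
      rewrite <- (PT s) at 1. f_equal. ring. }
  rewrite Cplus_0_l in L'. unfold G in L'. fold (cis t) in L'. rewrite <- Et, Cexp_0 in L'.
  replace (v + b * ((z - v) / b)) with z in L' by (field; auto).
  replace (v + b * 1) with z0 in L' by (unfold b; ring).
  rewrite Cmod_mult, Cmod_Ci, Cmod_R, Rmult_1_r in L'.
  apply Rabs_le_between in L'.
  assert (2 * k * Rabs t <= 2 * k * PI) by (apply Rmult_le_compat_l; lra). lra.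
Qed.

(** Otherwise loglog |g| varies by at most 2 k pi on every small circle round v. Circles through
    points where |g| <= M exist at arbitrarily small radii; |g| <= B on all of them, and between two
    of them by the maximum principle. So g would be bounded near v. *)
Lemma gauge_unbounded (g : C -> C) (v : C) (rho k d : R) : 0 < rho ->
  holo_punctured g v rho -> ~ bounded_near g v -> frequently_bounded g v ->
  0 <= k -> 0 < d ->
  exists z, z <> v /\ Cmod (z - v) < d /\
    k * gauge (Cmod (g z)) < Cmod (cder g z) * Cmod (z - v).
Proof.
  intros Hr Hg HNB [M HM] Hk Hd. apply NNPP. intros N.
  set (d1 := Rmin d rho). assert (Hd1 : 0 < d1) by (apply Rmin_pos; auto).
  assert (d1 <= d) by apply Rmin_l. assert (d1 <= rho) by apply Rmin_r. clearbody d1.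
  assert (HH : forall u, u <> v -> Cmod (u - v) < d1 ->
     cderiv g u (cder g u) /\ Cmod (cder g u) * Cmod (u - v) <= k * gauge (Cmod (g u))).
  { intros u Nu Hu. split. apply cder_correct, Hg; auto. lra.
    apply Rnot_lt_le. intros L. apply N. exists u. split; auto. split; auto. lra. }
  set (B := exp (exp (loglog M + 2 * k * PI))).
  assert (CIRC : forall z0 z, z0 <> v -> Cmod (z0 - v) < d1 -> Cmod (g z0) <= M ->
     Cmod (z - v) = Cmod (z0 - v) -> Cmod (g z) <= B).
  { intros z0 z Nz0 Hz0 HMz0 Ez. apply le_of_loglog_le.
    eapply Rle_trans. apply (loglog_on_circle g v z0 z k); auto.
    - intros u Hu. apply HH; [|lra]. intros ->. rewrite Cmod_diag in Hu.
      pose proof (Cmod_pos _ (Cminus_neq_0 _ _ Nz0)). lra.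
    - apply Rplus_le_compat_r, loglog_mono; auto. apply Cmod_ge_0. }
  destruct (HM d1 Hd1) as [zo [No [Ho Mo]]].
  set (ro := Cmod (zo - v)) in *. assert (Pro : 0 < ro) by (apply Cmod_pos, Cminus_neq_0, No).
  apply HNB. exists B, ro. split; auto. intros z1 N1 H1.
  pose proof (Cmod_pos _ (Cminus_neq_0 _ _ N1)) as P1.
  (* The outer circle is fixed; the inner one is chosen closer to v than the given point z1. *)
  destruct (HM (Cmod (z1 - v)) P1) as [zi [Ni [Hi Mi]]].
  set (ri := Cmod (zi - v)) in *. assert (Pri : 0 < ri) by (apply Cmod_pos, Cminus_neq_0, Ni).
  apply (maximum_principle (fun z => ri <= Cmod (z - v) <= ro) g B).
  - apply closed_annulus_bounded_closed.
  - intros z Hz. eapply cderiv_ccont. apply HH; [|lra]. intros ->. rewrite Cmod_diag in Hz. lra.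
  - intros z [Z1 Z2]. destruct (Rle_lt_or_eq_dec _ _ Z1) as [L1|E1].
    2:{ left. apply (CIRC zi); auto. fold ri. lra. }
    destruct (Rle_lt_or_eq_dec _ _ Z2) as [L2|E2].
    2:{ left. apply (CIRC zo); auto. }
    right. set (e := Rmin (Cmod (z - v) - ri) (ro - Cmod (z - v))).
    assert (He : 0 < e) by (apply Rmin_pos; lra).
    assert (e <= Cmod (z - v) - ri) by apply Rmin_l. assert (e <= ro - Cmod (z - v)) by apply Rmin_r.
    assert (IN : forall w, Cmod (w - z) < e -> ri <= Cmod (w - v) <= ro).
    { intros w Hw. pose proof (Cmod_dist w z v). pose proof (Cmod_dist z w v).
      rewrite (Cmod_minus_sym z w) in H5. lra. }
    exists e. split; auto. split; auto. intros w Hw. specialize (IN w Hw).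
    apply Hg. intros ->. rewrite Cmod_diag in IN. lra. lra.
  - lra.
Qed.

Lemma cderiv_affine (g : C -> C) (c : C) (r w l : C) :
  cderiv g (c + r * w) l -> cderiv (fun w => g (c + r * w)) w (l * r).
Proof.
  intros H. apply cderiv_eq with (l * (0 + r * 1)). ring.
  apply (cderiv_comp g (fun w => c + r * w)); auto. apply cderiv_plus. apply cderiv_const.
  apply (cderiv_scal r (fun w => w)), cderiv_id.
Qed.

Lemma rccont_dist (a z : C) : rccont (fun w => Cmod (w - a)) z.
Proof.
  apply (rccont_Cmod (fun w => w - a)). eapply cderiv_ccont.
  apply cderiv_minus. apply cderiv_id. apply cderiv_const.
Qed.

(* Zalcman-type point picking: maximise (delta - |z - z0|) |g'(z)| / gauge |g(z)|. *)
Lemma rescaling (g : C -> C) (v : C) (rho : R) (n : R) : 0 < rho ->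
  holo_punctured g v rho -> ~ bounded_near g v -> frequently_bounded g v -> 1 <= n ->
  exists (c : C) (r : R), 0 < r /\
    (forall w, Cmod w < n -> c + r * w <> v /\ Cmod (c + r * w - v) < / n) /\
    holo_disc (fun w => g (c + r * w)) 0 n /\
    (forall w, Cmod w < n ->
       Cmod (cder (fun w => g (c + r * w)) w) <= 2 * gauge (Cmod (g (c + r * w)))) /\
    Cmod (cder (fun w => g (c + r * w)) 0) = gauge (Cmod (g (c + r * 0))).
Proof.
  intros Hr Hg HNB HFB Hn.
  assert (Pn : 0 < / n) by (apply Rinv_0_lt_compat; lra).
  (* As delta is half of |z0 - v|, the factor 4 n makes the quantity to be maximised exceed 2 n at
     z0. *)
  destruct (gauge_unbounded g v rho (4 * n) (Rmin rho (/ n) / 2) Hr Hg HNB HFB) as [z0 [N0 [D0 G0]]].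
  { lra. } { pose proof (Rmin_pos _ _ Hr Pn). lra. }
  set (t0 := Cmod (z0 - v)) in *. assert (Pt : 0 < t0) by (apply Cmod_pos, Cminus_neq_0, N0).
  pose proof (Rmin_l rho (/ n)). pose proof (Rmin_r rho (/ n)).
  set (delta := (t0 / 2)%R). assert (Hdel : 0 < delta) by (unfold delta; lra).
  assert (IN : forall z, Cmod (z - z0) <= delta -> z <> v /\ Cmod (z - v) < / n /\ Cmod (z - v) < rho).
  { intros z Hz. pose proof (Cmod_dist z z0 v) as T1. fold t0 in T1. unfold delta in *.
    split; [|lra]. intros ->. rewrite Cmod_minus_sym in Hz. fold t0 in Hz. lra. }
  assert (DG : forall z, Cmod (z - z0) <= delta -> cderiv g z (cder g z)).
  { intros z Hz. destruct (IN z Hz) as [I1 [I2 I3]]. apply cder_correct, Hg; auto. }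
  assert (GP : forall z, 0 < gauge (Cmod (g z))) by (intros z; pose proof (gauge_ge_1 (Cmod (g z))); lra).
  assert (CD : forall z, Cmod (z - z0) <= delta -> ccont (cder g) z).
  { intros z Hz. destruct (IN z Hz) as [I1 [I2 I3]].
    pose proof (Cmod_pos _ (Cminus_neq_0 _ _ I1)) as P1.
    set (e := Rmin (Cmod (z - v)) (rho - Cmod (z - v))).
    assert (He : 0 < e) by (apply Rmin_pos; lra).
    assert (e <= Cmod (z - v)) by apply Rmin_l. assert (e <= rho - Cmod (z - v)) by apply Rmin_r.
    assert (HZ : holo_disc g z e).
    { intros w Hw. pose proof (Cmod_dist w z v). apply Hg; [|lra].
      intros ->. rewrite Cmod_minus_sym in Hw. lra. }
    destruct (holo_cder_holo g z e HZ z) as [l Hl]. rewrite Cmod_diag; auto.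
    eapply cderiv_ccont; eauto. }
  set (q := fun z => (Cmod (cder g z) * / gauge (Cmod (g z)))%R).
  assert (Q0 : forall z, 0 <= q z).
  { intros z. apply Rmult_le_pos. apply Cmod_ge_0. left. apply Rinv_0_lt_compat, GP. }
  set (u := fun z => ((delta + (-1) * Cmod (z - z0)) * q z)%R).
  destruct (closed_disc_bounded_closed z0 delta) as [[Bd HBd] Hcl].
  destruct (extreme_value (fun z => Cmod (z - z0) <= delta) u z0 Bd) as [zs [Hzs Hmax]]; auto.
  { rewrite Cmod_diag. lra. }
  { intros z Hz. apply rccont_mult.
    - apply rccont_plus. apply rccont_const. apply rccont_mult. apply rccont_const. apply rccont_dist.
    - apply rccont_mult. apply rccont_Cmod, CD; auto.
      apply (rccont_comp (fun x => / x)%R (fun z => gauge (Cmod (g z)))).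
      + apply continuity_pt_filterlim.
        apply (@ex_derive_continuous R_AbsRing R_NormedModule). auto_derive. specialize (GP z). lra.
      + apply rccont_gauge. eapply cderiv_ccont, DG; auto. }
  assert (U0 : 2 * n < u zs).
  { eapply Rlt_le_trans; [|apply (Hmax z0)]; [|rewrite Cmod_diag; lra].
    unfold u, q. rewrite Cmod_diag. specialize (GP z0).
    apply Rmult_lt_reg_r with (gauge (Cmod (g z0))); auto.
    replace ((delta + -1 * 0) * (Cmod (cder g z0) * / gauge (Cmod (g z0))) * gauge (Cmod (g z0)))%R
      with (delta * Cmod (cder g z0))%R by (field; lra).
    unfold delta. nra. }
  set (eta := (delta + -1 * Cmod (zs - z0))%R) in *.
  set (A := q zs). assert (UA : u zs = (eta * A)%R) by reflexivity.
  assert (Heta : 0 < eta).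
  { specialize (Q0 zs). fold A in Q0. assert (0 <= eta) by (unfold eta; lra). nra. }
  assert (HA : 0 < A) by (specialize (Q0 zs); fold A in Q0; nra).
  assert (PA : 0 < / A) by (apply Rinv_0_lt_compat; auto).
  (* This follows from eta A > 2 n. Over the rescaled disc of radius n the weight delta - |z - z0|
     is still at least eta / 2, so maximality gives q <= 2 A there: the origin of the factor 2 in
     the derivative bound. *)
  assert (SC : n * / A < eta / 2).
  { apply Rmult_lt_reg_r with A; auto. rewrite Rmult_assoc, Rinv_l, Rmult_1_r by lra. lra. }
  exists zs, (/ A)%R.
  assert (NEAR : forall w, Cmod w < n -> Cmod ((/ A)%R * w) < eta / 2).
  { intros w Hw. rewrite Cmod_mult, Cmod_RtoC by lra. nra. }
  assert (NEAR2 : forall w, Cmod w < n -> Cmod (zs + (/ A)%R * w - z0) <= delta - eta / 2).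
  { intros w Hw. specialize (NEAR w Hw).
    replace (zs + (/ A)%R * w - z0) with ((zs - z0) + (/ A)%R * w) by ring.
    eapply Rle_trans. apply Cmod_triangle. unfold eta in *. lra. }
  assert (DF : forall w, Cmod w < n -> cderiv (fun w => g (zs + (/ A)%R * w)) w
     (cder g (zs + (/ A)%R * w) * (/ A)%R)).
  { intros w Hw. specialize (NEAR2 w Hw). apply cderiv_affine, DG. lra. }
  assert (QB : forall w, Cmod w < n -> q (zs + (/ A)%R * w) <= 2 * A).
  { intros w Hw. specialize (NEAR2 w Hw). set (z := zs + (/ A)%R * w) in *.
    pose proof (Hmax z ltac:(lra)) as HM. rewrite UA in HM. unfold u in HM.
    specialize (Q0 z). assert (eta / 2 * q z <= eta * A).
    { eapply Rle_trans; [|apply HM]. apply Rmult_le_compat_r; lra. }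
    nra. }
  assert (P0 : Cmod 0 < n) by (rewrite Cmod_0; lra).
  split; [auto|split; [|split; [|split]]].
  - intros w Hw. specialize (NEAR2 w Hw). destruct (IN (zs + (/ A)%R * w)) as [I1 [I2 I3]]. lra. auto.
  - intros w Hw. replace (w - 0) with w in Hw by ring. eexists. apply DF; auto.
  - intros w Hw. rewrite (cder_unique _ w _ (DF w Hw)), Cmod_mult, Cmod_RtoC by lra.
    specialize (QB w Hw). unfold q in QB. set (z := zs + (/ A)%R * w) in *. specialize (GP z).
    apply Rmult_le_compat_r with (r := gauge (Cmod (g z))) in QB; [|lra].
    rewrite Rmult_assoc, Rinv_l, Rmult_1_r in QB by lra.
    apply Rmult_le_reg_r with A; auto. rewrite Rmult_assoc, Rinv_l, Rmult_1_r by lra. lra.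
  - rewrite (cder_unique _ 0 _ (DF 0 P0)), Cmod_mult, Cmod_RtoC by lra.
    replace (zs + (/ A)%R * 0) with zs by ring. specialize (GP zs).
    unfold A at 1, q. rewrite Rinv_mult, Rinv_inv.
    assert (Cmod (cder g zs) <> 0%R).
    { intros E. unfold A, q in HA. rewrite E in HA. lra. }
    field. auto.
Qed.

(* Montel's theorem, pointwise along an ultrafilter: the uniform Taylor estimate
   passes to the limit, so no locally uniform convergence is needed. *)
Lemma ultralimit_of_holomorphic (U : (nat -> Prop) -> Prop) (HU : free_ultrafilter U)
  (F : nat -> C -> C) (Bd : R -> R) :
  (forall n, holo_disc (F n) 0 (INR n)) ->
  (forall n r w, Cmod w <= r -> r < INR n -> Cmod (F n w) <= Bd r) ->
  exists f : C -> C, (forall w, ulim U (fun n => F n w) (f w)) /\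
    (forall w, exists l, cderiv f w l) /\
    (forall w, ulim U (fun n => cder (F n) w) (cder f w)).
Proof.
  intros HF HB.
  pose proof (uf_INR U HU) as EV.
  assert (L1 : forall w, exists l, ulim U (fun n => F n w) l).
  { intros w. apply (ulim_exists U HU _ (Bd (Cmod w))).
    generalize (EV (Cmod w)). apply (uf_mono U HU). intros n Hn. apply HB with (r := Cmod w); auto. lra. }
  apply choice in L1. destruct L1 as [f Hf].
  assert (SUB : forall n w, Cmod w + 1 < INR n -> holo_disc (F n) w 1 /\
     forall z, Cmod (z - w) < 1 -> Cmod (F n z) <= Bd (Cmod w + 1)%R).
  { intros n w Hn. split.
    - apply holo_sub with (RtoC 0) (INR n); auto. replace (w - 0) with w by ring. lra.
    - intros z Hz. apply HB; auto. pose proof (Cmod_reverse z w). lra. }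
  assert (L2 : forall w, exists l, ulim U (fun n => cder (F n) w) l).
  { intros w. apply (ulim_exists U HU _ (Bd (Cmod w + 1)%R)).
    generalize (EV (Cmod w + 1)%R). apply (uf_mono U HU). intros n Hn.
    destruct (SUB n w Hn) as [S1 S2]. pose proof (cauchy_estimate (F n) w 1 _ Rlt_0_1 S1 S2). lra. }
  apply choice in L2. destruct L2 as [D HD].
  assert (DER : forall w, cderiv f w (D w)).
  { intros w eps He. set (B := Bd (Cmod w + 1)%R). set (K := (8 * (Rabs B))%R). pose proof (Rabs_pos B).
    exists (Rmin (1 / 4) (eps / (K + 1))). assert (HK : 0 <= K) by (unfold K; lra). split.
    apply Rmin_pos; [lra|apply Rdiv_lt_0_compat; lra]. intros h Hh.
    destruct (proj1 (Rmin_Rgt _ _ _) Hh) as [h1 h2].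
    pose proof (Cmod_ge_0 h).
    apply Rle_trans with (K * Cmod h * Cmod h)%R.
    - apply (ulim_le U HU (fun n => F n (w + h) + (-1) * F n w + (- h) * cder (F n) w)).
      + replace (f (w + h) - f w - D w * h) with (f (w + h) + (-1) * f w + (- h) * D w) by ring.
        apply ulim_plus; auto. apply ulim_plus; auto. apply ulim_scal; auto. apply ulim_scal; auto.
      + generalize (EV (Cmod w + 1)%R). apply (uf_mono U HU). intros n Hn.
        destruct (SUB n w Hn) as [S1 S2].
        replace (F n (w + h) + (-1) * F n w + (- h) * cder (F n) w)
          with (F n (w + h) - F n w - cder (F n) w * h) by ring.
        eapply Rle_trans. apply taylor1 with (rho := 1%R) (M := B); auto; lra.
        rewrite Rmult_1_r, Rdiv_1_r. pose proof (Rle_abs B).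
        apply Rmult_le_compat_r; auto. apply Rmult_le_compat_r; auto. unfold K. lra.
    - apply Rmult_le_compat_r; auto.
      apply Rle_trans with ((K + 1) * (eps / (K + 1)))%R. nra. right. field. lra. }
  exists f. split; auto. split. intros w. now exists (D w).
  intros w. rewrite (cder_unique f w (D w)); auto.
Qed.

(* The rescalings of g have an entire limit f, and f has a simple a-point for some a.
   Near that point the rescalings are invertible over a disc that does not depend on eps. *)
Theorem univalent_sections (g : C -> C) (v : C) (rho : R) (l : list C) : 0 < rho ->
  holo_punctured g v rho -> ~ bounded_near g v -> frequently_bounded g v ->
  NoDup l -> length l = 5%nat ->
  exists a r0, In a l /\ 0 < r0 /\ forall eps, 0 < eps ->
   exists phi : C -> C, forall y, Cmod (y - a) < r0 ->
     phi y <> v /\ Cmod (phi y - v) < eps /\ g (phi y) = y /\ exists m, cderiv phi y m.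
Proof.
  intros Hr Hg HNB HFB ND LEN.
  (* The rescaling needs 1 <= n. Index 0 gets an arbitrary pair, which the free ultrafilter
     ignores. *)
  assert (RS : forall n : nat, exists cr : C * R, (1 <= n)%nat ->
    (forall w, Cmod w < INR n -> fst cr + snd cr * w <> v /\ Cmod (fst cr + snd cr * w - v) < / INR n) /\
    0 < snd cr /\
    holo_disc (fun w => g (fst cr + snd cr * w)) 0 (INR n) /\
    (forall w, Cmod w < INR n ->
       Cmod (cder (fun w => g (fst cr + snd cr * w)) w) <= 2 * gauge (Cmod (g (fst cr + snd cr * w)))) /\
    Cmod (cder (fun w => g (fst cr + snd cr * w)) 0) = gauge (Cmod (g (fst cr + snd cr * 0)))).
  { intros n. destruct (Compare_dec.le_lt_dec 1 n) as [L|L]; [|exists (v, 0%R); intros; lia].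
    destruct (rescaling g v rho (INR n) Hr Hg HNB HFB) as [c [r [R1 [R2 [R3 [R4 R5]]]]]].
    { apply (le_INR 1). auto. }
    exists (c, r). simpl. auto. }
  apply choice in RS. destruct RS as [cr Hcr].
  set (F := fun n w => g (fst (cr n) + snd (cr n) * w)).
  set (Bd := fun r : R => exp (exp (loglog 1 + 4 * (r + 1)))).
  assert (HF : forall n, holo_disc (F n) 0 (INR n)).
  { intros n. destruct (Compare_dec.le_lt_dec 1 n) as [L|L]. apply (Hcr n L).
    replace n with 0%nat by lia. intros z Hz. simpl in Hz. pose proof (Cmod_ge_0 (z - 0)). lra. }
  assert (HB : forall n r w, Cmod w <= r -> r < INR n -> Cmod (F n w) <= Bd r).
  { intros n r w Hw Hn. assert (L : (1 <= n)%nat).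
    { destruct n; [|lia]. simpl in Hn. pose proof (Cmod_ge_0 w). lra. }
    destruct (Hcr n L) as [_ [_ [R3 [R4 R5]]]]. apply le_of_loglog_le.
    eapply Rle_trans. apply (normalized_locally_bounded (F n) (INR n)); auto. apply (le_INR 1); auto. lra.
    lra. }
  destruct free_ultrafilter_exists as [U HU].
  destruct (ultralimit_of_holomorphic U HU F Bd HF HB) as [f [Lf [Df Lf']]].
  assert (EV : forall r : R, U (fun n => (1 <= n)%nat /\ r < INR n)).
  { intros r. apply (uf_and U HU). apply (uf_tail U HU). apply (uf_INR U HU). }
  assert (GF : forall w, Cmod (cder f w) <= 2 * gauge (Cmod (f w))).
  { intros w. apply le_epsilon. intros eps He.
    assert (He2 : 0 < eps / 2) by lra.
    destruct (rccont_gauge (fun z => z) (f w) (ccont_id _) _ He2) as [d [Hd Hg']].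
    apply (ulim_le U HU (fun n => cder (F n) w)); auto.
    generalize (uf_and U HU _ _ (EV (Cmod w)) (Lf w d Hd)). apply (uf_mono U HU).
    intros n [[N1 N2] N3]. destruct (Hcr n N1) as [_ [_ [_ [R4 _]]]].
    eapply Rle_trans. apply R4; auto. specialize (Hg' (F n w) N3). apply Rabs_lt_between in Hg'.
    fold (F n w). lra. }
  (* The normalisation makes |F n'(0)| a value of [gauge], hence at least 1; this survives in the
     limit and excludes a constant limit. *)
  assert (NZ : cder f 0 <> 0).
  { intros E. destruct (uf_ex U HU _ (uf_and U HU _ _ (EV 0%R) (Lf' 0 1%R Rlt_0_1))) as [n [[N1 _] N3]].
    destruct (Hcr n N1) as [_ [_ [_ [_ R5]]]]. rewrite E in N3.
    replace (cder (F n) 0 - 0) with (cder (F n) 0) in N3 by ring. unfold F in N3. rewrite R5 in N3.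
    pose proof (gauge_ge_1 (Cmod (g (fst (cr n) + snd (cr n) * 0)))). lra. }
  destruct (entire_simple_points f l ND LEN Df GF NZ) as [a [w0 [Ha [Hw0 HD0]]]].
  pose proof (Cmod_pos _ HD0) as PD. set (m := (Cmod (cder f w0) / 2)%R).
  assert (Hm : 0 < m) by (unfold m; lra).
  set (B := Bd (Cmod w0 + 1)%R).
  assert (HBp : 0 < B) by apply exp_pos.
  (* With Lipschitz constant 8 B, the derivative of F n varies by at most m / 2 over radius s, less
     than half of |A| since |A| > m. *)
  set (s := Rmin (1 / 8) (m / (16 * B))).
  assert (Hs : 0 < s) by (apply Rmin_pos; [lra|apply Rdiv_lt_0_compat; lra]).
  assert (Hs1 : s <= 1 / 8) by apply Rmin_l.
  assert (Hs2 : 16 * B * s <= m).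
  { apply Rle_trans with (16 * B * (m / (16 * B)))%R. apply Rmult_le_compat_l. lra. apply Rmin_r.
    right. field. lra. }
  clearbody s.
  (* The section lives over a disc of radius |A| s / 8 > 2 r0 round F n w0; half of that is spent on
     moving the centre to a. Only the limit f enters r0, so it does not depend on eps. *)
  set (r0 := (m * s / 16)%R). assert (Hr0 : 0 < r0) by (unfold r0; nra).
  exists a, r0. split; auto. split; auto. intros eps He.
  destruct (uf_ex U HU _ (uf_and U HU _ _ (EV (Rmax (Cmod w0 + 1) (/ eps)))
    (uf_and U HU _ _ (Lf' w0 m Hm) (Lf w0 r0 Hr0)))) as [n [[N1 N2] [N3 N4]]].
  assert (N5 : Cmod w0 + 1 < INR n) by (eapply Rle_lt_trans; [apply Rmax_l|apply N2]).
  assert (N6 : / INR n < eps).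
  { assert (/ eps < INR n) by (eapply Rle_lt_trans; [apply Rmax_r|apply N2]).
    rewrite <- (Rinv_inv eps). apply Rinv_lt_contravar; auto.
    apply Rmult_lt_0_compat; [apply Rinv_0_lt_compat; auto|].
    apply Rlt_trans with (2 := H). apply Rinv_0_lt_compat; auto. }
  set (A := cder (F n) w0).
  assert (HA : m < Cmod A).
  { pose proof (Cmod_reverse (cder f w0) A). rewrite Cmod_minus_sym in H. fold A in N3. unfold m in *. lra. }
  assert (HA0 : A <> 0) by (intros E; rewrite E, Cmod_0 in HA; lra).
  assert (H1 : holo_disc (F n) w0 1).
  { apply holo_sub with (RtoC 0) (INR n); auto. replace (w0 - 0) with w0 by ring. lra. }
  destruct (local_section (F n) w0 A s Hs HA0) as [sg Hsg].
  { apply holo_sub with w0 1%R; auto. rewrite Cmod_diag. lra. }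
  { intros u Hu. replace u with (w0 + (u - w0)) by ring.
    eapply Rle_trans. apply cder_lipschitz with (rho := 1%R) (M := B); auto; try lra.
    - intros z Hz. apply HB; auto. pose proof (Cmod_reverse z w0). lra.
    - rewrite Rmult_1_r, Rdiv_1_r. pose proof (Cmod_ge_0 (u - w0)). nra. }
  exists (fun y => fst (cr n) + snd (cr n) * sg y). intros y Hy.
  destruct (Hsg y) as [S1 [S2 [q Hq]]].
  { rewrite Hw0 in N4. pose proof (Cmod_dist y a (F n w0)). rewrite (Cmod_minus_sym a) in H.
    assert (m * s <= Cmod A * s) by nra. unfold r0 in *. lra. }
  assert (S3 : Cmod (sg y) < INR n) by (pose proof (Cmod_reverse (sg y) w0); lra).
  destruct (Hcr n N1) as [R2 _]. destruct (R2 _ S3) as [T1 T2].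
  split; auto. split. lra. split. exact S2.
  eexists. apply cderiv_plus. apply cderiv_const. apply cderiv_scal. eauto.
Qed.

(** * Two-cycles *)

(** The identity theorem is available on discs only. The largest disc round b that avoids v lies in
    the domain because |b - v| < rho / 2. *)
Lemma identity_touching_disc (g : C -> C) (v b c : C) (rho e : R) : holo_punctured g v rho ->
  b <> v -> Cmod (b - v) < rho / 2 -> 0 < e -> (forall z, Cmod (z - b) < e -> g z = c) ->
  forall z, Cmod (z - b) < Cmod (b - v) -> g z = c.
Proof.
  intros Hg Nb Hb He H z Hz. apply Cminus_eq_0.
  apply (identity_on_disc (fun z => g z - c) b (Cmod (b - v)) e He); auto.
  - apply holo_minus; [|apply holo_const]. intros w Hw. apply Hg.
    + intros ->. rewrite Cmod_minus_sym in Hw. lra.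
    + pose proof (Cmod_dist w b v). lra.
  - intros w Hw. rewrite H by auto. ring.
Qed.

Definition spiral_ratio : C := (/ 2, / 2)%R.

(* Discs centred at v + (b - v) ((1 + i) / 2)^k and touching v, for k = 0, 2, 4, 6,
   already cover a punctured neighbourhood of v. *)
Lemma identity_punctured (g : C -> C) (v b c : C) (rho e : R) : holo_punctured g v rho ->
  b <> v -> Cmod (b - v) < rho / 2 -> 0 < e -> (forall z, Cmod (z - b) < e -> g z = c) ->
  exists d, 0 < d /\ forall z, z <> v -> Cmod (z - v) < d -> g z = c.
Proof.
  intros Hg Nb Hb He H. set (t := b - v). assert (Nt : t <> 0) by now apply Cminus_neq_0.
  pose proof (Cmod_pos _ Nt) as Pt.
  assert (Mw : (Cmod spiral_ratio * Cmod spiral_ratio = / 2)%R) by (rewrite Cmod_sqr; simpl; lra).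
  assert (Mw1 : (Cmod (spiral_ratio - 1) * Cmod (spiral_ratio - 1) = / 2)%R) by (rewrite Cmod_sqr; simpl; lra).
  pose proof (Cmod_ge_0 spiral_ratio). pose proof (Cmod_ge_0 (spiral_ratio - 1)).
  assert (Lw : 0 < Cmod spiral_ratio < 1) by nra. assert (Lw1 : Cmod (spiral_ratio - 1) < 1) by nra.
  assert (SP : forall k, 0 < Cmod (t * spiral_ratio ^ k) <= Cmod t /\
     forall z, Cmod (z - (v + t * spiral_ratio ^ k)) < Cmod (t * spiral_ratio ^ k) -> g z = c).
  { induction k as [|k [IH1 IH2]].
    - simpl. rewrite Cmult_1_r. split. lra. replace (v + t) with b by (unfold t; ring).
      intros z Hz. apply (identity_touching_disc g v b c rho e); auto.
    - set (p := t * spiral_ratio ^ k) in *.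
      replace (t * spiral_ratio ^ S k) with (p * spiral_ratio) by (unfold p; simpl; ring).
      assert (P1 : 0 < Cmod (p * spiral_ratio) <= Cmod t) by (rewrite Cmod_mult; nra).
      split; auto. intros z Hz.
      assert (Ep : v + p * spiral_ratio - v = p * spiral_ratio) by ring.
      (* Consecutive centres are at distance |p| |[spiral_ratio] - 1| < |p|, so a small disc round
         the new centre lies in the previous disc. *)
      apply (identity_touching_disc g v (v + p * spiral_ratio) c rho (Cmod p - Cmod p * Cmod (spiral_ratio - 1))%R);
        rewrite ?Ep; auto.
      + intros E. rewrite E in Ep. replace (v - v) with (RtoC 0) in Ep by ring. rewrite <- Ep, Cmod_0 in P1. lra.
      + unfold t in *. lra.
      + nra.
      + intros w Hw. apply IH2.
        replace (w - (v + p)) with ((w - (v + p * spiral_ratio)) + p * (spiral_ratio - 1)) by ring.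
        eapply Rle_lt_trans. apply Cmod_triangle. rewrite Cmod_mult. lra. }
  (* The smallest of the four discs used, with centre - i / 8 in the coordinate u, determines this
     radius: 2 y^2 < - y / 4 requires |y| < 1 / 8. *)
  exists (Cmod t / 8)%R. split. lra. intros z Nz Hz.
  set (u := (z - v) / t).
  assert (Ez : z - v = t * u) by (unfold u; field; auto).
  assert (Hu : Cmod u < 1 / 8).
  { apply Rmult_lt_reg_l with (Cmod t); auto. rewrite <- Cmod_mult, <- Ez. lra. }
  assert (Nu : u <> 0).
  { intros E. apply Nz, Cminus_eq_0. rewrite Ez, E. ring. }
  assert (COVER : exists k, Cmod (u - spiral_ratio ^ k) < Cmod (spiral_ratio ^ k)).
  { assert (SQ : forall a b : C, (Cmod a * Cmod a < Cmod b * Cmod b)%R -> Cmod a < Cmod b).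
    { intros a0 b0 L. apply Rsqr_incrst_0; auto; apply Cmod_ge_0. }
    pose proof (re_le_Cmod u) as Rx. pose proof (im_le_Cmod u) as Ry.
    apply Rabs_le_between in Rx. apply Rabs_le_between in Ry.
    assert (NN : ~ (Re u = 0%R /\ Im u = 0%R)).
    { intros [E1 E2]. apply Nu. destruct u. simpl in *. now rewrite E1, E2. }
    set (x := Re u) in *. set (y := Im u) in *.
    assert (W2 : spiral_ratio ^ 2 = (0, / 2)%R) by (apply injective_projections; simpl; field).
    assert (W4 : spiral_ratio ^ 4 = (- / 4, 0)%R) by (apply injective_projections; simpl; field).
    assert (W6 : spiral_ratio ^ 6 = (0, - / 8)%R) by (apply injective_projections; simpl; field).
    (* The centres 1, i / 2, - 1 / 4 and - i / 8 lie on the four half-axes, and near 0 each disc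
       contains the quarter-plane sector round its half-axis. The larger of |x| and |y|, with its
       sign, selects the sector. *)
    assert (CASES : (x * x + y * y < 2 * x \/ x * x + y * y < y \/ x * x + y * y < - x / 2 \/ x * x + y * y < - y / 4)%R).
    { destruct (Rle_lt_dec (Rabs y) (Rabs x)) as [L|L].
      - assert (y * y <= x * x)%R by (apply Rsqr_le_abs_1 in L; exact L).
        destruct (Rtotal_order x 0) as [X|[X|X]].
        + right; right; left. nra.
        + exfalso. apply NN. split; auto. rewrite X, Rabs_R0 in L. pose proof (Rabs_pos y).
          destruct (Req_dec y 0) as [|Ny]; auto. apply Rabs_pos_lt in Ny. lra.
        + left. nra.
      - assert (x * x <= y * y)%R by (apply Rlt_le, Rsqr_le_abs_1 in L; exact L).
        destruct (Rtotal_order y 0) as [X|[X|X]].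
        + right; right; right. nra.
        + exfalso. rewrite X, Rabs_R0 in L. pose proof (Rabs_pos x). lra.
        + right; left. nra. }
    destruct CASES as [K|[K|[K|K]]]; [exists 0%nat|exists 2%nat|exists 4%nat|exists 6%nat];
      apply SQ; rewrite ?W2, ?W4, ?W6, !Cmod_sqr, Re_minus, Im_minus; fold x; fold y; simpl; nra. }
  destruct COVER as [k Hk]. destruct (SP k) as [_ SPk]. apply SPk.
  replace (z - (v + t * spiral_ratio ^ k)) with (t * (u - spiral_ratio ^ k)).
  rewrite !Cmod_mult. apply Rmult_lt_compat_l; auto.
  replace (z - (v + t * spiral_ratio ^ k)) with ((z - v) - t * spiral_ratio ^ k) by ring.
  rewrite Ez. ring.
Qed.

(** * Cycles from sections *)

Lemma circle_min_positive (f : C -> C) (a : C) (r rho : R) : 0 < r < rho ->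
  holo_disc f a rho -> (forall z, Cmod (z - a) = r -> f z <> 0) ->
  exists m, 0 < m /\ forall z, Cmod (z - a) = r -> m <= Cmod (f z).
Proof.
  intros Hr Hf H.
  destruct (closed_annulus_bounded_closed a r r) as [[B HB] Hcl].
  destruct (extreme_value (fun z => r <= Cmod (z - a) <= r) (fun z => (-1 * Cmod (f z))%R) (a + r) B)
    as [w [Hw Hm]]; auto.
  - replace (a + r - a) with (RtoC r) by ring. rewrite Cmod_RtoC; lra.
  - intros z Hz. apply rccont_mult. apply rccont_const. apply rccont_Cmod.
    destruct (Hf z) as [l Hl]. lra. eapply cderiv_ccont; eauto.
  - exists (Cmod (f w)). split. apply Cmod_pos, H. lra.
    intros z Hz. specialize (Hm z ltac:(lra)). lra.
Qed.

(* With a section phi of g near a taking values close to v, g - phi has a zero q near a,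
   and then g (g q) = g (phi q) = q; the multiplier is g'(q) / phi'(q). *)
Theorem two_cycles_near_preimages (g : C -> C) (v : C) (rho delta : R) (l : list C) : 0 < rho ->
  holo_punctured g v rho -> ~ bounded_near g v -> frequently_bounded g v ->
  NoDup l -> length l = 5%nat ->
  (forall a, In a l -> a <> v /\ Cmod (a - v) < rho / 2 /\ Cmod (a - v) < delta /\ g a = v) ->
  exists a, In a l /\ forall K, exists q mu,
    q <> v /\ Cmod (q - v) < delta /\ g q <> v /\ Cmod (g q - v) < delta /\
    g (g q) = q /\ g q <> q /\ cderiv (fun z => g (g z)) q mu /\
    (cder g a <> 0 -> K < Cmod mu).
Proof.
  intros Hr Hg HNB HFB ND LEN Hl.
  destruct (univalent_sections g v rho l Hr Hg HNB HFB ND LEN) as [a [r0 [Ha [Hr0 HS]]]].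
  exists a. split; auto. destruct (Hl a Ha) as [Na [Ha1 [Ha2 Ga]]].
  pose proof (Cmod_pos _ (Cminus_neq_0 _ _ Na)) as Pa. set (ta := Cmod (a - v)) in *.
  assert (Hol : holo_disc g a ta).
  { intros w Hw. apply Hg.
    - intros ->. rewrite Cmod_minus_sym in Hw. fold ta in Hw. lra.
    - pose proof (Cmod_dist w a v). fold ta in H. lra. }
  (* Otherwise g = v on a disc touching v, hence on a punctured neighbourhood of v, and g would be
     bounded there. *)
  assert (ISO : exists d, 0 < d /\ forall z, z <> a -> Cmod (z - a) < d -> g z - v <> 0).
  { destruct (zeros_isolated (fun z => g z - v) a ta Pa) as [Z|Z]; auto.
    - apply holo_minus; auto. apply holo_const.
    - exfalso. destruct (identity_punctured g v a v rho ta Hg Na Ha1 Pa) as [d [Hd Hc]].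
      { intros z Hz. apply Cminus_eq_0, Z; auto. }
      apply HNB. exists (Cmod v), d. split; auto. intros z Nz Hz. rewrite Hc by auto. lra. }
  destruct ISO as [d1 [Hd1 Hiso]].
  assert (LOW : exists d, 0 < d /\ forall z, Cmod (z - a) < d -> Cmod (cder g a) / 2 <= Cmod (cder g z)).
  { destruct (Req_dec (Cmod (cder g a)) 0) as [E|N].
    - exists 1%R. split. lra. intros z _. rewrite E. pose proof (Cmod_ge_0 (cder g z)). lra.
    - pose proof (Cmod_ge_0 (cder g a)). destruct (holo_cder_holo g a ta Hol a) as [m Hm].
      rewrite Cmod_diag; auto.
      destruct (cderiv_ccont _ _ _ Hm (Cmod (cder g a) / 2)%R ltac:(lra)) as [d [Hd Hc]].
      exists d. split; auto. intros z Hz. specialize (Hc z Hz).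
      pose proof (Cmod_reverse (cder g a) (cder g z)) as R. rewrite Cmod_minus_sym in R. lra. }
  destruct LOW as [d2 [Hd2 Hlow]].
  (* The disc of radius 2 r round a must lie in the domain of the sections (r0), away from v (ta)
     and within delta of v; it must contain no other preimage of v (d1) and keep |g'| >= |g'(a)| / 2
     (d2). *)
  set (r := (Rmin (Rmin (r0 / 4) (ta / 4)) (Rmin (delta - ta) (Rmin d1 d2)) / 2)%R).
  assert (Hrs : 0 < r /\ 2 * r <= r0 / 4 /\ 2 * r <= ta / 4 /\ 2 * r <= delta - ta /\ 2 * r <= d1 /\ 2 * r <= d2).
  { unfold r. set (m := Rmin (Rmin (r0 / 4) (ta / 4)) (Rmin (delta - ta) (Rmin d1 d2))).
    assert (0 < m) by (unfold m; repeat apply Rmin_pos; lra).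
    pose proof (Rmin_l (Rmin (r0 / 4) (ta / 4)) (Rmin (delta - ta) (Rmin d1 d2))) as A1.
    pose proof (Rmin_r (Rmin (r0 / 4) (ta / 4)) (Rmin (delta - ta) (Rmin d1 d2))) as A2. fold m in A1, A2.
    pose proof (Rmin_l (r0 / 4) (ta / 4)). pose proof (Rmin_r (r0 / 4) (ta / 4)).
    pose proof (Rmin_l (delta - ta) (Rmin d1 d2)). pose proof (Rmin_r (delta - ta) (Rmin d1 d2)).
    pose proof (Rmin_l d1 d2). pose proof (Rmin_r d1 d2). lra. }
  clearbody r. destruct Hrs as [Pr [L1 [L2 [L3 [L4 L5]]]]].
  destruct (circle_min_positive (fun z => g z - v) a r ta) as [m [Hm Hmin]].
  { lra. } { apply holo_minus; auto. apply holo_const. }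
  { intros z Hz. apply Hiso; [|lra]. intros ->. rewrite Cmod_diag in Hz. lra. }
  intros K.
  set (c := Cmod (cder g a)). pose proof (Cmod_ge_0 (cder g a)) as Pc. fold c in Pc.
  pose proof (Rabs_pos K) as PK.
  (* Calibrated for the multiplier bound. When g'(a) = 0 no such bound is claimed, and e4 is
     arbitrary. *)
  assert (E4 : exists e4, 0 < e4 /\ (0 < c -> e4 * (4 * (Rabs K + 1)) <= r * c)).
  { destruct Pc as [Pc|Pc].
    - exists (r * c / (4 * (Rabs K + 1)))%R. split. apply Rdiv_lt_0_compat; nra.
      intros _. right. field. lra.
    - exists 1%R. split; intros; lra. }
  destruct E4 as [e4 [Pe4 E4]].
  assert (Hdelta : 0 < delta) by lra.
  (* m / 2 makes |g - phi| smaller at a than on the circle; delta keeps g q close to v; ta / 2 puts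
     g q = phi q nearer to v than q is, so that g q <> q; e4 makes the multiplier large. *)
  set (eps := Rmin (Rmin (m / 2) delta) (Rmin (ta / 2) e4)).
  assert (He : 0 < eps) by (unfold eps; repeat apply Rmin_pos; lra).
  assert (Q1 : eps <= m / 2) by (unfold eps; eapply Rle_trans; [apply Rmin_l|apply Rmin_l]).
  assert (Q2 : eps <= delta) by (unfold eps; eapply Rle_trans; [apply Rmin_l|apply Rmin_r]).
  assert (Q3 : eps <= ta / 2) by (unfold eps; eapply Rle_trans; [apply Rmin_r|apply Rmin_l]).
  assert (Q4 : eps <= e4) by (unfold eps; eapply Rle_trans; [apply Rmin_r|apply Rmin_r]).
  clearbody eps.
  destruct (HS (eps / 2)%R ltac:(lra)) as [phi Hphi].
  assert (Hphol : holo_disc phi a (2 * r)).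
  { intros y Hy. apply (Hphi y). lra. }
  destruct (zero_in_disc (fun z => g z - phi z) a r (2 * r) (m - eps / 2)) as [q [Hq Eq]].
  { lra. } { apply holo_minus; auto. apply holo_sub with a ta; auto. rewrite Cmod_diag. lra. }
  { intros z Hz. specialize (Hmin z Hz). destruct (Hphi z ltac:(lra)) as [_ [H2 _]].
    replace (g z - phi z) with ((g z - v) - (phi z - v)) by ring.
    pose proof (Cmod_reverse (g z - v) (phi z - v)). lra. }
  { rewrite Ga. destruct (Hphi a) as [_ [H2 _]]. rewrite Cmod_diag. lra.
    rewrite Cmod_minus_sym. lra. }
  apply Cminus_eq_0 in Eq.
  destruct (Hphi q ltac:(lra)) as [P1 [P2 [P3 _]]].
  pose proof (Cmod_dist q a v) as T1. fold ta in T1.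
  pose proof (Cmod_dist a q v) as T2. fold ta in T2. rewrite (Cmod_minus_sym a q) in T2.
  assert (Dq : cderiv g q (cder g q)) by (apply (holo_cder g a q ta); auto; lra).
  assert (Dp : cderiv g (phi q) (cder g (phi q))).
  { apply cder_correct, Hg; auto. lra. }
  assert (Dphi : cderiv phi q (cder phi q)) by (apply (holo_cder phi a q (2 * r)); auto; lra).
  exists q, (cder g (phi q) * cder g q). rewrite Eq.
  split. { intros E. rewrite E, Cmod_minus_sym in Hq. fold ta in Hq. lra. }
  split. lra. split; auto. split. lra. split; auto.
  split. { intros E. rewrite E in P2. lra. }
  split. { apply (cderiv_comp g g). rewrite Eq. exact Dp. exact Dq. }
  intros Nc. assert (Hc : 0 < c) by (apply Cmod_pos; auto).
  assert (CH : cder g (phi q) * cder phi q = 1).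
  { apply cderiv_unique with (fun z => g (phi z)) q.
    apply (cderiv_comp g phi); auto.
    apply cderiv_ext_loc with (fun z => z) r; auto. 2: apply cderiv_id.
    intros w Hw. symmetry. apply Hphi. pose proof (Cmod_dist w q a). lra. }
  (* Cauchy's estimate is applied to phi - v, which is small, on radius r round q. With the chain
     rule [CH] it gives |g'(g q)| >= 2 r / eps; as |g'(q)| >= c / 2, the multiplier has modulus at
     least r c / eps. *)
  assert (CE : Cmod (cder phi q) * r <= eps / 2).
  { rewrite <- (cder_unique (fun z => phi z - v) q (cder phi q)).
    2:{ apply cderiv_eq with (cder phi q - 0). ring. apply cderiv_minus; auto. apply cderiv_const. }
    assert (INq : forall z, Cmod (z - q) < r -> Cmod (z - a) < 2 * r).
    { intros z Hz. pose proof (Cmod_dist z q a). lra. }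
    apply cauchy_estimate; auto.
    - apply holo_minus; [|apply holo_const]. intros z Hz. apply Hphol, INq, Hz.
    - intros z Hz. specialize (INq z Hz). destruct (Hphi z ltac:(lra)) as [_ [H2 _]]. lra. }
  apply (f_equal Cmod) in CH. rewrite Cmod_mult, Cmod_1 in CH.
  rewrite Cmod_mult. specialize (Hlow q ltac:(lra)). fold c in Hlow.
  set (X := Cmod (cder g (phi q))) in *. set (Y := Cmod (cder phi q)) in *. set (Z := Cmod (cder g q)) in *.
  assert (PX : 0 <= X) by apply Cmod_ge_0. assert (PY : 0 <= Y) by apply Cmod_ge_0.
  assert (XB : r <= X * (eps / 2)).
  { replace r with (X * Y * r)%R by (rewrite CH; ring). rewrite Rmult_assoc. apply Rmult_le_compat_l; auto. }
  apply Rle_lt_trans with (Rabs K). apply Rle_abs.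
  assert (S1 : r * c <= X * Z * eps).
  { apply Rle_trans with (X * (eps / 2) * (2 * Z))%R; [|right; field].
    apply Rmult_le_compat; lra. }
  assert (4 * (Rabs K + 1) <= X * Z).
  { apply Rmult_le_reg_r with eps; auto. specialize (E4 Hc).
    assert (eps * (4 * (Rabs K + 1)) <= e4 * (4 * (Rabs K + 1))) by (apply Rmult_le_compat_r; lra). lra. }
  lra.
Qed.

(** Each new point is taken closer to v than all previous ones, which makes it distinct from
    them. *)
Lemma distinct_points_near (P : C -> Prop) (v : C) (delta : R) (n : nat) : 0 < delta ->
  (forall d, 0 < d -> exists z, z <> v /\ Cmod (z - v) < d /\ P z) ->
  exists l, NoDup l /\ length l = n /\ forall a, In a l -> a <> v /\ Cmod (a - v) < delta /\ P a.
Proof.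
  intros Hd H. induction n as [|n [l [ND [LEN Hl]]]].
  - exists nil. split. constructor. split; auto. intros a [].
  - destruct (positive_distance v l) as [d [Hd' HD]]. { intros a Ha. apply Hl; auto. }
    destruct (H (Rmin d delta)) as [z [Nz [Hz Pz]]]. apply Rmin_pos; auto.
    pose proof (Rmin_l d delta). pose proof (Rmin_r d delta).
    exists (z :: l). split; [|split].
    + constructor; auto. intros I. specialize (HD z I). lra.
    + simpl. auto.
    + intros a [<-|I]; auto. split; auto. split; auto. lra.
Qed.

Lemma filterlim_of_Cmod_bound (q : nat -> C) (v : C) :
  (forall n, Cmod (q n - v) < / (INR n + 1)) -> filterlim q eventually (locally v).
Proof.
  intros H P HP. apply locally_Cmod in HP. destruct HP as [d [Hd HP]].
  destruct (archimed_cor1 d Hd) as [N [HN1 HN2]]. exists N. intros n Hn. apply HP.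
  eapply Rlt_trans; [apply H|]. eapply Rle_lt_trans; [|apply HN1].
  apply Rinv_le_contravar. apply lt_0_INR; auto. apply le_INR in Hn. lra.
Qed.

Theorem mainTheorem2 (v : C) (W : C -> Prop) (g : C -> C) :
  closed_neighbourhood W v ->
  holomorphic_on g (punctured W v) ->
  essential_singularity g v ->
  ~ picard_exceptional_value g v ->
  (exists q : nat -> C,
     filterlim q eventually (locally v) /\
     (forall n : nat, in_2_cycle g (punctured W v) (q n))) /\
  (~ completely_ramified_value g v ->
   exists (q : nat -> C) (mu : nat -> C),
     filterlim q eventually (locally v) /\
     (forall n : nat, in_2_cycle g (punctured W v) (q n)) /\
     (forall n : nat, has_multiplier_2 g (q n) (mu n)) /\
     (forall n : nat, repulsive (mu n)) /\
     filterlim (fun n : nat => Cmod (mu n)) eventually (Rbar_locally p_infty)).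
Proof.
  intros [_ HW] _ [Hess [Hrem Hpole]] Hpic.
  apply locally_Cmod in HW. destruct HW as [dW [HdW HW]].
  apply locally'_Cmod in Hess. destruct Hess as [rho [Hr Hg']].
  assert (Hg : holo_punctured g v rho).
  { intros z Nz Hz. apply ex_derive_cderiv. auto. }
  (* A bounded g would extend holomorphically over v by [riemann_removable]. *)
  assert (HNB : ~ bounded_near g v).
  { intros [M [d [Hd HM]]]. apply Hrem.
    set (s := Rmin d rho). assert (Hs : 0 < s) by (apply Rmin_pos; auto).
    pose proof (Rmin_l d rho). pose proof (Rmin_r d rho). fold s in H, H0.
    destruct (riemann_removable g v s M Hs) as [h [Hh E]].
    - intros z Nz Hz. apply Hg; auto. lra.
    - intros z Nz Hz. apply HM; auto. lra.
    - exists h. split.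
      + apply locally_Cmod. exists s. split; auto. intros z Hz. apply ex_derive_cderiv, Hh, Hz.
      + apply locally'_Cmod. exists s. split; auto. }
  (* Its negation says that |g| tends to infinity at v, which is a pole. *)
  assert (HFB : frequently_bounded g v).
  { apply NNPP. intros N. apply Hpole. intros P [M HP].
    apply locally'_Cmod. apply NNPP. intros N2. apply N. exists M. intros d Hd.
    apply NNPP. intros N3. apply N2. exists d. split; auto. intros z Nz Hz. apply HP.
    apply Rnot_le_lt. intros L. apply N3. now exists z. }
  (* P is a condition on the preimages of v: always true for the first assertion, g' <> 0 for the
     second. The one index n drives both the approach to v and the size of the multiplier. *)
  assert (KEY : forall P : C -> Prop, (forall d, 0 < d -> exists z, z <> v /\ Cmod (z - v) < d /\ (g z = v /\ P z)) ->
    forall n : nat, exists qm : C * C, Cmod (fst qm - v) < / (INR n + 1) /\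
      in_2_cycle g (punctured W v) (fst qm) /\ has_multiplier_2 g (fst qm) (snd qm) /\
      ((forall z, Cmod (z - v) < rho -> P z -> cder g z <> 0) -> INR n + 1 < Cmod (snd qm))).
  { intros P HP n. pose proof (pos_INR n).
    assert (Pn : 0 < / (INR n + 1)) by (apply Rinv_0_lt_compat; lra).
    (* dW keeps q and g q in W, rho / 2 is the range required by [two_cycles_near_preimages], and 1
       / (n + 1) forces convergence to v. *)
    set (delta := Rmin dW (Rmin (rho / 2) (/ (INR n + 1)))).
    assert (Hd : 0 < delta) by (repeat apply Rmin_pos; lra).
    assert (D1 : delta <= dW) by apply Rmin_l.
    assert (D2 : delta <= rho / 2) by (eapply Rle_trans; [apply Rmin_r|apply Rmin_l]).
    assert (D3 : delta <= / (INR n + 1)) by (eapply Rle_trans; [apply Rmin_r|apply Rmin_r]).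
    clearbody delta.
    destruct (distinct_points_near (fun z => g z = v /\ P z) v delta 5 Hd HP) as [l [ND [LEN Hl]]].
    destruct (two_cycles_near_preimages g v rho delta l Hr Hg HNB HFB ND LEN) as [a [Ha HK]].
    { intros a Ha. destruct (Hl a Ha) as [A1 [A2 [A3 _]]]. repeat split; auto. lra. }
    destruct (HK (INR n + 1)%R) as [q [mu [Q1 [Q2 [Q3 [Q4 [Q5 [Q6 [Q7 Q8]]]]]]]]].
    exists (q, mu). simpl. split. lra. split; [|split].
    - split; [|split; [|split]]; auto; split; auto; apply HW; lra.
    - now apply is_derive_cderiv.
    - intros HPd. apply Q8. destruct (Hl a Ha) as [A1 [A2 [_ A3]]]. apply HPd; auto. lra. }
  split.
  (* Preimages of v accumulate at v because v is not a Picard exceptional value. *)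
  - destruct (choice _ (KEY (fun _ => True) ltac:(
      intros d Hd; apply NNPP; intros N; apply Hpic, locally'_Cmod; exists d; split; auto;
      intros z Nz Hz E; apply N; exists z; auto))) as [qm Hqm].
    exists (fun n => fst (qm n)). split.
    + apply filterlim_of_Cmod_bound. intros n. apply Hqm.
    + intros n. apply Hqm.
  - intros Hcr.
    (* If v is not completely ramified, preimages where 0 is not a derivative of g accumulate at v.
       Within rho of v the function g is differentiable, so [cder g z] is its true derivative there,
       and is nonzero. *)
    destruct (choice _ (KEY (fun z => cder g z <> 0) ltac:(
      intros d Hd; apply NNPP; intros N; apply Hcr, locally'_Cmod; exists (Rmin d rho); split;
      [apply Rmin_pos; auto|]; intros z Nz Hz E; apply is_derive_cderiv, NNPP; intros D; apply N;
      pose proof (Rmin_l d rho); pose proof (Rmin_r d rho);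
      exists z; split; auto; split; [lra|split; auto]; intros D0; apply D; rewrite <- D0;
      apply cder_correct, Hg; auto; lra))) as [qm Hqm].
    assert (BIG : forall n, INR n + 1 < Cmod (snd (qm n))).
    { intros n. destruct (Hqm n) as [_ [_ [_ H]]]. apply H. auto. }
    exists (fun n => fst (qm n)), (fun n => snd (qm n)). split; [|split; [|split; [|split]]].
    + apply filterlim_of_Cmod_bound. intros n. apply Hqm.
    + intros n. apply Hqm.
    + intros n. apply Hqm.
    + intros n. unfold repulsive. specialize (BIG n). pose proof (pos_INR n). lra.
    + intros P [M HP]. destruct (INR_unbounded M) as [N HN]. exists N. intros n Hn. apply HP.
      specialize (BIG n). apply le_INR in Hn. lra.
Qed.
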